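(* Permutation Orbit Local Minimization (PLOM) is PLS-complete even when restricted to instances in which the given permutations $\pi_1,\dots,\pi_k$ pairwise commute.
   Context: PLS (Polynomial Local Search) is the class of local optimization problems in which a starting feasible solution and the neighborhood of a solution are computable in polynomial time, feasibility is recognizable in polynomial time, and one must output a local optimum. PLS-completeness is with respect to PLS-reductions (polynomial-time maps $f$ on instances and $g$ mapping local optima of $f(I)$ back to local optima of $I$). PLOM: the input is a set of positions $V=\{1,\dots,n\}$, permutations $\pi_1,\dots,\pi_k\in S_V$, and a string $s:V\to\{0,1\}$. A solution is a permutation $\sigma$ in the group $\langle\pi_1,\dots,\pi_k\rangle$ generated by the $\pi_i$ (given explicitly as a permutation); it is a local minimum if the string $v=s\circ\sigma$ satisfies $v\circ\pi_i\ge_{\mathrm{lex}} v$ for all $i=1,\dots,k$, where strings are compared lexicographically with position $1$ most significant. The task is to output such a local minimum $\sigma$. *)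

(* Defs.v *)
From HB Require Import structures.
From mathcomp Require Import all_boot all_order all_algebra all_fingroup.

Set Implicit Arguments.
Unset Strict Implicit.
Unset Printing Implicit Defensive.

Definition bits := seq bool.

(* Self-delimiting code <w_1, ..., w_m> of a list of bit strings as one bit
   string: every bit b is written 1b, and every w_i is closed by a 0. *)
Definition code_word (w : bits) : bits :=
  flatten [seq [:: true; b] | b <- w] ++ [:: false].

Definition code (ws : seq bits) : bits := flatten (map code_word ws).

Inductive move := MoveLeft | Stay | MoveRight.

(* None is the blank, Some (inl b) an input/output bit, and Some (inr a) an
   auxiliary symbol. *)
Definition symbol (aux : finType) : finType := option (bool + aux)%type.

(* Deterministic multitape Turing machines. *)
Record machine := Machine {
  ntapes : nat; (* the machine has ntapes.+1 tapes *)
  state : finType;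
  aux : finType;
  start : state;
  halting : pred state;
  delta : state -> {ffun 'I_ntapes.+1 -> symbol aux} ->
          state * {ffun 'I_ntapes.+1 -> symbol aux * move}
}.

(* A two-way infinite tape: both lists start with the cell next to the head,
   and all the cells beyond them are blank. *)
Record tape (A : finType) := Tape {
  left_cells : seq (symbol A);
  scanned : symbol A;
  right_cells : seq (symbol A)
}.

Definition move_tape (A : finType) (m : move) (t : tape A) : tape A :=
  let: Tape l a r := t in
  match m with
  | MoveLeft => Tape (behead l) (head None l) (a :: r)
  | Stay => t
  | MoveRight => Tape (a :: l) (head None r) (behead r)
  end.

Definition write_tape (A : finType) (a : symbol A) (t : tape A) : tape A :=
  Tape (left_cells t) a (right_cells t).

Definition input_tape (A : finType) (w : bits) : tape A :=
  let cells := [seq Some (inl b) | b <- w] in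
  Tape [::] (head None cells) (behead cells).

Fixpoint leading_bits (A : finType) (cells : seq (symbol A)) : bits :=
  if cells is Some (inl b) :: cells' then b :: leading_bits cells' else [::].

Definition config (M : machine) : Type :=
  (state M * {ffun 'I_(ntapes M).+1 -> tape (aux M)})%type.

Definition init_config (M : machine) (w : bits) : config M :=
  (start M, [ffun i => input_tape (aux M) (if i == ord0 then w else [::])]).

Definition step (M : machine) (c : config M) : config M :=
  let: (q, ts) := c in
  if halting q then c else
  let: (q', acts) := delta q [ffun i => scanned (ts i)] in
  (q', [ffun i => move_tape (acts i).2 (write_tape (acts i).1 (ts i))]).

(* The output is the longest bit string that starts under the head of the last
   tape. *)
Definition output (M : machine) (c : config M) : bits :=
  let t := c.2 ord_max in leading_bits (scanned t :: right_cells t).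

(* step is the identity on halted configurations, so the machine halts within
   T steps. *)
Definition computes_within (M : machine) (w : bits) (T : nat) (y : bits) :=
  let c := iter T (@step M) (init_config M w) in
  halting c.1 /\ output c = y.

(* Some machine maps inp a to out a, for all a in dom, in time polynomial in the
   length of inp a. *)
Definition polytime_on (A : Type) (dom : A -> Prop) (inp out : A -> bits) :=
  exists (M : machine) (p : {poly nat}), forall a : A, dom a ->
    computes_within M (inp a) (horner p (size (inp a))) (out a).

Definition polytime_decidable_on (A : Type) (dom : A -> Prop) (inp : A -> bits)
    (P : A -> Prop) :=
  exists2 b : A -> bool, (forall a, dom a -> (P a <-> b a)) &
    polytime_on dom inp (fun a => [:: b a]).

Record search_problem := SearchProblem {
  is_instance : bits -> Prop;
  feasible : bits -> bits -> Prop; (* instance, solution *)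
  local_opt : bits -> bits -> Prop (* instance, solution *)
}.

Definition restrict (D : bits -> Prop) (P : search_problem) : search_problem :=
  {| is_instance := fun x => is_instance P x /\ D x;
     feasible := feasible P;
     local_opt := local_opt P |}.

Definition feasible_pair (P : search_problem) (xs : bits * bits) : Prop :=
  is_instance P xs.1 /\ feasible P xs.1 xs.2.

(* Most significant bit first. *)
Definition bits_val (w : bits) : nat := foldl (fun a (b : bool) => a.*2 + b) 0 w.

Definition better (maximize : bool) (c' c : bits) : bool :=
  if maximize then bits_val c < bits_val c' else bits_val c' < bits_val c.

Record PLS_structure (P : search_problem) := {
  pls_maximize : bool;
  pls_init : bits -> bits;
  pls_cost : bits -> bits -> bits; (* instance, solution; in binary *)
  pls_nbrs : bits -> bits -> seq bits; (* instance, solution *)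
  pls_size : exists p : {poly nat}, forall x s,
    is_instance P x -> feasible P x s -> size s <= horner p (size x);
  pls_instance_dec : polytime_decidable_on (fun=> True) id (is_instance P);
  pls_feasible_dec :
    polytime_decidable_on (fun xs => is_instance P xs.1)
      (fun xs => code [:: xs.1; xs.2]) (fun xs => feasible P xs.1 xs.2);
  pls_init_feasible : forall x, is_instance P x -> feasible P x (pls_init x);
  pls_init_poly : polytime_on (is_instance P) id pls_init;
  pls_cost_poly :
    polytime_on (feasible_pair P) (fun xs => code [:: xs.1; xs.2])
      (fun xs => pls_cost xs.1 xs.2);
  pls_nbrs_feasible : forall x s s', is_instance P x -> feasible P x s ->
    s' \in pls_nbrs x s -> feasible P x s';
  pls_nbrs_poly :
    polytime_on (feasible_pair P) (fun xs => code [:: xs.1; xs.2])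
      (fun xs => code (pls_nbrs xs.1 xs.2));
  pls_local_opt : forall x s, is_instance P x ->
    (local_opt P x s <->
     feasible P x s /\
     forall s', s' \in pls_nbrs x s ->
       ~~ better pls_maximize (pls_cost x s') (pls_cost x s))
}.

Definition in_PLS (P : search_problem) : Prop := inhabited (PLS_structure P).

Definition PLS_reducible (P Q : search_problem) : Prop :=
  exists (f : bits -> bits) (g : bits -> bits -> bits),
    [/\ polytime_on (is_instance P) id f,
        polytime_on
          (fun xs => is_instance P xs.1 /\ feasible Q (f xs.1) xs.2)
          (fun xs => code [:: xs.1; xs.2]) (fun xs => g xs.1 xs.2),
        forall x, is_instance P x -> is_instance Q (f x)
      & forall x s, is_instance P x -> local_opt Q (f x) s ->
          local_opt P x (g x s)].

Definition PLS_complete (Q : search_problem) : Prop :=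
  in_PLS Q /\ forall P, in_PLS P -> PLS_reducible P Q.

(* Permutation Orbit Local Minimization; the positions 1, ..., n are the
   elements 0, ..., n-1 of 'I_n. *)

Record plom_instance := PlomInstance {
  npos : nat;
  gens : seq 'S_npos;
  str : 'I_npos -> bool
}.

Arguments str : clear implicits.

Definition word_of (n : nat) (v : 'I_n -> bool) : bits :=
  [seq v i | i <- enum 'I_n].

(* seqlexi is the lexicographic order on lists; on bool, false < true. *)
Definition lex_le (n : nat) (v w : 'I_n -> bool) : bool :=
  ((word_of v : seqlexi bool) <= word_of w)%O.

Definition plom_solution (I : plom_instance) (sigma : 'S_(npos I)) : Prop :=
  sigma \in <<[set pi in gens I]>>%g.

Definition plom_local_min (I : plom_instance) (sigma : 'S_(npos I)) : Prop :=
  let v := str I \o sigma in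
  forall pi, pi \in gens I -> lex_le v (v \o pi).

(* The concatenation of the values of sigma, each written in unary. *)
Definition enc_perm (n : nat) (sigma : 'S_n) : bits :=
  flatten [seq nseq (sigma i) true ++ [:: false] | i <- enum 'I_n].

Definition enc_instance (I : plom_instance) : bits :=
  code (word_of (str I) :: [seq enc_perm pi | pi <- gens I]).

Definition PLOM : search_problem :=
  {| is_instance := fun x => exists I, x = enc_instance I;
     feasible := fun x y => exists I (sigma : 'S_(npos I)),
       [/\ x = enc_instance I, y = enc_perm sigma & plom_solution sigma];
     local_opt := fun x y => exists I (sigma : 'S_(npos I)),
       [/\ x = enc_instance I, y = enc_perm sigma, plom_solution sigma
         & plom_local_min sigma] |}.

Definition commuting (I : plom_instance) : Prop :=
  {in gens I &, forall pi rho, commute pi rho}.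

Definition PLOM_commuting : search_problem :=
  restrict (fun x => exists2 I, commuting I & x = enc_instance I) PLOM.

(* Main.v *)
(** Membership of PLOM in PLS is the polynomial-time membership test for
    permutation groups: keep a table of group elements indexed by (first moved
    point, its image), sift products of elements through it, and add nontrivial
    residues until all products sift to the identity.

    For hardness, the local search of a problem P in PLS is written as one
    polynomial-time map a |-> (next a, cost a) on registers of fixed length,
    computed by a circuit (a Turing machine tableau whose cells are indexed by
    their distance to the head, so that each depends on boundedly many others).
    Take two copies of the circuit, with a free value for every gate, and a
    control bit z that names the master copy. Minimize lexicographically, in
    this order: the violated gates of the master; the cost of the master; the
    disagreements of the input of the slave with next of the master; the violated
    gates of the slave. Flipping a gate affects only later gates, so in a local
    minimum for single flips all gates are correct and the slave computes on
    next a; since flipping z does not help, next a is not better than a.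

    Each of these conditions depends on boundedly many bits. It becomes a block
    of 2^r positions listing its truth table, on which flipping a variable acts
    by exclusive or. These flips commute, and the first positions of the blocks
    display the conditions in order of priority. *)

From mathcomp Require Import all_boot all_order all_algebra all_fingroup zify.
From Stdlib Require Import FunctionalExtensionality Classical.
Require Import Defs.

Set Implicit Arguments.
Unset Strict Implicit.
Unset Printing Implicit Defensive.
Import GRing.Theory.

(** * Register programs and their compilation to Turing machines *)

(** Polynomial time is defined by Turing machines, which are awkward to compose. All algorithms are
    therefore written in a small language of bit stacks, equivalent to the machines in both
    directions: the machines of a problem in PLS become subroutines, and the resulting map on
    registers becomes a machine again, of which the tableau is taken. A gate of the tableau reads
    four cells in one-hot code, so the number of slots of a constraint depends on the machine only
    and truth tables have constant size. The string of a solution shows violations, not variables,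
    yet local optima must be mapped back to registers. Hence every variable also gets a block whose
    table is constantly 0. These blocks come first in the order and never affect a comparison, but
    the permutation moves the leading position of such a block exactly when the variable is set. A
    register is free to hold any word of its length, feasible or not. The successor map must
    therefore be defined on all of them, and its costs must have fixed length to be compared bit by
    bit. *)

Definition env := nat -> bits.

Definition upd (e : env) (r : nat) (w : bits) : env :=
  fun i => if i == r then w else e i.

(** Every register is a stack of bits, and [Case] and [Loop] pop the bit they test. The body of a
    [Loop] may push onto the tested register, which gives the while loops needed to simulate
    machines. *)
Inductive prog :=
| Skip
| Push of nat & bool
| Case of nat & prog & prog & prog
| Seq of prog & prog
| Loop of nat & prog & prog.

(** The clock counts the steps of the compiled machine: two for a push (move left, then write), one
    for each test and for each exit from a body, one for the passage inside a sequence. *)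
Inductive exec : prog -> env -> nat -> env -> Prop :=
| ExecSkip e : exec Skip e 0 e
| ExecPush r b e : exec (Push r b) e 2 (upd e r (b :: e r))
| ExecCase0 r p0 pf pt e t e' :
    e r = [::] -> exec p0 e t e' -> exec (Case r p0 pf pt) e t.+2 e'
| ExecCase1 r p0 pf pt e b w t e' :
    e r = b :: w -> exec (if b then pt else pf) (upd e r w) t e' ->
    exec (Case r p0 pf pt) e t.+2 e'
| ExecSeq p q e t e1 t' e2 :
    exec p e t e1 -> exec q e1 t' e2 -> exec (Seq p q) e (t + t'.+1) e2
| ExecLoop0 r pf pt e : e r = [::] -> exec (Loop r pf pt) e 1 e
| ExecLoop1 r pf pt e b w t e1 t' e2 :
    e r = b :: w -> exec (if b then pt else pf) (upd e r w) t e1 ->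
    exec (Loop r pf pt) e1 t' e2 ->
    exec (Loop r pf pt) e (t + t'.+1).+1 e2.

Fixpoint regs (p : prog) : nat :=
  match p with
  | Skip => 0
  | Push r _ => r
  | Case r p0 pf pt => maxn r (maxn (regs p0) (maxn (regs pf) (regs pt)))
  | Seq p q => maxn (regs p) (regs q)
  | Loop r pf pt => maxn r (maxn (regs pf) (regs pt))
  end.

Section Compile.

Variable N : nat.

Notation sym := (symbol void).
Notation reads := {ffun 'I_N.+1 -> sym}.
Notation acts := {ffun 'I_N.+1 -> sym * move}.
Notation tapes := {ffun 'I_N.+1 -> tape void}.

Record frag := Frag {
  fstate : finType;
  fini : fstate;
  ffin : fstate;
  fdelta : fstate -> reads -> fstate * acts
}.

Definition fstep (F : frag) (c : fstate F * tapes) : fstate F * tapes :=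
  let: (q, ts) := c in
  let: (q', a) := fdelta q [ffun i => scanned (ts i)] in
  (q', [ffun i => move_tape (a i).2 (write_tape (a i).1 (ts i))]).

Inductive reach (F : frag) :
    fstate F * tapes -> nat -> fstate F * tapes -> Prop :=
| Reach0 c : reach c 0 c
| ReachS c n c' : c.1 != ffin F -> reach (fstep c) n c' -> reach c n.+1 c'.

Lemma reach_trans (F : frag) (c c1 c2 : fstate F * tapes) n m :
  reach c n c1 -> reach c1 m c2 -> reach c (n + m) c2.
Proof. by elim=> [//|c0 n0 c' h _ IH] /IH; apply: ReachS. Qed.

Lemma reach1 (F : frag) (c c' : fstate F * tapes) :
  c.1 != ffin F -> fstep c = c' -> reach c 1 c'.
Proof. by move=> h <-; apply: ReachS => //; apply: Reach0. Qed.

(** Agreement is demanded only away from the final state of [F1], where the enclosing fragment takes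
    its own transition. Since [reach] never steps from a final state, runs carry over unchanged. *)
Lemma reach_embed (F1 F : frag) (f : fstate F1 -> fstate F) :
  (forall q r, q != ffin F1 ->
     fdelta (f q) r = (f (fdelta q r).1, (fdelta q r).2)) ->
  (forall q, q != ffin F1 -> f q != ffin F) ->
  forall c n c', reach c n c' -> reach (f c.1, c.2) n (f c'.1, c'.2).
Proof.
move=> fd ff c n c'; elim=> [c0|[q ts] m c0 /= hq _ IH]; first exact: Reach0.
apply: ReachS; first exact: ff.
by move: IH => /=; rewrite fd //; case: (fdelta _ _).
Qed.

Definition idle (r : reads) : acts := [ffun i => (r i, Stay)].

Definition act_on (k : 'I_N.+1) (a : sym * move) (r : reads) : acts :=
  [ffun i => if i == k then a else (r i, Stay)].

Lemma idle_tapes (ts : tapes) :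
  [ffun i => move_tape (idle [ffun i => scanned (ts i)] i).2
    (write_tape (idle [ffun i => scanned (ts i)] i).1 (ts i))] = ts.
Proof. by apply/ffunP=> i; rewrite !ffunE /=; case: (ts i). Qed.

Definition upd_tape (ts : tapes) (k : 'I_N.+1) (t : tape void) : tapes :=
  [ffun i => if i == k then t else ts i].

Lemma act_on_tapes (ts : tapes) k a :
  [ffun i => move_tape (act_on k a [ffun i => scanned (ts i)] i).2
    (write_tape (act_on k a [ffun i => scanned (ts i)] i).1 (ts i))]
  = upd_tape ts k (move_tape a.2 (write_tape a.1 (ts k))).
Proof.
apply/ffunP=> i; rewrite !ffunE; case: eqP => [->//|_].
by case: (ts i).
Qed.

Definition skip_frag : frag :=
  @Frag unit tt tt (fun _ r => (tt, idle r)).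

Definition push_frag (k : 'I_N.+1) (b : bool) : frag :=
  @Frag (option bool) None (Some true) (fun q r =>
    if q is None then (Some false, act_on k (r k, MoveLeft) r)
    else (Some true, act_on k (Some (inl b), Stay) r)).

Definition seq_frag (F G : frag) : frag :=
  @Frag (fstate F + fstate G)%type (inl (fini F)) (inr (ffin G)) (fun q r =>
    match q with
    | inl q1 => if q1 == ffin F then (inr (fini G), idle r)
                else (inl (fdelta q1 r).1, (fdelta q1 r).2)
    | inr q2 => (inr (fdelta q2 r).1, (fdelta q2 r).2)
    end).

(* None is the test state; Some None is the exit. *)
Definition case_frag (k : 'I_N.+1) (F0 Ff Ft : frag) : frag :=
  @Frag (option (option (fstate F0 + (fstate Ff + fstate Ft))))%type
    None (Some None) (fun q r =>
    match q with
    | None =>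
      match r k with
      | Some (inl false) =>
          (Some (Some (inr (inl (fini Ff)))), act_on k (None, MoveRight) r)
      | Some (inl true) =>
          (Some (Some (inr (inr (fini Ft)))), act_on k (None, MoveRight) r)
      | _ => (Some (Some (inl (fini F0))), idle r)
      end
    | Some None => (Some None, idle r)
    | Some (Some (inl q)) => if q == ffin F0 then (Some None, idle r) else
        (Some (Some (inl (fdelta q r).1)), (fdelta q r).2)
    | Some (Some (inr (inl q))) => if q == ffin Ff then (Some None, idle r) else
        (Some (Some (inr (inl (fdelta q r).1))), (fdelta q r).2)
    | Some (Some (inr (inr q))) => if q == ffin Ft then (Some None, idle r) else
        (Some (Some (inr (inr (fdelta q r).1))), (fdelta q r).2)
    end).

Definition loop_frag (k : 'I_N.+1) (Ff Ft : frag) : frag :=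
  @Frag (option (option (fstate Ff + fstate Ft)))%type
    None (Some None) (fun q r =>
    match q with
    | None =>
      match r k with
      | Some (inl false) =>
          (Some (Some (inl (fini Ff))), act_on k (None, MoveRight) r)
      | Some (inl true) =>
          (Some (Some (inr (fini Ft))), act_on k (None, MoveRight) r)
      | _ => (Some None, idle r)
      end
    | Some None => (Some None, idle r)
    | Some (Some (inl q)) => if q == ffin Ff then (None, idle r) else
        (Some (Some (inl (fdelta q r).1)), (fdelta q r).2)
    | Some (Some (inr q)) => if q == ffin Ft then (None, idle r) else
        (Some (Some (inr (fdelta q r).1)), (fdelta q r).2)
    end).

Fixpoint compile (p : prog) : frag :=
  match p with
  | Skip => skip_frag
  | Push r b => push_frag (inord r) b
  | Case r p0 pf pt =>
      case_frag (inord r) (compile p0) (compile pf) (compile pt)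
  | Seq p q => seq_frag (compile p) (compile q)
  | Loop r pf pt => loop_frag (inord r) (compile pf) (compile pt)
  end.

(* The stack w has its top under the head; everything else is blank. *)
Definition holds (t : tape void) (w : bits) : Prop :=
  all (pred1 None) (left_cells t) /\
  exists n, scanned t :: right_cells t
            = [seq Some (inl b) | b <- w] ++ nseq n None.

Definition holds_all (ts : tapes) (e : env) : Prop :=
  forall i : 'I_N.+1, holds (ts i) (e i).

Lemma holds_upd (ts : tapes) e (r : nat) t w : r <= N ->
  holds_all ts e -> holds t w ->
  holds_all (upd_tape ts (inord r) t) (upd e r w).
Proof.
move=> hr h ht i; rewrite ffunE /upd.
have -> : (i == inord r) = (val i == r) by rewrite -val_eqE /= inordK.
by case: eqP.
Qed.

Lemma holds_at (ts : tapes) e (r : nat) : r <= N -> holds_all ts e ->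
  holds (ts (inord r)) (e r).
Proof. by move=> hr /(_ (inord r)); rewrite inordK. Qed.

Lemma holds_nil t : holds t [::] -> scanned t = None.
Proof. by case: t => l a r [_ [[|n] //= [->]]]. Qed.

Lemma holds_cons t b w : holds t (b :: w) ->
  scanned t = Some (inl b) /\
  holds (move_tape MoveRight (write_tape None t)) w.
Proof.
case: t => l a r [/= hl [n [-> hr]]]; split=> //; split=> //=.
case: r hr => [|a' r] hr /=; last by exists n.
by exists 1; case: w hr => //; case: n.
Qed.

Lemma holds_push t b w : holds t w ->
  holds (write_tape (Some (inl b)) (move_tape MoveLeft (write_tape (scanned t) t)))
        (b :: w).
Proof.
case: t => l a r [/= hl [n hr]]; split=> /=; first by case: l hl => //= ? ? /andP[].
by exists n; rewrite hr.
Qed.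

Lemma compile_correct p e t e' : exec p e t e' -> regs p <= N ->
  forall ts, holds_all ts e ->
  exists2 ts', reach (fini (compile p), ts) t (ffin (compile p), ts')
             & holds_all ts' e'.
Proof.
elim=> {p e t e'}.
- by move=> e _ ts h; exists ts => //; apply: Reach0.
- move=> r b e /= hr ts h.
  exists (upd_tape ts (inord r) (write_tape (Some (inl b)) (move_tape MoveLeft
     (write_tape (scanned (ts (inord r))) (ts (inord r)))))); last first.
    by apply: holds_upd => //; apply: holds_push; apply: holds_at.
  apply: ReachS => //; apply: reach1 => //=.
  rewrite act_on_tapes /= !ffunE act_on_tapes; congr (_, _).
  by apply/ffunP=> i; rewrite !ffunE eqxx; case: eqP.
- move=> r p0 pf pt e t e' er _ IH /=; rewrite !geq_max => /and4P[hr h0 hf ht] ts h.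
  have [ts' R' h'] := IH h0 ts h; exists ts' => //.
  have sn : scanned (ts (inord r)) = None.
    by apply: holds_nil; rewrite -er; apply: holds_at.
  apply: ReachS => //=; rewrite ffunE sn idle_tapes -(addn1 t).
  pose F := case_frag (inord r) (compile p0) (compile pf) (compile pt).
  apply: (@reach_trans F _ (Some (Some (inl (ffin (compile p0)))), ts')).
    by apply: (@reach_embed _ F (fun q => Some (Some (inl q))) _ _ _ _ _ R')
       => //= q rd /negPf ->.
  by apply: reach1 => //=; rewrite eqxx idle_tapes.
- move=> r p0 pf pt e b w t e' er _ IH /=.
  rewrite !geq_max => /and4P[hr h0 hf ht] ts h.
  have [sn hw] : scanned (ts (inord r)) = Some (inl b) /\
      holds (move_tape MoveRight (write_tape None (ts (inord r)))) w.
    by apply: holds_cons; rewrite -er; apply: holds_at.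
  have [|ts' R' h'] := IH _ _ (holds_upd hr h hw); first by case: (b).
  exists ts' => //.
  apply: ReachS => //=; rewrite ffunE sn -(addn1 t).
  pose F := case_frag (inord r) (compile p0) (compile pf) (compile pt).
  case: b er sn IH R' => er sn IH R'; rewrite act_on_tapes.
    apply: (@reach_trans F _ (Some (Some (inr (inr (ffin (compile pt))))), ts')).
      by apply: (@reach_embed _ F (fun q => Some (Some (inr (inr q)))) _ _ _ _ _ R')
       => //= q rd /negPf ->.
    by apply: reach1 => //=; rewrite eqxx idle_tapes.
  apply: (@reach_trans F _ (Some (Some (inr (inl (ffin (compile pf))))), ts')).
    by apply: (@reach_embed _ F (fun q => Some (Some (inr (inl q)))) _ _ _ _ _ R')
     => //= q rd /negPf ->.
  by apply: reach1 => //=; rewrite eqxx idle_tapes.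
- move=> p q e t e1 t' e2 _ IH1 _ IH2 /=; rewrite geq_max => /andP[hp hq] ts h.
  have [ts1 R1 h1] := IH1 hp ts h; have [ts2 R2 h2] := IH2 hq ts1 h1.
  exists ts2 => //; pose F := seq_frag (compile p) (compile q).
  apply: (@reach_trans F _ (inl (ffin (compile p)), ts1)).
    by apply: (@reach_embed _ F inl _ _ _ _ _ R1) => //= q0 rd /negPf ->.
  apply: ReachS => //=; rewrite eqxx idle_tapes.
  by apply: (@reach_embed _ F inr _ _ _ _ _ R2).
- move=> r pf pt e er /=; rewrite !geq_max => /and3P[hr _ _] ts h.
  exists ts => //; apply: reach1 => //=; rewrite ffunE.
  have -> : scanned (ts (inord r)) = None.
    by apply: holds_nil; rewrite -er; apply: holds_at.
  by rewrite idle_tapes.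
- move=> r pf pt e b w t e1 t' e2 er _ IH1 _ IH2 /= hN; have := hN.
  rewrite !geq_max => /and3P[hr hf ht] ts h.
  have [sn hw] : scanned (ts (inord r)) = Some (inl b) /\
      holds (move_tape MoveRight (write_tape None (ts (inord r)))) w.
    by apply: holds_cons; rewrite -er; apply: holds_at.
  have [|ts1 R1 h1] := IH1 _ _ (holds_upd hr h hw); first by case: (b).
  have [ts2 R2 h2] := IH2 hN _ h1.
  exists ts2 => //.
  apply: ReachS => //=; rewrite ffunE sn.
  pose F := loop_frag (inord r) (compile pf) (compile pt).
  case: b er sn IH1 R1 => er sn IH1 R1; rewrite act_on_tapes.
    apply: (@reach_trans F _ (Some (Some (inr (ffin (compile pt)))), ts1)).
      by apply: (@reach_embed _ F (fun q => Some (Some (inr q))) _ _ _ _ _ R1)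
       => //= q rd /negPf ->.
    by apply: ReachS => //=; rewrite eqxx idle_tapes.
  apply: (@reach_trans F _ (Some (Some (inl (ffin (compile pf)))), ts1)).
    by apply: (@reach_embed _ F (fun q => Some (Some (inl q))) _ _ _ _ _ R1)
     => //= q rd /negPf ->.
  by apply: ReachS => //=; rewrite eqxx idle_tapes.
Qed.

Definition frag_machine (F : frag) : machine :=
  @Machine N (fstate F) void (fini F) (pred1 (ffin F)) (@fdelta F).

(** A halted machine stands still, so the exact count of [reach] may be replaced by any larger
    time. *)
Lemma reach_iter (F : frag) c n c' : reach c n c' -> c'.1 = ffin F ->
  forall T, n <= T -> iter T (@step (frag_machine F)) c = c'.
Proof.
have halt T (q : fstate F * tapes) : q.1 = ffin F ->
  iter T (@step (frag_machine F)) q = q.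
  by case: q => q ts /= ->; elim: T => //= T ->; rewrite /= eqxx.
elim=> [c0|c0 m c1 hc _ IH] hq T; first by move=> _; apply: halt.
case: T => // T hT; rewrite iterSr -[RHS](IH hq T hT); congr iter.
by case: c0 hc {IH} => q ts /= /negPf ->.
Qed.

End Compile.

Definition mk (l : seq bits) : env := fun i => nth [::] l i.

Lemma exec_machine p N w t e' : regs p <= N ->
  exec p (mk [:: w]) t e' -> forall T, t <= T ->
  computes_within (frag_machine (compile N p)) w T (e' N).
Proof.
move=> hN E T hT.
have h0 : @holds_all N [ffun i : 'I_N.+1 => input_tape void (if i == ord0 then w else [::])]
    (mk [:: w]).
  move=> i; rewrite ffunE; split=> //=; rewrite -val_eqE /=.
  case: i => [[|i] ?] /=; last by exists 1; rewrite /mk /= nth_nil.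
  by case: w {E} => [|b w] /=; [exists 1 | exists 0; rewrite cats0].
have [ts' R h'] := compile_correct E hN h0.
rewrite /computes_within /init_config (reach_iter R erefl hT); split; first exact: eqxx.
have [_ [n E']] := h' ord_max.
rewrite -[output _]/(leading_bits (scanned (ts' ord_max) :: right_cells (ts' ord_max))) E' /=.
by elim: (e' N) {E'} => /= [|b u ->] //; case: n.
Qed.

(** * Time bounds and elementary register programs *)

Definition execT (p : prog) (e : env) (T : nat) (e' : env) : Prop :=
  exists2 t, exec p e t e' & t <= T.

Lemma execT_le p e T T' e' : T <= T' -> execT p e T e' -> execT p e T' e'.
Proof. by move=> h [t E ht]; exists t => //; apply: leq_trans h. Qed.

Lemma execT_seq p q e T e1 T' e2 :
  execT p e T e1 -> execT q e1 T' e2 -> execT (Seq p q) e (T + T').+1 e2.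
Proof.
move=> [t E ht] [t' E' ht']; exists (t + t'.+1); first exact: ExecSeq E E'.
by rewrite addnS ltnS leq_add.
Qed.

Lemma execT_skip e : execT Skip e 0 e.
Proof. by exists 0 => //; apply: ExecSkip. Qed.

Lemma execT_push r b e : execT (Push r b) e 2 (upd e r (b :: e r)).
Proof. by exists 2 => //; apply: ExecPush. Qed.

Lemma execT_case0 r p0 pf pt e T e' : e r = [::] -> execT p0 e T e' ->
  execT (Case r p0 pf pt) e T.+2 e'.
Proof. by move=> er [t E ht]; exists t.+2 => //; apply: ExecCase0. Qed.

Lemma execT_case1 r p0 pf pt e b w T e' : e r = b :: w ->
  execT (if b then pt else pf) (upd e r w) T e' ->
  execT (Case r p0 pf pt) e T.+2 e'.
Proof. by move=> er [t E ht]; exists t.+2 => //; apply: ExecCase1 E. Qed.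

(** No unit of time adds more than one bit to a register, so a time bound is also a bound on the
    size of results. *)
Lemma exec_size p e t e' : exec p e t e' ->
  forall r, size (e' r) <= size (e r) + t.
Proof.
have us (e0 : env) r b w i : e0 r = b :: w -> size (upd e0 r w i) <= size (e0 i).
  by move=> er; rewrite /upd; case: eqP => // ->; rewrite er leqnSn.
elim=> {p e t e'} [e r|r b e i|r p0 pf pt e t e' _ _ IH i
  |r p0 pf pt e b w t e' er _ IH i|p q e t e1 t' e2 _ IH _ IH' i
  |r pf pt e _ i|r pf pt e b w t e1 t' e2 er _ IH _ IH' i].
- by rewrite addn0.
- by rewrite /upd; case: eqP => [->|_] /=; lia.
- by move: (IH i); lia.
- by move: (IH i) (us e r b w i er); lia.
- by move: (IH i) (IH' i); lia.
- by lia.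
- by move: (IH i) (IH' i) (us e r b w i er); lia.
Qed.

Lemma execT_size p e T e' r : execT p e T e' -> size (e' r) <= size (e r) + T.
Proof. by move=> [t E ht]; have := exec_size E r; lia. Qed.

(** [I w s] is the environment in which the tested register holds [w] and the rest is described by
    [s]. When the body leaves the tested register alone, the loop is a left fold over its
    content. *)
Lemma exec_loop (S : Type) (I : bits -> S -> env) (f : S -> bool -> S) r pf pt c :
  (forall w s, I w s r = w) ->
  (forall b w s, execT (if b then pt else pf) (upd (I (b :: w) s) r w) c
                       (I w (f s b))) ->
  forall w s, execT (Loop r pf pt) (I w s) (c.+2 * size w).+1 (I [::] (foldl f s w)).
Proof.
move=> Ir H; elim=> [|b w IH] s /=.
  by exists 1 => //; apply: ExecLoop0.
have [t E ht] := H b w s; have [t' E' ht'] := IH (f s b).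
exists (t + t'.+1).+1; last by lia.
by apply: ExecLoop1 E E'; rewrite Ir.
Qed.

Lemma updE e r w : upd e r w r = w.
Proof. by rewrite /upd eqxx. Qed.

Lemma updN e r w i : i != r -> upd e r w i = e i.
Proof. by rewrite /upd => /negPf ->. Qed.

Lemma upd_upd e r w w' : upd (upd e r w) r w' = upd e r w'.
Proof. by apply: functional_extensionality => i; rewrite /upd; case: eqP. Qed.

Lemma updC e r r' w w' : r != r' ->
  upd (upd e r w) r' w' = upd (upd e r' w') r w.
Proof.
move=> h; apply: functional_extensionality => i; rewrite /upd.
by case: (i =P r') => // ->; rewrite eq_sym (negPf h).
Qed.

Lemma upd_id e r w : e r = w -> upd e r w = e.
Proof.
by move=> <-; apply: functional_extensionality => i; rewrite /upd; case: eqP => [->|].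
Qed.

Lemma upd_mk l i w : upd (mk l) i w = mk (set_nth [::] l i w).
Proof.
by apply: functional_extensionality => j; rewrite /upd /mk nth_set_nth /= eq_sym.
Qed.

Lemma mk_rcons0 l : mk (rcons l [::]) = mk l.
Proof.
apply: functional_extensionality => i; rewrite /mk nth_rcons.
by case: ltngtP => // h; rewrite nth_default //; lia.
Qed.

Definition mvr (i j : nat) : prog := Loop i (Push j false) (Push j true).

Lemma exec_mvr i j e : i != j ->
  execT (mvr i j) e (4 * size (e i)).+1
        (upd (upd e i [::]) j (catrev (e i) (e j))).
Proof.
move=> ij.
have -> : catrev (e i) (e j) = foldl (fun s b => b :: s) (e j) (e i).
  by elim: (e i) (e j) => //= b w IH s.
rewrite -{1}[e](@upd_id e j (e j)) // -{1}[e](@upd_id e i (e i)) //.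
apply: (@exec_loop _ (fun w s => upd (upd e i w) j s)) => [w s|b w s].
  by rewrite updN // updE.
have -> : upd (upd (upd e i (b :: w)) j s) i w = upd (upd e i w) j s.
  by rewrite updC 1?eq_sym // upd_upd.
have := execT_push j b (upd (upd e i w) j s); rewrite updE upd_upd.
by case: b.
Qed.

Definition clr (i : nat) : prog := Loop i Skip Skip.

Lemma exec_clr i e : execT (clr i) e (2 * size (e i)).+1 (upd e i [::]).
Proof.
rewrite -{1}[e](@upd_id e i (e i)) //.
apply: (@exec_loop unit (fun w _ => upd e i w) (fun _ _ => tt) _ _ _ 0 _ _ _ tt).
  by move=> w _; rewrite updE.
by move=> b w _; rewrite upd_upd; case: b; apply: execT_skip.
Qed.

Fixpoint clrs (n : nat) : prog :=
  if n is n'.+1 then Seq (clr n) (clrs n') else Skip.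

Lemma exec_clrs n e B : (forall i, size (e i) <= B) ->
  execT (clrs n) e (n * (2 * B).+2) (fun i => if 0 < i <= n then [::] else e i).
Proof.
elim: n e => [|n IH] e hB /=.
  have -> : (fun i => if 0 < i <= 0 then [::] else e i) = e.
    by apply: functional_extensionality => -[].
  exact: execT_skip.
apply: (@execT_le _ _ ((2 * size (e n.+1)).+1 + n * (2 * B).+2).+1).
  by have := hB n.+1; lia.
apply: (execT_seq (exec_clr _ _)).
have -> : (fun i => if 0 < i <= n.+1 then [::] else e i) =
  (fun i => if 0 < i <= n then [::] else upd e n.+1 [::] i).
  apply: functional_extensionality => i; rewrite /upd.
  by case: (i =P n.+1) => [->|]; [rewrite leqnn ltnn | case: ifP; case: ifP => //; lia].
by apply: IH => i; rewrite /upd; case: eqP.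
Qed.

Fixpoint shift (o : nat) (p : prog) : prog :=
  match p with
  | Skip => Skip
  | Push r b => Push (o + r) b
  | Case r p0 pf pt => Case (o + r) (shift o p0) (shift o pf) (shift o pt)
  | Seq p q => Seq (shift o p) (shift o q)
  | Loop r pf pt => Loop (o + r) (shift o pf) (shift o pt)
  end.

Lemma shift_exec o p e0 t e1 : exec p e0 t e1 ->
  forall e, (forall i, e (o + i) = e0 i) ->
  exec (shift o p) e t (fun i => if i < o then e i else e1 (i - o)).
Proof.
have ue (e f : env) r w : (forall i, e (o + i) = f i) ->
    forall i, upd e (o + r) w (o + i) = upd f r w i.
  by move=> h i; rewrite /upd eqn_add2l h.
have tl (e f : env) : (forall i, e (o + i) = f i) ->
    (fun i => if i < o then e i else f (i - o)) = e.
  move=> h; apply: functional_extensionality => i; case: ltnP => // hi.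
  by rewrite -h subnKC.
have ul (e f : env) r w : (fun i => if i < o then upd e (o + r) w i else f i)
   = (fun i => if i < o then e i else f i).
  apply: functional_extensionality => i; case: ltnP => // hi.
  by rewrite updN //; apply/eqP; lia.
have ap (e f : env) : forall i, (fun i => if i < o then e i else f (i - o)) (o + i) = f i.
  by move=> i; rewrite ltnNge leq_addr /= addKn.
elim=> {p e0 t e1}.
- by move=> e0 e h /=; rewrite tl //; apply: ExecSkip.
- move=> r b e0 e h /=.
  have -> : (fun i => if i < o then e i else upd e0 r (b :: e0 r) (i - o))
     = upd e (o + r) (b :: e (o + r)).
    by rewrite -(ul e _ r (b :: e (o + r))) h tl //; apply: ue.
  exact: ExecPush.
- by move=> r p0 pf pt e0 t e1 er _ IH e h /=; apply: ExecCase0; rewrite ?h //; apply: IH.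
- move=> r p0 pf pt e0 b w t e1 er _ IH e h /=; apply: (@ExecCase1 _ _ _ _ _ b w).
    by rewrite h.
  by have := IH _ (ue e e0 r w h); rewrite ul; case: b er IH.
- move=> p q e0 t e1 t' e2 _ IH1 _ IH2 e h /=; apply: (ExecSeq (IH1 _ h)).
  have -> : (fun i => if i < o then e i else e2 (i - o)) = 
     (fun i => if i < o then (fun i => if i < o then e i else e1 (i - o)) i else e2 (i - o)).
    by apply: functional_extensionality => i; case: ltnP.
  exact/IH2/ap.
- by move=> r pf pt e0 er e h /=; rewrite tl //; apply: ExecLoop0; rewrite h.
- move=> r pf pt e0 b w t e1 t' e2 er _ IH1 _ IH2 e h /=.
  apply: (@ExecLoop1 _ _ _ _ b w _ (fun i => if i < o then e i else e1 (i - o))).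
  + by rewrite h.
  + by have := IH1 _ (ue e e0 r w h); rewrite ul; case: b er IH1.
  + have -> : (fun i => if i < o then e i else e2 (i - o)) =
     (fun i => if i < o then (fun i => if i < o then e i else e1 (i - o)) i else e2 (i - o)).
      by apply: functional_extensionality => i; case: ltnP.
    exact/IH2/ap.
Qed.

(** The subroutine call: above the registers of [l] only [w] is present, so the shifted program
    finds the environment it was written for and does not touch [l]. *)
Lemma execT_shift p l w T w' : execT p (mk [:: w]) T (mk [:: w']) ->
  execT (shift (size l) p) (mk (rcons l w)) T (mk (rcons l w')).
Proof.
move=> [t E ht]; exists t => //.
have -> : mk (rcons l w') = (fun i => if i < size l then mk (rcons l w) i
     else mk [:: w'] (i - size l)).
  apply: functional_extensionality => i; rewrite /mk !nth_rcons.
  by case: ltngtP => // h; [case: (i - size l) (subn_gt0 (size l) i) => [|[]] //; rewrite h | rewrite h subnn].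
apply: (shift_exec E) => i; rewrite /mk nth_rcons ltnNge leq_addr /=.
by case: i => [|i]; rewrite ?addn0 ?eqxx // -[X in _ == X]addn0 eqn_add2l /= nth_nil.
Qed.

(** * Polynomial bounds *)

Definition polyb (b : nat -> nat) : Prop :=
  exists q : {poly nat}, forall n, b n <= horner q n.

(** Coefficients are natural numbers, so a size may be replaced by an upper bound inside any
    polynomial. *)
Lemma horner_mono (q : {poly nat}) m n : m <= n -> horner q m <= horner q n.
Proof.
move=> h; elim/poly_ind: q => [|q c IH]; first by rewrite !horner0.
rewrite !hornerMXaddC; apply: leq_add => //; exact: leq_mul.
Qed.

Lemma polyb_horner q : polyb (horner q).
Proof. by exists q. Qed.

Lemma polyb_id : polyb id.
Proof. by exists 'X%R => n; rewrite hornerX. Qed.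

Lemma polyb_const c : polyb (fun=> c).
Proof. by exists (polyC c) => n; rewrite hornerC. Qed.

Lemma polyb_add a b : polyb a -> polyb b -> polyb (fun n => a n + b n).
Proof.
move=> [q hq] [r hr]; exists (q + r)%R => n; rewrite hornerD.
exact: leq_add.
Qed.

Lemma polyb_mul a b : polyb a -> polyb b -> polyb (fun n => a n * b n).
Proof.
move=> [q hq] [r hr]; exists (q * r)%R => n; rewrite hornerM.
exact: leq_mul.
Qed.

Lemma polyb_S a : polyb a -> polyb (fun n => (a n).+1).
Proof.
move=> h; have [q hq] := polyb_add h (polyb_const 1).
by exists q => n; rewrite -addn1.
Qed.

Lemma polyb_comp q b : polyb b -> polyb (fun n => horner q (b n)).
Proof.
move=> [r hr]; exists (q \Po r)%R => n; rewrite horner_comp.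
exact: horner_mono.
Qed.

Ltac polyb := repeat first [ exact: polyb_id | exact: polyb_const | exact: polyb_horner
  | apply: polyb_S | apply: polyb_add | apply: polyb_mul | apply: polyb_comp ].

(** All registers but the first are empty at the end as at the start, so that such programs can be
    run one after the other. The promise [dom] on an arbitrary type [A] lets one statement range
    over pairs, feasible solutions or loop states. *)
Definition ptime (A : Type) (dom : A -> Prop) (inp out : A -> bits) : Prop :=
  exists (p : prog) (q : {poly nat}), forall a, dom a ->
    execT p (mk [:: inp a]) (horner q (size (inp a))) (mk [:: out a]).

Lemma ptimeI (A : Type) (dom : A -> Prop) (inp out : A -> bits) p b :
  polyb b ->
  (forall a, dom a -> execT p (mk [:: inp a]) (b (size (inp a))) (mk [:: out a])) ->
  ptime dom inp out.
Proof. by move=> [q hq] h; exists p, q => a /h; apply: execT_le. Qed.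

Lemma prog_to_polytime (A : Type) (dom : A -> Prop) (inp out : A -> bits) :
  ptime dom inp out -> polytime_on dom inp out.
Proof.
(* Two registers beyond those of [p]: the result has to arrive on the last tape, and since a move
   reverses a stack it travels through [N.-1]. *)
move=> [p [q h]]; pose N := (regs p).+2.
pose p' := Seq p (Seq (mvr 0 N.-1) (mvr N.-1 N)).
pose b n := (horner q n + (((4 * (n + horner q n)).+1 + (4 * (n + horner q n)).+1)).+1).+1.
have [r hr] : polyb b by rewrite /b; polyb.
exists (frag_machine (compile N p')), r => a /h E.
pose e' := upd (upd (upd (mk [:: out a]) 0 [::]) N.-1 [::]) N (out a).
have -> : out a = e' N by rewrite /e' updE.
suff [t Et ht] : execT p' (mk [:: inp a]) (b (size (inp a))) e'.
  apply: (exec_machine _ Et (leq_trans ht (hr _))).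
  by rewrite /= /N !geq_max /=; lia.
have hs : size (out a) <= size (inp a) + horner q (size (inp a)).
  exact: (execT_size 0 E).
apply: (execT_seq E).
have [t1 E1 h1] := @exec_mvr 0 N.-1 (mk [:: out a]) isT.
have hN : N.-1 != N by rewrite /N; apply/eqP; lia.
have [t2 E2 h2] := @exec_mvr _ _ (upd (upd (mk [:: out a]) 0 [::]) N.-1 (rev (out a))) hN.
have hE : mk [:: out a] N.-1 = [::] by rewrite /N /mk /= nth_nil.
rewrite hE /= in E1.
have hE2 : upd (upd (mk [:: out a]) 0 [::]) N.-1 (rev (out a)) N = [::].
  by rewrite !updN // /N; apply/eqP; lia.
rewrite !updE hE2 upd_upd -/(rev (rev _)) revK size_rev in E2 h2.
apply: (@execT_seq _ _ _ _ _ _ _ (ex_intro2 _ _ t1 E1 _) (ex_intro2 _ _ t2 E2 _)).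
  by apply: leq_trans h1 _; rewrite /mk /=; lia.
by apply: leq_trans h2 _; lia.
Qed.

(** * Simulation of Turing machines by register programs *)

(** One step of a machine is a finite case distinction. Without loops its program terminates by
    structure, and [cost] bounds its time independently of the environment. *)
Fixpoint loop_free (p : prog) : bool :=
  match p with
  | Skip | Push _ _ => true
  | Case _ p0 pf pt => [&& loop_free p0, loop_free pf & loop_free pt]
  | Seq p q => loop_free p && loop_free q
  | Loop _ _ _ => false
  end.

Fixpoint ev (p : prog) (e : env) : env :=
  match p with
  | Skip => e
  | Push r b => upd e r (b :: e r)
  | Case r p0 pf pt =>
      if e r is b :: w then
        if b then ev pt (upd e r w) else ev pf (upd e r w)
      else ev p0 e
  | Seq p q => ev q (ev p e)
  | Loop _ _ _ => e
  end.

Fixpoint cost (p : prog) : nat :=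
  match p with
  | Skip => 0
  | Push _ _ => 2
  | Case _ p0 pf pt => (maxn (cost p0) (maxn (cost pf) (cost pt))).+2
  | Seq p q => (cost p + cost q).+1
  | Loop _ _ _ => 0
  end.

Lemma exec_ev p e : loop_free p -> execT p e (cost p) (ev p e).
Proof.
elim: p e => [|r b|r p0 IH0 pf IHf pt IHt|p IHp q IHq|//] e /=.
- by move=> _; apply: execT_skip.
- by move=> _; apply: execT_push.
- move=> /and3P[h0 hf ht]; case E: (e r) => [|b w].
    apply: execT_case0 => //; apply: execT_le (IH0 e h0); exact: leq_maxl.
  apply: (execT_case1 _ E); case: b E => E.
    by apply: execT_le (IHt _ ht); rewrite !leq_max leqnn !orbT.
  by apply: execT_le (IHf _ hf); rewrite !leq_max leqnn !orbT.
- move=> /andP[hp hq]; exact: execT_seq (IHp e hp) (IHq _ hq).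
Qed.

Fixpoint pushes (r : nat) (w : bits) : prog :=
  if w is b :: w' then Seq (pushes r w') (Push r b) else Skip.

Lemma loop_free_pushes r w : loop_free (pushes r w).
Proof. by elim: w => //= b w ->. Qed.

Lemma ev_pushes r w e : ev (pushes r w) e = upd e r (w ++ e r).
Proof. by elim: w => [|b w IH] /=; [rewrite upd_id | rewrite IH updE upd_upd]. Qed.

Section Read.

Variable T : finType.

Definition ucode (a : T) : bits := nseq (index a (enum T)) true ++ [:: false].

Fixpoint read_in (r : nat) (l : seq T) (k : T -> prog) : prog :=
  if l is a :: l' then Case r Skip (k a) (read_in r l' k) else Skip.

(** Every value of [T] gets a program of its own, so a decoded symbol becomes known at the level of
    programs. The branch [p0] is taken on an empty stack, which stands for the blanks beyond the
    stored cells. *)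
Definition read (r : nat) (p0 : prog) (k : T -> prog) : prog :=
  if enum T is a :: l then Case r p0 (k a) (read_in r l k) else Skip.

Lemma loop_free_read r p0 k : loop_free p0 -> (forall a, loop_free (k a)) ->
  loop_free (read r p0 k).
Proof.
move=> h0 hk; rewrite /read; case: (enum T) => //= a l; rewrite h0 hk /=.
by elim: l => //= b l ->; rewrite hk.
Qed.

Lemma ev_read_in r l k e a w : a \in l ->
  e r = nseq (index a l) true ++ false :: w ->
  ev (read_in r l k) e = ev (k a) (upd e r w).
Proof.
elim: l e => //= b l IH e; rewrite inE (eq_sym a b); case: eqP => [<- _ /= ->//|_] /= al ->.
by rewrite (IH _ al) ?updE // upd_upd.
Qed.

Lemma ev_read r p0 k e a w : e r = ucode a ++ w ->
  ev (read r p0 k) e = ev (k a) (upd e r w).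
Proof.
rewrite /read /ucode -catA; have := mem_enum T a.
case: (enum T) => //= b l; rewrite inE (eq_sym a b); case: eqP => [<- _ /= ->//|_] /= al ->.
by rewrite (@ev_read_in _ _ _ _ a w) ?updE // upd_upd.
Qed.

Lemma ev_read0 r p0 k e : T -> e r = [::] -> ev (read r p0 k) e = ev p0 e.
Proof.
move=> a er; rewrite /read; have := mem_enum T a.
by case: (enum T) => //= b l _; rewrite er.
Qed.

End Read.

Section Simulation.

Variable M : machine.

Local Notation k := (ntapes M).+1.
Local Notation sym := (symbol (aux M)).
Local Notation scans := {ffun 'I_k -> sym}.
Local Notation tapes := {ffun 'I_k -> tape (aux M)}.

Definition control : finType := (state M * scans)%type.

Definition syms (l : seq sym) : bits := flatten (map (@ucode sym) l).

Definition Lreg (i : 'I_k) : nat := i.*2.+2.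
Definition Rreg (i : 'I_k) : nat := i.*2.+3.
Definition spare : nat := k.*2.+2.

(** Register 0 is for input and output, register 1 for the code of the control, and each tape is a
    pair of stacks. The scanned symbols lie on no stack; they are part of the control. *)
Definition tenv (w c : bits) (ts : tapes) : env := fun n =>
  match n with
  | 0 => w
  | 1 => c
  | n'.+2 => if insub n'./2 is Some i then
      syms (if odd n' then right_cells (ts i) else left_cells (ts i))
      else [::]
  end.

Definition set_tape (ts : tapes) (i : 'I_k) (t : tape (aux M)) : tapes :=
  [ffun j => if j == i then t else ts j].

Lemma tenv_L w c ts i : tenv w c ts (Lreg i) = syms (left_cells (ts i)).
Proof. by rewrite /tenv /Lreg doubleK valK odd_double. Qed.

Lemma tenv_R w c ts i : tenv w c ts (Rreg i) = syms (right_cells (ts i)).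
Proof. by rewrite /tenv /Rreg -[i.*2.+1]/(true + i.*2) half_bit_double valK oddD odd_double. Qed.

Lemma tenv_spare w c ts : tenv w c ts spare = [::].
Proof. by rewrite /tenv /spare doubleK insubF // ltnn. Qed.

Lemma tenv_updL w c (ts : tapes) i t : right_cells t = right_cells (ts i) ->
  upd (tenv w c ts) (Lreg i) (syms (left_cells t)) = tenv w c (set_tape ts i t).
Proof.
move=> h; apply: functional_extensionality => -[|[|n]] //; rewrite /upd.
case: eqP => [->|/eqP hn]; first by rewrite tenv_L ffunE eqxx.
rewrite /tenv; case: insubP => // j _ hj; rewrite ffunE; case: eqP => // ji; subst j.
case: ifP => ho; first by rewrite h.
by case/eqP: hn; rewrite /Lreg hj -[in LHS](odd_double_half n) ho.
Qed.

Lemma tenv_updR w c (ts : tapes) i t : left_cells t = left_cells (ts i) ->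
  upd (tenv w c ts) (Rreg i) (syms (right_cells t)) = tenv w c (set_tape ts i t).
Proof.
move=> h; apply: functional_extensionality => -[|[|n]] //; rewrite /upd.
case: eqP => [->|/eqP hn]; first by rewrite tenv_R ffunE eqxx.
rewrite /tenv; case: insubP => // j _ hj; rewrite ffunE; case: eqP => // ji; subst j.
case: ifP => ho; last by rewrite h.
by case/eqP: hn; rewrite /Rreg hj -[in LHS](odd_double_half n) ho.
Qed.

Definition read_sym (r : nat) (kont : sym -> prog) : prog :=
  read r (kont None) kont.

Lemma ev_read_sym r kont e l : e r = syms l ->
  ev (read_sym r kont) e = ev (kont (head None l)) (upd e r (syms (behead l))).
Proof.
case: l => [|a l] er; first by rewrite (@ev_read0 _ _ _ _ _ (None : sym)) //= upd_id.
by rewrite (@ev_read _ _ _ _ _ a (syms l)).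
Qed.

Definition put (s : scans) (i : 'I_k) (a : sym) : scans :=
  [ffun j => if j == i then a else s j].

(** Continuation style: symbols read at run time are collected in [s], and [kont] supplies a
    separate program for every combination of scanned symbols. *)
Fixpoint moves (is_ : seq 'I_k) (acts : {ffun 'I_k -> sym * move}) (s : scans)
    (kont : scans -> prog) : prog :=
  if is_ is i :: is' then
    match (acts i).2 with
    | Stay => moves is' acts (put s i (acts i).1) kont
    | MoveRight => Seq (pushes (Lreg i) (ucode (acts i).1))
        (read_sym (Rreg i) (fun a => moves is' acts (put s i a) kont))
    | MoveLeft => Seq (pushes (Rreg i) (ucode (acts i).1))
        (read_sym (Lreg i) (fun a => moves is' acts (put s i a) kont))
    end
  else kont s.

Lemma loop_free_moves is_ acts s kont : (forall s, loop_free (kont s)) ->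
  loop_free (moves is_ acts s kont).
Proof.
move=> h; elim: is_ s => //= i is_ IH s.
by case: (acts i).2; rewrite //= loop_free_pushes /=; apply: loop_free_read.
Qed.

Lemma ev_moves w c is_ (acts : {ffun 'I_k -> sym * move}) s kont (ts : tapes) : uniq is_ ->
  let nx i := move_tape (acts i).2 (write_tape (acts i).1 (ts i)) in
  ev (moves is_ acts s kont) (tenv w c ts) =
  ev (kont [ffun i => if i \in is_ then scanned (nx i) else s i])
     (tenv w c [ffun i => if i \in is_ then nx i else ts i]).
Proof.
move=> + nx; elim: is_ s ts @nx => [|i is_ IH] s ts nx.
  move=> _ /=; congr (ev (kont _) (tenv _ _ _)); apply/ffunP=> j;
  by rewrite ffunE.
move=> /= /andP[ni u].
have key : ev (moves is_ acts (put s i (scanned (nx i))) kont)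
     (tenv w c (set_tape ts i (nx i))) =
  ev (kont [ffun j => if j \in i :: is_ then scanned (nx j) else s j])
     (tenv w c [ffun j => if j \in i :: is_ then nx j else ts j]).
  rewrite IH //; congr (ev (kont _) (tenv _ _ _)); apply/ffunP=> j;
  rewrite !ffunE inE; case: (j =P i) => [->|//]; rewrite (negPf ni) //=.
move: key; rewrite {1 2}/nx; case E: (acts i) => [a m] /=; case Et: (ts i) => [l b r].
case: m E => E /=.
- move=> <-; rewrite ev_pushes tenv_R.
  rewrite -/(syms (a :: right_cells (ts i))) Et.
  rewrite (@tenv_updR _ _ _ _ (Tape l b (a :: r))) ?Et //.
  rewrite (@ev_read_sym _ _ _ l); last by rewrite tenv_L ffunE eqxx.
  rewrite (@tenv_updL _ _ _ _ (Tape (behead l) (head None l) (a :: r))) ?ffunE ?eqxx //.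
  congr (ev _ (tenv _ _ _)); apply/ffunP=> j; rewrite !ffunE; case: eqP => //.
- move=> <-; congr (ev _ _); apply: functional_extensionality => -[|[|n]] //=.
  case: insubP => // j _ hj; rewrite ffunE; case: eqP => // ->.
  by rewrite Et.
- move=> <-; rewrite ev_pushes tenv_L.
  rewrite -/(syms (a :: left_cells (ts i))) Et.
  rewrite (@tenv_updL _ _ _ _ (Tape (a :: l) b r)) ?Et //.
  rewrite (@ev_read_sym _ _ _ r); last by rewrite tenv_R ffunE eqxx.
  rewrite (@tenv_updR _ _ _ _ (Tape (a :: l) (head None r) (behead r))) ?ffunE ?eqxx //.
  congr (ev _ (tenv _ _ _)); apply/ffunP=> j; rewrite !ffunE; case: eqP => //.
Qed.

(* A halting control pushes the scanned symbol of the output tape back, and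
   leaves register 1 empty, which ends the simulation loop. *)
Definition finish (q : state M) (s : scans) : prog :=
  if halting q then pushes (Rreg ord_max) (ucode (s ord_max))
  else pushes 1 (ucode ((q, s) : control)).

Lemma loop_free_finish q s : loop_free (finish q s).
Proof. by rewrite /finish; case: ifP => _; apply: loop_free_pushes. Qed.

Definition sim_step (x : control) : prog :=
  let: (q', acts) := delta x.1 x.2 in moves (enum 'I_k) acts x.2 (finish q').

Lemma loop_free_sim_step x : loop_free (sim_step x).
Proof.
rewrite /sim_step; case: (delta _ _) => q' acts.
by apply: loop_free_moves => s; apply: loop_free_finish.
Qed.

Definition ready (w : bits) (c : config M) : env :=
  ev (finish c.1 [ffun i => scanned (c.2 i)]) (tenv w [::] c.2).

Lemma ev_sim_step w (c : config M) : ~~ halting c.1 ->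
  ev (sim_step (c.1, [ffun i => scanned (c.2 i)])) (tenv w [::] c.2) = ready w (step c).
Proof.
case: c => q ts /= /negPf hq; rewrite /ready /step hq /sim_step /=.
case: (delta _ _) => q' acts; rewrite ev_moves ?enum_uniq //=.
congr (ev (finish _ _) (tenv _ _ _)); apply/ffunP=> i; by rewrite !ffunE mem_enum.
Qed.

(** The test of the loop consumes the first bit of the unary code of the control and so plays the
    first [Case] of [read]. Register 1, left empty by [finish] on halting, ends the loop. *)
Definition sim_loop : prog :=
  if enum control is x :: l then Loop 1 (sim_step x) (read_in 1 l sim_step) else Skip.

Lemma ready_halted w (c : config M) : halting c.1 ->
  ready w c = tenv w [::] (set_tape c.2 ord_max
    (Tape (left_cells (c.2 ord_max)) None
       (scanned (c.2 ord_max) :: right_cells (c.2 ord_max)))).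
Proof.
move=> h; rewrite /ready /finish h ev_pushes ffunE tenv_R.
rewrite -/(syms (scanned (c.2 ord_max) :: right_cells (c.2 ord_max))).
apply: (@tenv_updR w [::] c.2 ord_max (Tape (left_cells (c.2 ord_max)) None (scanned (c.2 ord_max) :: right_cells (c.2 ord_max)))) => //.
Qed.

Lemma ready_running w (c : config M) : ~~ halting c.1 ->
  ready w c = tenv w (ucode ((c.1, [ffun i => scanned (c.2 i)]) : control)) c.2.
Proof.
move=> /negPf h; rewrite /ready /finish h ev_pushes cats0.
by apply: functional_extensionality => -[|[|n]].
Qed.

Definition sim_cost : nat :=
  if enum control is x :: l then maxn (cost (sim_step x)) (cost (read_in 1 l sim_step))
  else 0.

Lemma exec_sim_loop w (c : config M) T : halting (iter T (@step M) c).1 ->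
  execT sim_loop (ready w c) (sim_cost.+2 * T).+1 (ready w (iter T (@step M) c)).
Proof.
elim: T c => [|T IH] c.
  move=> /= h; rewrite ready_halted // /sim_loop.
  have := mem_enum control (c.1, [ffun i => scanned (c.2 i)]).
  by case: (enum control) => // x l _; exists 1 => //; apply: ExecLoop0.
rewrite iterSr => h; case hc: (halting c.1).
  have sc : step c = c by case: (c) hc => q ts /= ->.
  by rewrite sc in h *; apply: execT_le (IH _ h); lia.
have [t E ht] := IH _ h.
have lfr l : loop_free (read_in 1 l sim_step).
  by elim: l => //= a l ->; rewrite loop_free_sim_step.
set x : control := (c.1, [ffun i => scanned (c.2 i)]).
have key : ev (sim_step x) (tenv w [::] c.2) = ready w (step c).
  by apply: ev_sim_step; rewrite hc.
have up u : upd (tenv w u c.2) 1 [::] = tenv w [::] c.2.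
  by apply: functional_extensionality => -[|[|n]].
rewrite ready_running ?hc // -/x.
move: E ht; rewrite /sim_loop /sim_cost /ucode; have := mem_enum control x.
case: (enum control) => // a l; rewrite inE /= (eq_sym x a); case: eqP => [->|_] /= xl E ht.
  have [t' E' ht'] := exec_ev (tenv w [::] c.2) (loop_free_sim_step x).
  rewrite key in E'; exists (t' + t.+1).+1; last by move: (leq_maxl (cost (sim_step x)) (cost (read_in 1 l sim_step))); nia.
  by apply: ExecLoop1 E => //; rewrite up.
have [t' E' ht'] := exec_ev (tenv w (nseq (index x l) true ++ [:: false]) c.2) (lfr l).
rewrite (@ev_read_in _ _ _ _ _ x [::]) // up key in E'.
exists (t' + t.+1).+1; last by move: (leq_maxr (cost (sim_step a)) (cost (read_in 1 l sim_step))); nia.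
apply: ExecLoop1 E; first by [].
have -> : upd (tenv w (true :: nseq (index x l) true ++ [:: false]) c.2) 1
   (nseq (index x l) true ++ [:: false]) = tenv w (nseq (index x l) true ++ [:: false]) c.2.
  by apply: functional_extensionality => -[|[|n]].
exact: E'.
Qed.

(** The move reverses the input, so that pushing its symbols one by one restores the order. The
    first symbol is then read back, because the scanned symbol belongs to the control. *)
Definition load : prog :=
  Seq (mvr 0 spare) (Seq
    (Loop spare (pushes (Rreg ord0) (ucode (Some (inl false) : sym)))
                (pushes (Rreg ord0) (ucode (Some (inl true) : sym))))
    (read_sym (Rreg ord0) (fun a => finish (start M) (put [ffun=> None] ord0 a)))).

(** Register 1 is the continue flag of the loop in [unload]. It is raised again only after a bit, so
    the loop stops where [leading_bits] does. The scanned symbol is on top of the right stack, where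
    [finish] has put it. *)
Definition unload_body : prog :=
  read (Rreg ord_max) Skip (fun a : sym =>
    if a is Some (inl b) then Seq (Push spare b) (Push 1 true) else Skip).

Definition unload : prog :=
  Seq (Push 1 true) (Seq (Loop 1 unload_body unload_body) 
    (Seq (mvr spare 0) (clrs spare))).

Definition bit_cost : nat :=
  maxn (cost (pushes (Rreg ord0) (ucode (Some (inl false) : sym))))
       (cost (pushes (Rreg ord0) (ucode (Some (inl true) : sym)))).

Lemma exec_load : exists c, forall w : bits,
  execT load (mk [:: w]) (c * (size w).+1) (ready [::] (init_config M w)).
Proof.
exists (4 + bit_cost.+2 + 10 + cost (read_sym (Rreg ord0) (fun a => finish (start M) (put [ffun=> None] ord0 a)))) => w.
set K := cost (read_sym _ _).
pose bl : tape (aux M) := input_tape (aux M) [::].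
pose ts0 : tapes := [ffun=> bl].
pose tsw l : tapes := set_tape ts0 ord0 (Tape [::] None l).
have e0 : mk [:: w] = tenv w [::] ts0.
  apply: functional_extensionality => -[|[|n]] //; rewrite /mk /=.
  by case: insubP => // i _ _; rewrite ffunE; case: odd.
apply: (@execT_le _ _ ((4 * size w).+1 + ((bit_cost.+2 * size w).+1 + K).+1).+1).
  by rewrite /K; nia.
have sp0 : 0 != spare by [].
rewrite e0; apply: execT_seq; first exact: (exec_mvr _ sp0).
have -> : upd (upd (tenv w [::] ts0) 0 [::]) spare
      (catrev (tenv w [::] ts0 0) (tenv w [::] ts0 spare)) =
   upd (tenv [::] [::] (tsw [::])) spare (rev w).
  rewrite tenv_spare /=; congr upd; apply: functional_extensionality => -[|[|n]] //=.
  by rewrite /upd /=; case: insubP => // i _ _; rewrite !ffunE; case: eqP => _; case: odd.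
have srR : spare != Rreg ord0 by rewrite /spare /Rreg; apply/eqP; lia.
apply: execT_seq.
  have := @exec_loop _ (fun w l => upd (tenv [::] [::] (tsw l)) spare w)
    (fun l b => Some (inl b) :: l) spare
    (pushes (Rreg ord0) (ucode (Some (inl false) : sym)))
    (pushes (Rreg ord0) (ucode (Some (inl true) : sym))) bit_cost _ _ (rev w) [::].
  rewrite size_rev; apply=> [v s|b v s]; first by rewrite updE.
  rewrite upd_upd.
  have Q : upd (upd (tenv [::] [::] (tsw s)) spare v) (Rreg ord0)
      (ucode (Some (inl b) : sym) ++ upd (tenv [::] [::] (tsw s)) spare v (Rreg ord0)) =
     upd (tenv [::] [::] (tsw (Some (inl b) :: s))) spare v.
    have hR : right_cells (tsw s ord0) = s by rewrite ffunE eqxx.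
    rewrite updC // updN 1?eq_sym // tenv_R hR; congr upd.
    rewrite -[ucode _ ++ syms s]/(syms (right_cells (Tape [::] None (Some (inl b) :: s)))).
    rewrite (@tenv_updR _ _ _ _ (Tape [::] None (Some (inl b) :: s))).
      by congr tenv; apply/ffunP => j; rewrite !ffunE; case: eqP.
    by rewrite ffunE eqxx.
  rewrite -Q -ev_pushes; case: b {Q}; apply: execT_le (exec_ev _ (loop_free_pushes _ _)).
    exact: leq_maxr.
  exact: leq_maxl.
have -> : foldl (fun l b => Some (inl b) :: l) [::] (rev w) = [seq Some (inl b) | b <- w] :> seq sym.
  by rewrite foldl_rev; elim: w {e0} => //= b w ->.
set l := map _ _.
rewrite upd_id ?tenv_spare //.
have Q : ev (read_sym (Rreg ord0) (fun a => finish (start M) (put [ffun=> None] ord0 a)))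
   (tenv [::] [::] (tsw l)) = ready [::] (init_config M w).
  rewrite (@ev_read_sym _ _ _ l); last by rewrite tenv_R ffunE eqxx.
  rewrite (@tenv_updR _ _ _ _ (Tape [::] None (behead l))); last by rewrite ffunE eqxx.
  rewrite /ready /=; congr (ev (finish _ _) _).
    by apply/ffunP=> i; rewrite !ffunE; case: eqP.
  apply: functional_extensionality => -[|[|n]] //=.
  case: insubP => // i _ _; rewrite !ffunE; case: eqP => _ //; by case: odd.
rewrite -Q; apply: exec_ev; apply: loop_free_read => *; exact: loop_free_finish.
Qed.

(** What remains on the tapes is left unspecified; [clrs] erases it afterwards. *)
Lemma exec_unload_loop (ts : tapes) u l : right_cells (ts ord_max) = l ->
  exists2 ts', execT (Loop 1 unload_body unload_body)
     (upd (tenv [::] [:: true] ts) spare u)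
     (((cost unload_body).+2 * (size l).+1).+1)
     (upd (tenv [::] [::] ts') spare (catrev (leading_bits l) u))
   & True.
Proof.
have lf : loop_free unload_body.
  by apply: loop_free_read => // -[[b|]|].
have sp1 : spare != 1 by [].
have sR : spare != Rreg ord_max by rewrite /spare /Rreg /=; apply/eqP; lia.
have R1 : Rreg ord_max != 1 by [].
have tc c ts0 : upd (tenv [::] c ts0) 1 [::] = tenv [::] [::] ts0.
  by apply: functional_extensionality => -[|[|n]].
have tc1 c ts0 : upd (tenv [::] [::] ts0) 1 c = tenv [::] c ts0.
  by apply: functional_extensionality => -[|[|n]].
have stop ts1 ts2 u1 u2 :
  ev unload_body (upd (tenv [::] [::] ts1) spare u1) = upd (tenv [::] [::] ts2) spare u2 ->
  execT (Loop 1 unload_body unload_body) (upd (tenv [::] [:: true] ts1) spare u1)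
    (cost unload_body + 3) (upd (tenv [::] [::] ts2) spare u2).
  move=> Q; have [t E ht] := exec_ev (upd (tenv [::] [::] ts1) spare u1) lf.
  exists (t + 1.+1).+1; last by lia.
  apply: (@ExecLoop1 _ _ _ _ true [::]) => //=; first by rewrite updC // tc; exact: E.
  by rewrite Q; apply: ExecLoop0; rewrite updN.
elim: l u ts => [|a l IH] u ts hl.
  exists ts => //=; apply: execT_le (stop _ _ _ _ _); first by lia.
  rewrite ev_read0 //; first exact: None.
  by rewrite updN 1?eq_sym // tenv_R hl.
pose ts' := set_tape ts ord_max (Tape (left_cells (ts ord_max)) None l).
have Q0 : upd (upd (tenv [::] [::] ts) spare u) (Rreg ord_max) (syms l) =
   upd (tenv [::] [::] ts') spare u.
  rewrite updC //; congr upd.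
  exact: (@tenv_updR _ _ _ _ (Tape (left_cells (ts ord_max)) None l)).
have Q : ev unload_body (upd (tenv [::] [::] ts) spare u) =
  if a is Some (inl b) then upd (tenv [::] [:: true] ts') spare (b :: u)
  else upd (tenv [::] [::] ts') spare u.
  rewrite /unload_body (@ev_read _ _ _ _ _ a (syms l)); last first.
    by rewrite updN 1?eq_sym // tenv_R hl.
  rewrite Q0; case: a {hl} => [[b|?]|] //=.
  by rewrite updE upd_upd updN // updC //= tc1.
case: a hl Q => [[b|x]|] hl Q; last first.
- by exists ts' => //; apply: execT_le (stop _ _ _ _ Q); rewrite mulnS addn3 ltnS leq_addr.
- by exists ts' => //; apply: execT_le (stop _ _ _ _ Q); rewrite mulnS addn3 ltnS leq_addr.
have [|ts2 [t E ht] _] := IH (b :: u) ts'; first by rewrite ffunE eqxx.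
exists ts2 => //; have [t1 E1 ht1] := exec_ev (upd (tenv [::] [::] ts) spare u) lf.
rewrite Q in E1; exists (t1 + t.+1).+1; last by move: ht ht1; rewrite [size (_ :: _)]/=; move: (cost unload_body) (size l) => c n; rewrite !mulnS; lia.
by apply: (@ExecLoop1 _ _ _ _ true [::]) => //=; first by rewrite updC // tc; exact: E1.
Qed.

Lemma exec_unload : exists c, forall (cf : config M) B, halting cf.1 ->
  (forall r, size (ready [::] cf r) <= B) ->
  execT unload (ready [::] cf) (c * B.+1) (mk [:: output cf]).
Proof.
pose C := (cost unload_body).+2.
exists (2 + C.+1 + C + 10 + 5 * (4 + C)  + spare * (2 * (4 + C)).+2) => cf B hq hB.
have hB0 := hB; rewrite ready_halted // in hB *.
set ts := set_tape _ _ _ in hB *.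
pose l := scanned (cf.2 ord_max) :: right_cells (cf.2 ord_max).
have hl : right_cells (ts ord_max) = l by rewrite ffunE eqxx.
have szl : size l <= B.
  apply: leq_trans (hB (Rreg ord_max)); rewrite tenv_R hl.
  elim: (l) => //= a l' IH; rewrite /syms /= size_cat -/(syms l') /ucode size_cat /=; lia.
have [ts' E _] := exec_unload_loop [::] hl.
have sp0 : spare != 0 by [].
pose U := (C * (size l).+1).+1.
have cs : leading_bits l = output cf by [].
have hs r : size (upd (tenv [::] [::] ts') spare (catrev (leading_bits l) [::]) r) <= B + 1 + U.
  have := execT_size r E; rewrite -/C -/U.
  set z := size (upd (tenv [::] [:: true] _) _ _ _).
  suff : z <= B + 1 by lia.
  rewrite /z /upd; case: eqP => // _; have := hB r.
  by clear z; case: (r) => [|[|r']] //= h; lia.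
have hU : U <= C * B.+1 + 1 by rewrite /U; nia.
pose D := B + 1 + U.
apply: (@execT_le _ _ (2 + (U + ((4 * D).+1 + spare * (2 * D).+2).+1).+1).+1).
  have hD : D <= (4 + C) * B.+1 by rewrite /D; nia.
  have : spare * (2 * D).+2 <= spare * (2 * (4 + C)).+2 * B.+1.
    rewrite -mulnA; apply: leq_mul => //; nia.
  move: (spare * _) (spare * _) => x y; nia.
apply: execT_seq; first exact: execT_push.
have -> : upd (tenv [::] [::] ts) 1 (true :: tenv [::] [::] ts 1) =
   upd (tenv [::] [:: true] ts) spare [::].
  rewrite [in RHS]upd_id ?tenv_spare //.
  by apply: functional_extensionality => -[|[|n]].
apply: (execT_seq E).
apply: execT_seq.
  by apply: execT_le (exec_mvr _ sp0); have := hs spare; rewrite -/D; lia.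
set e := upd _ 0 _.
have eE : e = upd (upd (tenv [::] [::] ts') spare [::]) 0 (leading_bits l).
  by rewrite /e upd_upd updE updN //= -/(rev (rev _)) revK.
have -> : mk [:: output cf] = (fun i => if 0 < i <= spare then [::] else e i).
  apply: functional_extensionality => -[|i]; first by rewrite eE updE cs.
  rewrite /mk /= nth_nil; case: ifP => // hi; rewrite eE updN // updN; last first.
    by apply/eqP => h; rewrite h leqnn in hi.
  case: i hi => [|i] //= hi; rewrite insubF //; apply/negP => hk; move/negP: hi; apply.
  by rewrite /spare; lia.
apply: exec_clrs => i; rewrite eE; have := hs spare; rewrite updE -/(rev _) size_rev => h1.
rewrite /upd; case: eqP => // _; case: eqP => // /eqP hi.
by have := hs i; rewrite updN.
Qed.

End Simulation.

Lemma polytime_to_prog (A : Type) (dom : A -> Prop) (inp out : A -> bits) :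
  polytime_on dom inp out -> ptime dom inp out.
Proof.
move=> [M [q h]].
have [c1 h1] := exec_load M; have [c2 h2] := exec_unload M.
(* [B] bounds every register at the time of halting: the size of the input plus the time spent on
   loading and simulating. *)
pose B n := n + c1 * n.+1 + (sim_cost M).+2 * horner q n + 1.
pose b n := (c1 * n.+1 + (((sim_cost M).+2 * horner q n).+1 + c2 * (B n).+1).+1).+1.
apply: (@ptimeI _ _ _ _ (Seq (load M) (Seq (sim_loop M) (unload M))) b).
  by rewrite /b /B; polyb.
move=> a /h [hh ho]; set w := inp a in hh ho *.
have E1 := h1 w; have E2 := exec_sim_loop [::] hh.
apply: (execT_seq E1); apply: (execT_seq E2).
rewrite -ho; apply: h2 => // r.
have s1 := execT_size r E1; have s2 := execT_size r E2.
have s0 : size (mk [:: w] r) <= size w by case: r {s1 s2} => //= r; rewrite /mk /= nth_nil.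
by rewrite /B; lia.
Qed.

Lemma polytimeP (A : Type) (dom : A -> Prop) (inp out : A -> bits) :
  polytime_on dom inp out <-> ptime dom inp out.
Proof. by split; [apply: polytime_to_prog | apply: prog_to_polytime]. Qed.

(** * Closure properties of polynomial time *)

(** Chosen to agree with [code]: the code of a nonempty list is by computation the [pr] of its first
    word and the code of the rest. *)
Definition pr (u v : bits) : bits := code_word u ++ v.

Lemma size_code_word u : size (code_word u) = (2 * size u).+1.
Proof.
rewrite /code_word size_cat size_flatten /shape -map_comp addn1; congr S.
by elim: u => //= b u; rewrite /sumn /= => ->; lia.
Qed.

Lemma size_pr u v : size (pr u v) = (2 * size u + size v).+1.
Proof. by rewrite size_cat size_code_word. Qed.

Lemma exec_mvr_mk i j l : i != j ->
  execT (mvr i j) (mk l) (4 * size (nth [::] l i)).+1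
    (mk (set_nth [::] (set_nth [::] l i [::]) j
           (catrev (nth [::] l i) (nth [::] l j)))).
Proof. by move=> ij; rewrite -!upd_mk; apply: exec_mvr. Qed.

Lemma execT_eq p e e1 e2 T : execT p e T e1 -> e1 = e2 -> execT p e T e2.
Proof. by move=> h <-. Qed.

Lemma mk_trim l : mk (l ++ [:: [::]]) = mk l.
Proof. by rewrite cats1 mk_rcons0. Qed.

Lemma mk1 x : mk [:: x; [::]] = mk [:: x].
Proof. exact: (mk_trim [:: x]). Qed.

Lemma mk2 x : mk [:: x; [::]; [::]] = mk [:: x].
Proof. by rewrite -(mk1 x); exact: (mk_trim [:: x; [::]]). Qed.

Lemma mk3 x : mk [:: x; [::]; [::]; [::]] = mk [:: x].
Proof. by rewrite -(mk2 x); exact: (mk_trim [:: x; [::]; [::]]). Qed.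

Definition dup : prog :=
  Seq (Loop 0 (Seq (Push 1 false) (Push 2 false)) (Seq (Push 1 true) (Push 2 true)))
      (Seq (mvr 1 0) (mvr 2 1)).

Lemma exec_dup w : execT dup (mk [:: w]) (15 * size w + 5) (mk [:: w; w]).
Proof.
have f w' : foldl (fun s (b : bool) => b :: s) [::] w' = rev w'.
  by rewrite -[w' in LHS]revK foldl_rev; elim: (rev w') => //= b v ->.
apply: (@execT_le _ _ ((7 * size w).+1 + ((4 * size w).+1 + (4 * size w).+1).+1).+1).
  by lia.
rewrite -(mk2 w).
apply: execT_seq.
  apply: (@exec_loop _ (fun w s => mk [:: w; s; s]) (fun s b => b :: s) _ _ _ 5) => //.
  move=> b v s; rewrite upd_mk /=.
  have P : execT (Seq (Push 1 b) (Push 2 b)) (mk [:: v; s; s]) 5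
     (mk [:: v; b :: s; b :: s]).
    have := execT_seq (execT_push 1 b (mk [:: v; s; s])) (execT_push 2 b _).
    by rewrite !upd_mk /=.
  by case: b P.
rewrite f.
apply: execT_seq.
  have := @exec_mvr_mk 1 0 [:: [::]; rev w; rev w] isT; rewrite /= size_rev => h; exact: h.
have := @exec_mvr_mk 2 1 [:: catrev (rev w) [::]; [::]; rev w] isT.
rewrite /= -/(rev (rev w)) revK size_rev => h; apply: (execT_eq h).
exact: (mk_trim [:: w; w]).
Qed.

Section Closure.

Variables (A : Type) (dom : A -> Prop) (inp : A -> bits).
Implicit Types out mid : A -> bits.

Definition bnd (F : A -> nat) : Prop :=
  exists q : {poly nat}, forall a, dom a -> F a <= horner q (size (inp a)).

Lemma ptime_size out : ptime dom inp out -> bnd (fun a => size (out a)).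
Proof.
move=> [p [q h]]; have [r hr] : polyb (fun n => n + horner q n) by polyb.
exists r => a /h E; apply: leq_trans (hr _); exact: (execT_size 0 E).
Qed.

Lemma ptime_id : ptime dom inp inp.
Proof. by exists Skip, 0%R => a _; apply: execT_le (execT_skip _). Qed.

Lemma ptime_ext out out' : (forall a, dom a -> out a = out' a) ->
  ptime dom inp out -> ptime dom inp out'.
Proof. by move=> e [p [q h]]; exists p, q => a da; rewrite -e //; apply: h. Qed.

Lemma ptime_comp mid out : ptime dom inp mid -> ptime dom mid out -> ptime dom inp out.
Proof.
move=> h1 [p2 [q2 h2]]; have [r hr] := ptime_size h1; move: h1 => [p1 [q1 h1]].
apply: (@ptimeI _ _ _ _ (Seq p1 p2) (fun n => (horner q1 n + horner q2 (horner r n)).+1)).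
  by polyb.
move=> a da; apply: (execT_seq (h1 a da)); apply: execT_le (h2 a da).
exact/horner_mono/hr.
Qed.

Lemma ptime_const w : ptime dom inp (fun=> w).
Proof.
apply: (@ptimeI _ _ _ _ (Seq (clr 0) (pushes 0 w))
  (fun n => ((2 * n).+1 + cost (pushes 0 w)).+1)); first by polyb.
move=> a _; apply: execT_seq; first exact: exec_clr.
apply: execT_eq; first exact: (exec_ev _ (loop_free_pushes _ _)).
by rewrite ev_pushes updE upd_upd cats0 upd_mk.
Qed.

Lemma ptime_cons b out : ptime dom inp out -> ptime dom inp (fun a => b :: out a).
Proof.
move=> h; apply: (ptime_comp h); apply: (@ptimeI _ _ _ _ (Push 0 b) (fun=> 2)).
  by polyb.
by move=> a _; apply: execT_eq (execT_push _ _ _) _; rewrite upd_mk.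
Qed.

Lemma ptime_behead out : ptime dom inp out -> ptime dom inp (fun a => behead (out a)).
Proof.
move=> h; apply: (ptime_comp h); apply: (@ptimeI _ _ _ _ (Case 0 Skip Skip Skip) (fun=> 2)).
  by polyb.
move=> a _; case E: (out a) => [|b w].
  exact/execT_case0/execT_skip.
by apply: (@execT_case1 _ _ _ _ _ b w) => //; rewrite upd_mk; case: b {E}; apply: execT_skip.
Qed.

Lemma ptime_nonnil out : ptime dom inp out -> ptime dom inp (fun a => [:: out a != [::]]).
Proof.
move=> h; apply: (ptime_comp h).
apply: (@ptimeI _ _ _ _ (Case 0 (Push 0 false) (Seq (clr 0) (Push 0 true))
   (Seq (clr 0) (Push 0 true))) (fun n => (2 * n + 10))); first by polyb.
move=> a _; case E: (out a) => [|b w].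
  apply: (@execT_le _ _ 4) => //; apply: execT_case0 => //.
  by apply: execT_eq (execT_push _ _ _) _; rewrite upd_mk.
apply: (@execT_le _ _ ((2 * size w).+1 + 2).+1.+2); first by rewrite /=; lia.
apply: (@execT_case1 _ _ _ _ _ b w) => //; rewrite upd_mk.
have R : execT (Seq (clr 0) (Push 0 true)) (mk [:: w]) ((2 * size w).+1 + 2).+1 (mk [:: [:: true]]).
  apply: execT_seq; first exact: exec_clr.
  by apply: execT_eq (execT_push _ _ _) _; rewrite !upd_mk.
by case: b {E}.
Qed.

Lemma ptime_head out : ptime dom inp out -> ptime dom inp (fun a => [:: head false (out a)]).
Proof.
move=> h; apply: (ptime_comp h).
apply: (@ptimeI _ _ _ _ (Case 0 (Push 0 false) (Seq (clr 0) (Push 0 false))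
   (Seq (clr 0) (Push 0 true))) (fun n => (2 * n + 10))); first by polyb.
move=> a _; case E: (out a) => [|b w].
  apply: (@execT_le _ _ 4) => //; apply: execT_case0 => //.
  by apply: execT_eq (execT_push _ _ _) _; rewrite upd_mk.
apply: (@execT_le _ _ ((2 * size w).+1 + 2).+1.+2); first by rewrite /=; lia.
apply: (@execT_case1 _ _ _ _ _ b w) => //; rewrite upd_mk.
have R c : execT (Seq (clr 0) (Push 0 c)) (mk [:: w]) ((2 * size w).+1 + 2).+1 (mk [:: [:: c]]).
  apply: execT_seq; first exact: exec_clr.
  by apply: execT_eq (execT_push _ _ _) _; rewrite !upd_mk.
by case: b {E}.
Qed.

Lemma exec_two (u v : A -> bits) : ptime dom inp u -> ptime dom inp v ->
  exists p b, polyb b /\ forall a, dom a ->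
    execT p (mk [:: inp a]) (b (size (inp a))) (mk [:: [::]; u a; v a]).
Proof.
move=> [p1 [q1 h1]] [p2 [q2 h2]].
exists (Seq dup (Seq (shift 1 p1) (Seq (mvr 0 3) (Seq (mvr 3 2) (shift 2 p2))))).
exists (fun n => ((15 * n + 5) + (horner q1 n + ((4 * n).+1 + ((4 * n).+1 + horner q2 n).+1).+1).+1).+1).
split; first by polyb.
move=> a da; apply: (execT_seq (exec_dup _)).
apply: execT_seq; first exact: (@execT_shift p1 [:: inp a] _ _ _ (h1 a da)).
apply: execT_seq; first exact: (@exec_mvr_mk 0 3 [:: inp a; u a] isT).
apply: execT_seq.
  have := (@exec_mvr_mk 3 2 [:: [::]; u a; [::]; rev (inp a)] isT).
  by rewrite /= size_rev -/(rev (rev _)) revK => H; exact: H.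
have -> : mk [:: [::]; u a; inp a; [::]] = mk [:: [::]; u a; inp a].
  exact: (mk_trim [:: [::]; u a; inp a]).
exact: (@execT_shift p2 [:: [::]; u a] _ _ _ (h2 a da)).
Qed.

Lemma bnd_ler (b : nat -> nat) (F : A -> nat) : polyb b -> bnd F ->
  (forall m n, m <= n -> b m <= b n) -> bnd (fun a => b (F a)).
Proof.
move=> [q hq] [r hr] mono; have [s hs] : polyb (fun n => horner q (horner r n)) by polyb.
exists s => a da; apply: leq_trans (hs _); apply: leq_trans (hq _).
exact/mono/hr.
Qed.

Lemma ptime_pair (u v : A -> bits) : ptime dom inp u -> ptime dom inp v ->
  ptime dom inp (fun a => pr (u a) (v a)).
Proof.
move=> hu hv; have [p [b [pb h]]] := exec_two hu hv.
have [qu su] := ptime_size hu; have [qv sv] := ptime_size hv.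
pose tail := Seq (mvr 2 3) (Seq (mvr 3 0) (Seq (Push 0 false) (Seq (mvr 1 2)
   (Loop 2 (Seq (Push 0 false) (Push 0 true)) (Seq (Push 0 true) (Push 0 true)))))).
apply: (@ptimeI _ _ _ _ (Seq p tail) (fun n => (b n + ((4 * horner qv n).+1 +
  ((4 * horner qv n).+1 + (2 + ((4 * horner qu n).+1 + (7 * horner qu n).+1).+1).+1).+1).+1).+1)).
  by polyb.
move=> a da; apply: (execT_seq (h a da)).
have {}sv := sv a da; have {}su := su a da.
apply: execT_seq.
  by apply: execT_le (@exec_mvr_mk 2 3 [:: [::]; u a; v a] isT); rewrite /=; lia.
apply: execT_seq.
  apply: execT_le (@exec_mvr_mk 3 0 [:: [::]; u a; [::]; rev (v a)] isT).
  by rewrite /= size_rev; lia.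
rewrite /= -/(rev (rev _)) revK; apply: (execT_seq (execT_push _ _ _)).
rewrite upd_mk; apply: execT_seq.
  apply: execT_le (@exec_mvr_mk 1 2 [:: false :: v a; u a; [::]; [::]] isT).
  by rewrite /=; lia.
rewrite /= -/(rev _); apply: (@execT_le _ _ (7 * size (rev (u a))).+1).
  by rewrite size_rev; lia.
have := @exec_loop _ (fun w s => mk [:: s; [::]; w; [::]]) (fun s b => true :: b :: s) 2
  (Seq (Push 0 false) (Push 0 true)) (Seq (Push 0 true) (Push 0 true)) 5 _ _ (rev (u a)) (false :: v a).
rewrite mk3 foldl_rev.
have -> : foldr (fun (x : bool) z => [:: true, x & z]) (false :: v a) (u a) = pr (u a) (v a).
  by rewrite /pr /code_word -catA; elim: (u a) => //= c l ->.
apply => // c w s; rewrite upd_mk /=.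
have R : execT (Seq (Push 0 c) (Push 0 true)) (mk [:: s; [::]; w; [::]]) 5
    (mk [:: [:: true, c & s]; [::]; w; [::]]).
  have := execT_seq (execT_push 0 c (mk [:: s; [::]; w; [::]])) (execT_push 0 true _).
  by rewrite !upd_mk.
by case: c R.
Qed.

(** Each branch is required only on the inputs that reach it. This is how the outcome of a test,
    such as feasibility, becomes the promise under which another machine may be called. *)
Lemma ptime_if (c : A -> bool) out1 out2 :
  ptime dom inp (fun a => [:: c a]) ->
  ptime (fun a => dom a /\ c a) inp out1 -> ptime (fun a => dom a /\ ~~ c a) inp out2 ->
  ptime dom inp (fun a => if c a then out1 a else out2 a).
Proof.
move=> [p [q h]] [p1 [q1 h1]] [p2 [q2 h2]].
apply: (@ptimeI _ _ _ _ (Seq dup (Seq (shift 1 p) (Case 1 Skip p2 p1)))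
  (fun n => (15 * n + 5 + (horner q n + (horner q1 n + horner q2 n).+2).+1).+1)).
  by polyb.
move=> a da; apply: (execT_seq (exec_dup _)).
apply: execT_seq; first exact: (@execT_shift p [:: inp a] _ _ _ (h a da)).
apply: (@execT_case1 _ _ _ _ _ (c a) [::]) => //; rewrite upd_mk /= mk1.
case hc: (c a); first by apply: execT_le (h1 a (conj da hc)); apply: leq_addr.
by apply: execT_le (h2 a (conj da _)); rewrite ?hc ?leq_addl.
Qed.

End Closure.

Lemma ptime_dom A (dom dom' : A -> Prop) inp out : (forall a, dom' a -> dom a) ->
  ptime dom inp out -> ptime dom' inp out.
Proof. by move=> h [p [q H]]; exists p, q => a /h; apply: H. Qed.

Lemma ptime_sub A B (dom : A -> Prop) inp (m : A -> B) (dom' : B -> Prop) inp' out' :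
  ptime dom' inp' out' -> (forall a, dom a -> dom' (m a)) ->
  ptime dom inp (fun a => inp' (m a)) -> ptime dom inp (fun a => out' (m a)).
Proof.
move=> [p [q H]] h h1; apply: (ptime_comp h1).
by exists p, q => a /h; apply: H.
Qed.

(** Register 1 is again the continue flag: it is raised after every marked bit, and the closing 0 of
    the first component leaves it empty. *)
Definition split_body : prog :=
  Case 0 Skip Skip (Case 0 Skip (Seq (Push 2 false) (Push 1 true))
                               (Seq (Push 2 true) (Push 1 true))).

Lemma exec_split u v s :
  execT (Loop 1 split_body split_body) (mk [:: pr u v; [:: true]; s])
    (11 * (size u).+1) (mk [:: v; [::]; catrev u s]).
Proof.
elim: u s => [|b u IH] s /=.
  have [t E ht] : execT split_body (mk [:: false :: v; [::]; s]) 2 (mk [:: v; [::]; s]).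
    by apply: (@execT_case1 _ _ _ _ _ false v) => //; rewrite upd_mk; apply: execT_skip.
  exists (t + 2).+1; last by lia.
  apply: (@ExecLoop1 _ _ _ _ true [::]) => //; first by rewrite upd_mk; exact: E.
  by apply: ExecLoop0.
have [t E ht] : execT split_body (mk [:: [:: true, b & pr u v]; [::]; s]) 9
    (mk [:: pr u v; [:: true]; b :: s]).
  apply: (@execT_case1 _ _ _ _ _ true (b :: pr u v) 7) => //; rewrite upd_mk.
  apply: (@execT_case1 _ _ _ _ _ b (pr u v) 5) => //; rewrite upd_mk /=.
  have := execT_seq (execT_push 2 b (mk [:: pr u v; [::]; s])) (execT_push 1 true _).
  by rewrite !upd_mk /=; case: b.
have [t' E' ht'] := IH (b :: s).
exists (t + t'.+1).+1; last by lia.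
by apply: (@ExecLoop1 _ _ _ _ true [::]) => //; first by rewrite upd_mk; exact: E.
Qed.

Lemma ptime_fst A (dom : A -> Prop) inp (u v : A -> bits) :
  ptime dom inp (fun a => pr (u a) (v a)) -> ptime dom inp u.
Proof.
move=> h; apply: (ptime_comp h).
apply: (@ptimeI _ _ _ _ (Seq (Push 1 true) (Seq (Loop 1 split_body split_body)
   (Seq (clr 0) (mvr 2 0)))) (fun n => (2 + (11 * n.+1 + ((2 * n).+1 + (4 * n).+1).+1).+1).+1)).
  by polyb.
move=> a _; apply: (execT_seq (execT_push _ _ _)); rewrite upd_mk /=.
have -> : mk [:: pr (u a) (v a); [:: true]] = mk [:: pr (u a) (v a); [:: true]; [::]].
  by rewrite -(mk_trim [:: pr (u a) (v a); [:: true]]).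
apply: execT_seq.
  by apply: execT_le (exec_split _ _ _); rewrite size_pr; lia.
apply: execT_seq.
  by apply: execT_le (exec_clr _ _); rewrite size_pr /mk /=; lia.
rewrite upd_mk; apply: execT_eq.
  apply: execT_le (@exec_mvr_mk 2 0 [:: [::]; [::]; catrev (u a) [::]] isT).
  by rewrite /= size_rev size_pr; lia.
by rewrite /= -/(rev (rev _)) revK mk2.
Qed.

Lemma ptime_snd A (dom : A -> Prop) inp (u v : A -> bits) :
  ptime dom inp (fun a => pr (u a) (v a)) -> ptime dom inp v.
Proof.
move=> h; apply: (ptime_comp h).
apply: (@ptimeI _ _ _ _ (Seq (Push 1 true) (Seq (Loop 1 split_body split_body)
   (clr 2))) (fun n => (2 + (11 * n.+1 + (2 * n).+1).+1).+1)).
  by polyb.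
move=> a _; apply: (execT_seq (execT_push _ _ _)); rewrite upd_mk /=.
have -> : mk [:: pr (u a) (v a); [:: true]] = mk [:: pr (u a) (v a); [:: true]; [::]].
  by rewrite -(mk_trim [:: pr (u a) (v a); [:: true]]).
apply: execT_seq.
  by apply: execT_le (exec_split _ _ _); rewrite size_pr; lia.
apply: execT_eq.
  by apply: execT_le (exec_clr _ _); rewrite size_pr /mk /= size_rev; lia.
by rewrite upd_mk mk2.
Qed.

(** The step sees only the coded state, so states must carry whatever they use of the input. All
    states are assumed to be small because polynomially many polynomial-time steps can grow
    exponentially. *)
Lemma ptime_iter A (dom : A -> Prop) inp (cnt : A -> bits) (st : A -> nat -> bits) :
  ptime dom inp cnt -> ptime dom inp (fun a => st a 0) ->
  ptime (fun x : A * nat => dom x.1 /\ x.2 < size (cnt x.1))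
     (fun x => st x.1 x.2) (fun x => st x.1 x.2.+1) ->
  (exists q : {poly nat}, forall a i, dom a -> i <= size (cnt a) ->
     size (st a i) <= horner q (size (inp a))) ->
  ptime dom inp (fun a => st a (size (cnt a))).
Proof.
move=> hc hs [p [q h]] [r hr]; have [p0 [b [pb h0]]] := exec_two hc hs.
have [k hk] := ptime_size hc.
apply: (@ptimeI _ _ _ _ (Seq p0 (Seq (Loop 1 (shift 2 p) (shift 2 p)) (Seq (mvr 2 3) (mvr 3 0))))
  (fun n => (b n + (((horner q (horner r n)).+2 * horner k n).+1 +
     ((4 * horner r n).+1 + (4 * horner r n).+1).+1).+1).+1)); first by polyb.
move=> a da; apply: (execT_seq (h0 a da)).
set n := size (inp a); set N := size (cnt a).
have L w i : size w + i = N ->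
  execT (Loop 1 (shift 2 p) (shift 2 p)) (mk [:: [::]; w; st a i])
    ((horner q (horner r n)).+2 * size w).+1 (mk [:: [::]; [::]; st a N]).
  elim: w i => [|c w IH] i /= hi.
    by rewrite -hi; exists 1 => //; apply: ExecLoop0.
  have hiN : i < N by lia.
  have [t E ht] := @execT_shift p [:: [::]; w] _ _ _ (h (a, i) (conj da hiN)).
  have [|t' E' ht'] := IH i.+1; first by lia.
  exists (t + t'.+1).+1.
    apply: (@ExecLoop1 _ _ _ _ c w _ _ _ _ _ _ E') => //.
    by rewrite upd_mk /=; case: (c); apply: E.
  have : horner q (size (st a i)) <= horner q (horner r n).
    by apply/horner_mono/hr => //; apply: ltnW.
  by move: ht ht'; move: (horner q (horner r n)) (horner q (size _)) => x y; rewrite /= mulnS; lia.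
have hN := hr a N da (leqnn _); rewrite -/n in hN.
apply: execT_seq.
  apply: execT_le (L (cnt a) 0 _); last by rewrite addn0.
  by rewrite ltnS leq_mul2l hk ?orbT.
apply: execT_seq.
  by apply: execT_le (@exec_mvr_mk 2 3 _ isT); rewrite /= -/n; lia.
apply: execT_eq.
  apply: execT_le (@exec_mvr_mk 3 0 [:: [::]; [::]; [::]; rev (st a N)] isT).
  by rewrite /= size_rev; lia.
by rewrite /= -/(rev (rev _)) revK mk3.
Qed.

(** * Encodings and bounded iteration *)

Definition en (n : nat) : bits := nseq n true.
Definition ep (T U : Type) (e : T -> bits) (f : U -> bits) (x : T * U) : bits :=
  pr (e x.1) (f x.2).
Definition es (T : Type) (e : T -> bits) (l : seq T) : bits := code (map e l).
Notation eb b := [:: (b : bool)].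

Lemma es_cons T (e : T -> bits) x l : es e (x :: l) = pr (e x) (es e l).
Proof. by []. Qed.

Lemma size_en n : size (en n) = n.
Proof. by rewrite size_nseq. Qed.

Section Bounds.

Variables (A : Type) (dom : A -> Prop) (inp : A -> bits).

Lemma bnd_le F G : (forall a, dom a -> F a <= G a) -> bnd dom inp G -> bnd dom inp F.
Proof. by move=> h [q H]; exists q => a da; apply: leq_trans (h a da) (H a da). Qed.

Lemma bnd_const c : bnd dom inp (fun=> c).
Proof. by have [q h] := polyb_const c; exists q. Qed.

Lemma bnd_add F G : bnd dom inp F -> bnd dom inp G -> bnd dom inp (fun a => F a + G a).
Proof.
move=> [q h] [r k]; have [s hs] := polyb_add (polyb_horner q) (polyb_horner r).
by exists s => a da; apply: leq_trans (hs _); apply: leq_add; [apply: h|apply: k].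
Qed.

Lemma bnd_mul F G : bnd dom inp F -> bnd dom inp G -> bnd dom inp (fun a => F a * G a).
Proof.
move=> [q h] [r k]; have [s hs] := polyb_mul (polyb_horner q) (polyb_horner r).
by exists s => a da; apply: leq_trans (hs _); apply: leq_mul; [apply: h|apply: k].
Qed.

Lemma bnd_S F : bnd dom inp F -> bnd dom inp (fun a => (F a).+1).
Proof.
by move=> h; apply: bnd_le (bnd_add h (bnd_const 1)) => a _; rewrite addn1.
Qed.

Lemma bnd_inp : bnd dom inp (fun a => size (inp a)).
Proof. exact/ptime_size/ptime_id. Qed.

Lemma bnd_en n : ptime dom inp (fun a => en (n a)) -> bnd dom inp n.
Proof. by move=> /ptime_size; apply: bnd_le => a _; rewrite size_en. Qed.

Lemma bnd_comp q F : bnd dom inp F -> bnd dom inp (fun a => horner q (F a)).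
Proof.
move=> h; apply: (bnd_ler (b := horner q) (polyb_horner q) h).
exact: horner_mono.
Qed.

End Bounds.

Ltac bnd := repeat first [ exact: bnd_const | exact: bnd_inp | exact: bnd_en
  | apply: bnd_S | apply: bnd_add | apply: bnd_mul | apply: bnd_comp
  | apply: ptime_size ; assumption | assumption ].

Section Context.

Variables (A B : Type) (dom : A -> Prop) (domb : A * B -> Prop).
Variables (inp : A -> bits) (e : B -> bits).

Lemma ptime_p1 out : ptime dom inp out -> (forall x, domb x -> dom x.1) ->
  ptime domb (ep inp e) (fun x => out x.1).
Proof.
move=> h hd; apply: (@ptime_sub _ _ _ _ (fun x => x.1) _ _ _ h) => //.
exact: (ptime_fst (ptime_id _ _)).
Qed.

Lemma ptime_p2 : ptime domb (ep inp e) (fun x => e x.2).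
Proof. exact: (ptime_snd (ptime_id _ _)). Qed.

End Context.

(** Lists are coded in two ways, bit strings as themselves ([rawk]) and other lists self-delimited
    ([listk]). The record collects what folds use of a code, so that each list operation is treated
    once. *)
Record lkind (T : Type) (eT : T -> bits) (eL : seq T -> bits) : Prop := {
  lk_nil : eL [::] = [::];
  lk_cat l1 l2 : size (eL l2) <= size (eL (l1 ++ l2));
  lk_len l : size l <= size (eL l);
  lk_elem t l : size (eT t) <= size (eL (t :: l));
  lk_inc t l : size (eL (t :: l)) <= size (eL l) + (2 * size (eT t)).+1;
  lk_nonnil l : (eL l != [::]) = ~~ nilp l;
  lk_behead A (dom : A -> Prop) inp (l : A -> seq T) :
    ptime dom inp (fun a => eL (l a)) -> ptime dom inp (fun a => eL (behead (l a)));
  lk_head A (dom : A -> Prop) inp (h : A -> T) (l : A -> seq T) :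
    ptime dom inp (fun a => eL (h a :: l a)) -> ptime dom inp (fun a => eT (h a));
  lk_cons A (dom : A -> Prop) inp (h : A -> T) (l : A -> seq T) :
    ptime dom inp (fun a => eT (h a)) -> ptime dom inp (fun a => eL (l a)) ->
    ptime dom inp (fun a => eL (h a :: l a))
}.

Lemma rawk : lkind (fun b => eb b) (fun w => w).
Proof.
split=> //.
- by move=> l1 l2; rewrite size_cat leq_addl.
- by move=> t l /=; lia.
- by case.
- by move=> A dom inp l; apply: ptime_behead.
- by move=> A dom inp h l /ptime_head.
move=> A dom inp h l Hh Hl.
apply: (@ptime_ext _ _ _ (fun a => if h a then true :: l a else false :: l a)).
  by move=> a _; case: (h a).
by apply: ptime_if => //; [apply: ptime_dom (ptime_cons true Hl) | apply: ptime_dom (ptime_cons false Hl)] => a [].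
Qed.

Lemma listk (T : Type) (e : T -> bits) : lkind e (es e).
Proof.
split=> //.
- by move=> l1 l2; rewrite /es map_cat /code map_cat flatten_cat size_cat leq_addl.
- by elim=> // a l IH; rewrite es_cons size_pr /=; lia.
- by move=> t l; rewrite es_cons size_pr; lia.
- by move=> t l; rewrite es_cons size_pr; lia.
- by case=> // t l; rewrite es_cons -size_eq0 size_pr.
- move=> A dom inp l Hl.
  apply: (@ptime_ext _ _ _ (fun a => if es e (l a) != [::] then es e (behead (l a)) else [::])).
    by move=> a _; case: (l a) => // t l'; rewrite es_cons -size_eq0 size_pr.
  apply: ptime_if; [exact: ptime_nonnil | | exact: ptime_const].
  have Hl' : ptime (fun a => dom a /\ es e (l a) != [::]) inp (fun a => es e (l a)).
    by apply: ptime_dom Hl => a [].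
  apply: (@ptime_snd _ _ _ (fun a => if l a is t :: _ then e t else [::])).
  by apply: ptime_ext Hl' => a [_]; case: (l a).
- by move=> A dom inp h l; apply: ptime_fst.
- by move=> A dom inp h l; apply: ptime_pair.
Qed.

Section Fold.

Variables (T : Type) (eT : T -> bits) (eL : seq T -> bits) (K : lkind eT eL).
Variables (A : Type) (dom : A -> Prop) (inp : A -> bits).
Variables (S : Type) (eS : S -> bits) (l : A -> seq T) (s0 : A -> S).
Variables (f : A -> S -> T -> S) (domb : A * T * S -> Prop).
Hypothesis Hl : ptime dom inp (fun a => eL (l a)).
Hypothesis Hs : ptime dom inp (fun a => eS (s0 a)).
Hypothesis Hf : ptime domb (ep (ep inp eT) eS) (fun x => eS (f x.1.1 x.2 x.1.2)).
Hypothesis Hd : forall a l1 t l2, dom a -> l a = l1 ++ t :: l2 ->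
  domb (a, t, foldl (f a) (s0 a) l1).

(** The iterated state consists of the input, the rest of the list and the accumulator. *)
Lemma ptime_foldl_inhabited (t0 : T) :
  (exists q : {poly nat}, forall a l1 l2, dom a -> l a = l1 ++ l2 ->
     size (eS (foldl (f a) (s0 a) l1)) <= horner q (size (inp a))) ->
  ptime dom inp (fun a => eS (foldl (f a) (s0 a) (l a))).
Proof.
move=> [q hq].
pose st a i := pr (inp a) (pr (eL (drop i (l a))) (eS (foldl (f a) (s0 a) (take i (l a))))).
(* The counter is the code of the list rather than its length: it has at least as many bits as there
   are elements, and a step on an exhausted list changes nothing. *)
suff H : ptime dom inp (fun a => st a (size (eL (l a)))).
  have := ptime_snd (ptime_snd H); apply: ptime_ext => a _; rewrite take_oversize //.
  exact: (lk_len K).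
apply: ptime_iter => //.
- apply: ptime_pair; first exact: ptime_id.
  apply: ptime_pair; first by apply: ptime_ext Hl => a _; rewrite drop0.
  by apply: ptime_ext Hs => a _; rewrite take0.
- set D := fun x : A * nat => _.
  have H1 : ptime D (fun x => st x.1 x.2) (fun x => inp x.1) by apply: ptime_fst (ptime_id _ _).
  have H2 : ptime D (fun x => st x.1 x.2) (fun x => eL (drop x.2 (l x.1))).
    exact: ptime_fst (ptime_snd (ptime_id _ _)).
  have H3 : ptime D (fun x => st x.1 x.2) (fun x => eS (foldl (f x.1) (s0 x.1) (take x.2 (l x.1)))).
    exact: ptime_snd (ptime_snd (ptime_id _ _)).
  pose h (x : A * nat) := nth t0 (l x.1) x.2.
  apply: (@ptime_ext _ _ _ (fun x => if eL (drop x.2 (l x.1)) != [::] then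
     pr (inp x.1) (pr (eL (behead (drop x.2 (l x.1))))
       (eS (f x.1 (foldl (f x.1) (s0 x.1) (take x.2 (l x.1))) (h x)))) else st x.1 x.2)).
    move=> [a i] _ /=; rewrite (lk_nonnil K) /nilp size_drop subn_eq0 -ltnNge /h /st /=.
    case: ltnP => hi.
      by rewrite (take_nth t0) // -cats1 foldl_cat /= (drop_nth t0).
    by rewrite !drop_oversize ?take_oversize // (leq_trans hi).
  apply: ptime_if; [exact: ptime_nonnil | | exact: ptime_id].
  set D' := fun x : A * nat => D x /\ _.
  have DD x : D' x -> D x by case.
  have hl x : D' x -> drop x.2 (l x.1) = h x :: behead (drop x.2 (l x.1)).
    move=> [_]; rewrite (lk_nonnil K) /nilp size_drop subn_eq0 -ltnNge => hi.
    by rewrite (drop_nth t0).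
  apply: ptime_pair; first exact: ptime_dom DD H1.
  apply: ptime_pair; first by apply: (lk_behead K); apply: ptime_dom DD H2.
  apply: (@ptime_sub _ _ D' _ (fun x => (x.1, h x, foldl (f x.1) (s0 x.1) (take x.2 (l x.1)))) _ _ _ Hf).
    move=> x Dx; apply: (@Hd _ _ _ (behead (drop x.2 (l x.1)))); first by case: Dx => -[].
    by rewrite -hl // cat_take_drop.
  apply: ptime_pair; last exact: ptime_dom DD H3.
  apply: ptime_pair; first exact: ptime_dom DD H1.
  apply: (lk_head K (l := fun x => behead (drop x.2 (l x.1)))).
  by apply: (@ptime_ext _ _ _ (fun x => eL (drop x.2 (l x.1)))) => [x /hl {1}->//|]; apply: ptime_dom DD H2.
- have [r hr] := ptime_size Hl.
  have [s hs] : polyb (fun n => (2 * n + (2 * horner r n + horner q n).+1).+1) by polyb.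
  exists s => a i da _; apply: leq_trans (hs _); rewrite /st !size_pr.
  have h1 : size (eL (drop i (l a))) <= size (eL (l a)).
    by rewrite -[X in _ <= size (eL X)](cat_take_drop i) (lk_cat K).
  have h2 := hr a da.
  have h3 := hq a (take i (l a)) (drop i (l a)) da (esym (cat_take_drop _ _)).
  by lia.
Qed.

Lemma ptime_foldl :
  (exists q : {poly nat}, forall a l1 l2, dom a -> l a = l1 ++ l2 ->
     size (eS (foldl (f a) (s0 a) l1)) <= horner q (size (inp a))) ->
  ptime dom inp (fun a => eS (foldl (f a) (s0 a) (l a))).
Proof.
(* The iteration picks elements with [nth], which takes a default; over an empty type all lists are
   empty. *)
case: (classic (inhabited T)) => [[t0]|nT]; first exact: ptime_foldl_inhabited.
move=> _; apply: ptime_ext Hs => a _; case: (l a) => // t; by case: nT.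
Qed.

(** When each step adds an amount bounded in terms of the input alone, total growth is that amount
    times the length of the list, hence polynomial. *)
Lemma ptime_foldl_inc :
  (exists q : {poly nat}, forall a l1 t l2, dom a -> l a = l1 ++ t :: l2 ->
     let s := foldl (f a) (s0 a) l1 in
     size (eS (f a s t)) <= size (eS s) + horner q (size (inp a))) ->
  ptime dom inp (fun a => eS (foldl (f a) (s0 a) (l a))).
Proof.
move=> [q hq]; apply: ptime_foldl.
have [r hr] := ptime_size Hl; have [k hk] := ptime_size Hs.
have [s hs] : polyb (fun n => horner k n + horner r n * horner q n) by polyb.
exists s => a l1 l2 da e; apply: leq_trans (hs _).
apply: (@leq_trans (horner k (size (inp a)) + size l1 * horner q (size (inp a)))); last first.
  rewrite leq_add2l leq_mul2r; apply/orP; right; apply: leq_trans (hr a da).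
  by apply: leq_trans (lk_len K (l a)); rewrite e size_cat leq_addr.
elim/last_ind: l1 l2 e => [|l1 t IH] l2 e; first by rewrite addn0 hk.
rewrite -cats1 foldl_cat size_cat mulnDl addnA /= mul1n.
rewrite cat_rcons in e.
by apply: leq_trans (hq a l1 t l2 da e) _; rewrite leq_add2r; apply: IH e.
Qed.

End Fold.

Section Iter.

Variables (A : Type) (dom : A -> Prop) (inp : A -> bits).
Variables (S : Type) (eS : S -> bits) (n : A -> nat) (s0 : A -> S).
Variables (f : A -> S -> S) (domb : A * S -> Prop).
Hypothesis Hn : ptime dom inp (fun a => en (n a)).
Hypothesis Hs : ptime dom inp (fun a => eS (s0 a)).
Hypothesis Hf : ptime domb (ep inp eS) (fun x => eS (f x.1 x.2)).
Hypothesis Hd : forall a i, dom a -> i < n a -> domb (a, iter i (f a) (s0 a)).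

Let f' a s (_ : bool) := f a s.

Let foldE a m : foldl (f' a) (s0 a) (nseq m true) = iter m (f a) (s0 a).
Proof. by elim: m (s0 a) => //= m IH s; rewrite IH -iterSr. Qed.

Let split a (l1 l2 : bits) : en (n a) = l1 ++ l2 ->
  l1 = nseq (size l1) true /\ size l1 + size l2 = n a.
Proof.
move=> h; split; last by rewrite -size_cat -h size_en.
have : all (pred1 true) (l1 ++ l2) by rewrite -h all_pred1_nseq.
by rewrite all_cat => /andP[/all_pred1P].
Qed.

Let Hf' : ptime (fun x : A * bool * S => domb (x.1.1, x.2)) (ep (ep inp (fun b => eb b)) eS)
  (fun x => eS (f' x.1.1 x.2 x.1.2)).
Proof.
apply: (@ptime_sub _ _ _ _ (fun x : A * bool * S => (x.1.1, x.2)) _ _ _ Hf) => //.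
apply: ptime_pair; last exact: ptime_snd (ptime_id _ _).
exact: ptime_fst (ptime_fst (ptime_id _ _)).
Qed.

Let Hd' a (l1 : bits) t l2 : dom a -> en (n a) = l1 ++ t :: l2 ->
  domb (a, foldl (f' a) (s0 a) l1).
Proof.
move=> da /split [-> h]; rewrite foldE; apply: Hd => //.
by rewrite /= size_nseq in h *; lia.
Qed.

Lemma ptime_iterN :
  (exists q : {poly nat}, forall a i, dom a -> i <= n a ->
     size (eS (iter i (f a) (s0 a))) <= horner q (size (inp a))) ->
  ptime dom inp (fun a => eS (iter (n a) (f a) (s0 a))).
Proof.
move=> [q hq]; apply: (@ptime_ext _ _ _ (fun a => eS (foldl (f' a) (s0 a) (en (n a))))).
  by move=> a _; rewrite foldE.
apply: (ptime_foldl rawk Hn Hs Hf') => [a l1 t l2|]; first exact: Hd'.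
exists q => a l1 l2 da /split [-> h]; rewrite foldE; apply: hq => //.
by rewrite size_nseq in h *; lia.
Qed.

Lemma ptime_iterN_inc :
  (exists q : {poly nat}, forall a i, dom a -> i < n a ->
     let s := iter i (f a) (s0 a) in
     size (eS (f a s)) <= size (eS s) + horner q (size (inp a))) ->
  ptime dom inp (fun a => eS (iter (n a) (f a) (s0 a))).
Proof.
move=> [q hq]; apply: (@ptime_ext _ _ _ (fun a => eS (foldl (f' a) (s0 a) (en (n a))))).
  by move=> a _; rewrite foldE.
apply: (ptime_foldl_inc rawk Hn Hs Hf') => [a l1 t l2|]; first exact: Hd'.
exists q => a l1 t l2 da /split [-> h]; rewrite foldE; apply: hq => //.
by rewrite /= size_nseq in h *; lia.
Qed.

End Iter.

Ltac solve_dom := solve [ done | by move=> ? [] | by move=> ? [[]] | by move=> ? ? [] | (move=> * /=; simpl in *; intuition) ].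

Lemma ptime_p1_weak A B (dom : A -> Prop) (inp : A -> bits) (e : B -> bits) out :
  ptime dom inp out -> ptime (fun x : A * B => dom x.1) (ep inp e) (fun x => out x.1).
Proof. by move=> h; apply: ptime_p1 h _. Qed.

(** Contexts are nested pairs coded by [ep]. The tactic proves that a component is computable by
    projecting away the inner ones until a hypothesis applies, as one looks up a de Bruijn index. *)
Ltac ptime_var := first
  [ eassumption
  | exact: (@ptime_p2 _ _ (fun=> True) _ _)
  | exact: ptime_p2
  | exact: (@ptime_id _ (fun=> True) _)
  | exact: ptime_id
  | match goal with
    | |- @ptime (?A * ?B) ?d (ep ?i ?e) ?g =>
      let o := constr:(fun ctx_ : A * B => ltac:(
        let b := eval cbv beta in (g ctx_) in
        let b' := eval pattern (fst ctx_) in b in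
        match b' with ?f _ => exact f end)) in
      match o with
      | (fun _ => ?f) =>
        tryif is_evar d then (apply: (@ptime_p1_weak A B _ i e f); ptime_var)
        else (apply: (@ptime_p1 A B _ d i e f); [ ptime_var | solve_dom ])
      end
    end
  | match goal with
    | H : ptime ?d ?i ?g |- ptime ?d' ?i ?g => apply: ptime_dom H; solve_dom
    end ].

Lemma ptime_ifs A (dom : A -> Prop) inp (c : A -> bool) out1 out2 :
  ptime dom inp (fun a => [:: c a]) -> ptime dom inp out1 -> ptime dom inp out2 ->
  ptime dom inp (fun a => if c a then out1 a else out2 a).
Proof.
by move=> h h1 h2; apply: ptime_if => //; [apply: ptime_dom h1|apply: ptime_dom h2] => a [].
Qed.

Lemma ptime_negb A (dom : A -> Prop) inp (c : A -> bool) :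
  ptime dom inp (fun a => [:: c a]) -> ptime dom inp (fun a => [:: ~~ c a]).
Proof.
move=> h; apply: (@ptime_ext _ _ _ (fun a => if c a then [:: false] else [:: true])).
  by move=> a _; case: (c a).
by apply: ptime_ifs => //; apply: ptime_const.
Qed.

Lemma ptime_andb A (dom : A -> Prop) inp (c d : A -> bool) :
  ptime dom inp (fun a => [:: c a]) -> ptime (fun a => dom a /\ c a) inp (fun a => [:: d a]) ->
  ptime dom inp (fun a => [:: c a && d a]).
Proof.
move=> h k; apply: (@ptime_ext _ _ _ (fun a => if c a then [:: d a] else [:: false])).
  by move=> a _; case: (c a).
by apply: ptime_if => //; apply: ptime_const.
Qed.

(** * Polynomial-time operations on lists *)

Section Lists.

Variables (T : Type) (eT : T -> bits) (eL : seq T -> bits) (K : lkind eT eL).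

Lemma lk_sizeE l1 t l2 : size (eT t) <= size (eL (l1 ++ t :: l2)).
Proof. exact: leq_trans (lk_elem K t l2) (lk_cat K _ _). Qed.

Lemma ptime_nilp A (dom : A -> Prop) inp (l : A -> seq T) :
  ptime dom inp (fun a => eL (l a)) -> ptime dom inp (fun a => eb (nilp (l a))).
Proof.
move=> /ptime_nonnil/ptime_negb; apply: ptime_ext => a _.
by rewrite (lk_nonnil K) negbK.
Qed.

Lemma ptime_headl A (dom : A -> Prop) inp t0 (l : A -> seq T) :
  ptime dom inp (fun a => eL (l a)) -> ptime dom inp (fun a => eT (t0 a)) ->
  ptime dom inp (fun a => eT (head (t0 a) (l a))).
Proof.
move=> Hl Ht; apply: (@ptime_ext _ _ _ (fun a => if nilp (l a) then eT (t0 a) else eT (head (t0 a) (l a)))).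
  by move=> a _; case: (l a).
apply: ptime_if; [exact: ptime_nilp | by apply: ptime_dom Ht => a [] |].
apply: (lk_head K (l := fun a => behead (l a))).
apply: (@ptime_ext _ _ _ (fun a => eL (l a))); last by apply: ptime_dom Hl => a [].
by move=> a [_]; case: (l a).
Qed.

Lemma ptime_catrev A (dom : A -> Prop) inp (l1 l2 : A -> seq T) :
  ptime dom inp (fun a => eL (l1 a)) -> ptime dom inp (fun a => eL (l2 a)) ->
  ptime dom inp (fun a => eL (catrev (l1 a) (l2 a))).
Proof.
move=> H1 H2.
apply: (@ptime_ext _ _ _ (fun a => eL (foldl (fun s t => t :: s) (l2 a) (l1 a)))).
  by move=> a _; elim: (l1 a) (l2 a) => //= t l IH s; rewrite IH.
apply: (ptime_foldl_inc K (f := fun _ s t => t :: s) (domb := fun x => dom x.1.1)) => //.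
  by apply: (lk_cons K); ptime_var.
have [q hq] := ptime_size H1.
have [r hr] : polyb (fun n => (2 * horner q n).+1) by polyb.
exists r => a la t lb da e /=; apply: leq_trans (lk_inc K _ _) _.
rewrite leq_add2l; apply: leq_trans (hr _).
rewrite ltnS leq_mul2l /=; apply: leq_trans (hq a da); rewrite e; exact: lk_sizeE.
Qed.

Lemma ptime_rev A (dom : A -> Prop) inp (l : A -> seq T) :
  ptime dom inp (fun a => eL (l a)) -> ptime dom inp (fun a => eL (rev (l a))).
Proof.
by move=> H; apply: ptime_catrev => //; rewrite (lk_nil K); apply: ptime_const.
Qed.

Lemma ptime_cat A (dom : A -> Prop) inp (l1 l2 : A -> seq T) :
  ptime dom inp (fun a => eL (l1 a)) -> ptime dom inp (fun a => eL (l2 a)) ->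
  ptime dom inp (fun a => eL (l1 a ++ l2 a)).
Proof.
move=> /ptime_rev H1 H2; have := ptime_catrev H1 H2; apply: ptime_ext => a _.
by rewrite catrevE revK.
Qed.

Lemma ptime_size_of A (dom : A -> Prop) inp (l : A -> seq T) :
  ptime dom inp (fun a => eL (l a)) -> ptime dom inp (fun a => en (size (l a))).
Proof.
move=> H; apply: (@ptime_ext _ _ _ (fun a => en (foldl (fun n _ => n.+1) 0 (l a)))).
  move=> a _; congr en; rewrite -[RHS]addn0.
  by elim: (l a) 0 => //= t l' IH n; rewrite IH addnS.
apply: (ptime_foldl_inc K (f := fun _ n _ => n.+1) (domb := fun x => dom x.1.1)) => //.
- exact: ptime_const.
- by apply: ptime_cons; ptime_var.
- by have [q hq] := polyb_const 1; exists q => * /=; rewrite !size_nseq -addn1 leq_add2l.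
Qed.

Lemma ptime_drop A (dom : A -> Prop) inp (n : A -> nat) (l : A -> seq T) :
  ptime dom inp (fun a => en (n a)) ->
  ptime dom inp (fun a => eL (l a)) -> ptime dom inp (fun a => eL (drop (n a) (l a))).
Proof.
move=> Hn Hl; have E i (s : seq T) : iter i behead s = drop i s.
  by elim: i s => [|i IH] s; rewrite ?drop0 // iterS IH -drop1 drop_drop.
apply: (@ptime_ext _ _ _ (fun a => eL (iter (n a) behead (l a)))).
  by move=> a _; rewrite E.
apply: (ptime_iterN (f := fun _ => behead) (domb := fun x => dom x.1)) => //.
  by apply: (lk_behead K); ptime_var.
have [q hq] := ptime_size Hl; exists q => a i da _; rewrite E; apply: leq_trans (hq a da).
by rewrite -[X in _ <= size (eL X)](cat_take_drop i) (lk_cat K).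
Qed.

Lemma ptime_nth A (dom : A -> Prop) inp t0 (l : A -> seq T) n :
  ptime dom inp (fun a => eL (l a)) -> ptime dom inp (fun a => eT (t0 a)) ->
  ptime dom inp (fun a => en (n a)) ->
  ptime dom inp (fun a => eT (nth (t0 a) (l a) (n a))).
Proof.
move=> Hl Ht Hn; have := ptime_headl (ptime_drop Hn Hl) Ht; apply: ptime_ext => a _.
by rewrite -nth0 nth_drop addn0.
Qed.

Lemma ptime_all A (dom : A -> Prop) inp (l : A -> seq T) (p : A -> T -> bool)
    (domb : A * T -> Prop) :
  ptime dom inp (fun a => eL (l a)) ->
  ptime domb (ep inp eT) (fun x => eb (p x.1 x.2)) ->
  (forall a l1 t l2, dom a -> l a = l1 ++ t :: l2 -> domb (a, t)) ->
  ptime dom inp (fun a => eb (all (p a) (l a))).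
Proof.
move=> Hl Hp Hd.
apply: (@ptime_ext _ _ _ (fun a => eb (foldl (fun s t => s && p a t) true (l a)))).
  move=> a _; rewrite -[in RHS](andTb (all _ _)).
  by elim: (l a) true => [|t l' IH] s /=; rewrite ?andbT // IH andbA.
apply: (ptime_foldl K (eS := fun b => eb b) (f := fun a s t => s && p a t) (domb := fun x => dom x.1.1 /\ domb x.1)) => //.
- exact: ptime_const.
- apply: ptime_andb; [ptime_var|].
  apply: (@ptime_sub _ _ _ _ (fun x : A * T * bool => x.1) _ _ _ Hp); first by move=> x [[]].
  exact: ptime_fst (ptime_id _ _).
- by move=> a l1 t l2 da e; split=> //; apply: Hd e.
- by have [q hq] := polyb_const 1; exists q => a *; apply: (hq (size (inp a))).
Qed.

Lemma ptime_has A (dom : A -> Prop) inp (l : A -> seq T) (p : A -> T -> bool)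
    (domb : A * T -> Prop) :
  ptime dom inp (fun a => eL (l a)) ->
  ptime domb (ep inp eT) (fun x => eb (p x.1 x.2)) ->
  (forall a l1 t l2, dom a -> l a = l1 ++ t :: l2 -> domb (a, t)) ->
  ptime dom inp (fun a => eb (has (p a) (l a))).
Proof.
move=> Hl /ptime_negb Hp Hd; have := ptime_negb (ptime_all (p := fun a t => ~~ p a t) Hl Hp Hd).
by apply: ptime_ext => a _; rewrite -[in RHS](negbK (has _ _)) -all_predC.
Qed.

Lemma ptime_find A (dom : A -> Prop) inp (l : A -> seq T) (p : A -> T -> bool)
    (domb : A * T -> Prop) :
  ptime dom inp (fun a => eL (l a)) ->
  ptime domb (ep inp eT) (fun x => eb (p x.1 x.2)) ->
  (forall a l1 t l2, dom a -> l a = l1 ++ t :: l2 -> domb (a, t)) ->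
  ptime dom inp (fun a => en (find (p a) (l a))).
Proof.
move=> Hl Hp Hd.
pose f a (s : bool * nat) t := if s.1 then s else if p a t then (true, s.2) else (false, s.2.+1).
pose eS := ep (fun b => eb b) en.
suff : ptime dom inp (fun a => eS (foldl (f a) (false, 0) (l a))).
  move=> /ptime_snd; apply: ptime_ext => a _; congr en; rewrite -[RHS]addn0.
  have E n l' : foldl (f a) (true, n) l' = (true, n) by elim: l'.
  by elim: (l a) 0 => //= t l' IH n; rewrite {2}/f /=; case: (p a t); rewrite ?E // IH addnS.
have fE x : f x.1.1 x.2 x.1.2 = if x.2.1 then x.2 else
   if p x.1.1 x.1.2 then (true, x.2.2) else (false, x.2.2.+1) by [].
apply: (ptime_foldl_inc K (f := f) (domb := fun x => dom x.1.1 /\ domb x.1)) => //.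
- exact: ptime_const.
- set D := fun x => _.
  have H2 : ptime D (ep (ep inp eT) eS) (fun x => eS x.2) by exact: ptime_p2.
  have Hq : ptime D (ep (ep inp eT) eS) (fun x => eb (p x.1.1 x.1.2)).
    apply: (@ptime_sub _ _ _ _ (fun x : A * T * (bool * nat) => x.1) _ _ _ Hp); first by move=> x [].
    exact: ptime_fst (ptime_id _ _).
  apply: (@ptime_ext _ _ _ (fun x => if x.2.1 then eS x.2 else
   if p x.1.1 x.1.2 then pr [:: true] (en x.2.2) else pr [:: false] (true :: en x.2.2))).
    by move=> [[a t] [s n]] _; rewrite /f /=; case: s; case: (p a t).
  apply: ptime_ifs => //; first exact: ptime_fst H2.
  apply: ptime_ifs => //; apply: ptime_pair; try exact: ptime_const.
    exact: ptime_snd H2.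
  exact: ptime_cons (ptime_snd H2).
- by move=> a l1 t l2 da e; split=> //; apply: Hd e.
- have [q hq] := polyb_const 1; exists q => a l1 t l2 da e /=; set s := foldl _ _ _.
  apply: (@leq_trans (size (eS s) + 1)); last by rewrite leq_add2l.
  by rewrite /eS /ep !size_pr /f; case: s => [[] n] /=; case: (p a t) => /=; rewrite ?size_nseq; lia.
Qed.

Lemma ptime_filter A (dom : A -> Prop) inp (l : A -> seq T) (p : A -> T -> bool)
    (domb : A * T -> Prop) :
  ptime dom inp (fun a => eL (l a)) ->
  ptime domb (ep inp eT) (fun x => eb (p x.1 x.2)) ->
  (forall a l1 t l2, dom a -> l a = l1 ++ t :: l2 -> domb (a, t)) ->
  ptime dom inp (fun a => eL (filter (p a) (l a))).
Proof.
move=> Hl Hf Hd.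
suff : ptime dom inp (fun a => eL (foldl (fun s t => if p a t then t :: s else s) [::] (l a))).
  move=> H; have := ptime_rev H; apply: ptime_ext => a _; congr eL.
  have -> : filter (p a) (l a) = catrev [::] (filter (p a) (l a)) by [].
  elim: (l a) [::] => [|t l' IH] s /=; first by rewrite catrevE cats0.
  by rewrite IH /=; case: (p a t).
apply: (ptime_foldl_inc K (f := fun a s t => if p a t then t :: s else s) (domb := fun x => dom x.1.1 /\ domb x.1)) => //.
- by rewrite (lk_nil K); apply: ptime_const.
- apply: (@ptime_ext _ _ _ (fun x => if p x.1.1 x.1.2 then eL (x.1.2 :: x.2) else eL x.2)).
    by move=> x _; case: ifP.
  apply: ptime_ifs; last exact: ptime_p2; last by apply: (lk_cons K); ptime_var.
  apply: (@ptime_sub _ _ _ _ (fun x : A * T * seq T => x.1) _ _ _ Hf); first by move=> x [].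
  exact: ptime_fst (ptime_id _ _).
- by move=> a l1 t l2 da e; split=> //; apply: Hd e.
- have [q hq] := ptime_size Hl.
  have [r hr] : polyb (fun n => (2 * horner q n).+1) by polyb.
  exists r => a la t lb da e /=; case: ifP => _; last exact: leq_addr.
  apply: leq_trans (lk_inc K _ _) _.
  rewrite leq_add2l; apply: leq_trans (hr _).
  rewrite ltnS leq_mul2l /=; apply: leq_trans (hq a da); rewrite e; exact: lk_sizeE.
Qed.

End Lists.

Section Map.

Variables (T : Type) (eT : T -> bits) (eL : seq T -> bits) (K : lkind eT eL).
Variables (U : Type) (eU : U -> bits) (eM : seq U -> bits) (K' : lkind eU eM).

Lemma ptime_map A (dom : A -> Prop) inp (l : A -> seq T) (f : A -> T -> U)
    (domb : A * T -> Prop) :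
  ptime dom inp (fun a => eL (l a)) ->
  ptime domb (ep inp eT) (fun x => eU (f x.1 x.2)) ->
  (forall a l1 t l2, dom a -> l a = l1 ++ t :: l2 -> domb (a, t)) ->
  ptime dom inp (fun a => eM (map (f a) (l a))).
Proof.
move=> Hl Hf Hd.
suff : ptime dom inp (fun a => eM (foldl (fun s t => f a t :: s) [::] (l a))).
  move=> H; have := ptime_rev K' H; apply: ptime_ext => a _; congr eM.
  have -> : map (f a) (l a) = catrev [::] (map (f a) (l a)) by [].
  elim: (l a) [::] => [|t l' IH] s /=; first by rewrite catrevE cats0.
  by rewrite IH.
apply: (ptime_foldl_inc K (f := fun a s t => f a t :: s) (domb := fun x => dom x.1.1 /\ domb x.1)) => //.
- by rewrite (lk_nil K'); apply: ptime_const.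
- apply: (lk_cons K'); last exact: ptime_p2.
  apply: (@ptime_sub _ _ _ _ (fun x : A * T * seq U => x.1) _ _ _ Hf); first by move=> x [].
  exact: ptime_fst (ptime_id _ _).
- by move=> a l1 t l2 da e; split=> //; apply: Hd e.
- have [q hq] := ptime_size Hf; have [k hk] := ptime_size Hl.
  have [r hr] : polyb (fun n => (2 * horner q (2 * n + horner k n).+1).+1) by polyb.
  exists r => a l1 t l2 da e /=; apply: leq_trans (lk_inc K' _ _) _.
  rewrite leq_add2l; apply: leq_trans (hr _).
  rewrite ltnS leq_mul2l /=; apply: leq_trans (hq (a, t) (Hd _ _ _ _ da e)) _.
  apply: horner_mono; rewrite /ep size_pr ltnS leq_add2l /=; apply: leq_trans (hk a da).
  rewrite e; exact: (lk_sizeE K).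
Qed.

End Map.

(** * Unary arithmetic, equality tests and ranges *)

Lemma ptime_addn A (dom : A -> Prop) inp (m n : A -> nat) :
  ptime dom inp (fun a => en (m a)) -> ptime dom inp (fun a => en (n a)) ->
  ptime dom inp (fun a => en (m a + n a)).
Proof.
by move=> Hm Hn; apply: ptime_ext (ptime_cat rawk Hm Hn) => a _; rewrite /en nseqD.
Qed.

Lemma ptime_succ A (dom : A -> Prop) inp (n : A -> nat) :
  ptime dom inp (fun a => en (n a)) -> ptime dom inp (fun a => en (n a).+1).
Proof. exact: ptime_cons. Qed.

Lemma ptime_muln A (dom : A -> Prop) inp (m n : A -> nat) :
  ptime dom inp (fun a => en (m a)) -> ptime dom inp (fun a => en (n a)) ->
  ptime dom inp (fun a => en (m a * n a)).
Proof.
move=> Hm Hn; apply: (@ptime_ext _ _ _ (fun a => en (iter (m a) (addn (n a)) 0))).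
  by move=> a _; rewrite iter_addn_0 mulnC.
apply: (ptime_iterN_inc (f := fun a => addn (n a)) (domb := fun x => dom x.1)) => //.
- exact: ptime_const.
- by apply: ptime_addn; ptime_var.
- have [q hq] := bnd_en Hn; exists q => a i da _ /=; rewrite !size_nseq addnC leq_add2l.
  exact: hq.
Qed.

Lemma ptime_subn A (dom : A -> Prop) inp (m n : A -> nat) :
  ptime dom inp (fun a => en (m a)) -> ptime dom inp (fun a => en (n a)) ->
  ptime dom inp (fun a => en (m a - n a)).
Proof.
by move=> Hm Hn; apply: ptime_ext (ptime_drop rawk Hn Hm) => a _; rewrite /en drop_nseq.
Qed.

Lemma ptime_leq A (dom : A -> Prop) inp (m n : A -> nat) :
  ptime dom inp (fun a => en (m a)) -> ptime dom inp (fun a => en (n a)) ->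
  ptime dom inp (fun a => eb (m a <= n a)).
Proof.
move=> Hm Hn; apply: ptime_ext (ptime_nilp rawk (ptime_subn Hm Hn)) => a _.
by rewrite /nilp size_en.
Qed.

Lemma ptime_horner A (dom : A -> Prop) inp (n : A -> nat) (p : {poly nat}) :
  ptime dom inp (fun a => en (n a)) -> ptime dom inp (fun a => en (horner p (n a))).
Proof.
move=> Hn; elim/poly_ind: p => [|p c IH].
  by apply: (@ptime_ext _ _ _ (fun=> en 0)) => [a _|]; [rewrite horner0 | apply: ptime_const].
apply: (@ptime_ext _ _ _ (fun a => en (horner p (n a) * n a + c))).
  by move=> a _; rewrite hornerMXaddC.
apply: ptime_addn; last exact: ptime_const.
exact: ptime_muln.
Qed.

(** A fold over [u] consumes [v]. Running out of [v] clears the flag, and bits of [v] that are left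
    over are detected at the end. *)
Lemma ptime_eqbits A (dom : A -> Prop) inp (u v : A -> bits) :
  ptime dom inp u -> ptime dom inp v -> ptime dom inp (fun a => eb (u a == v a)).
Proof.
move=> Hu Hv.
pose f (s : bool * bits) b := if s.2 is c :: w then (s.1 && (c == b), w) else (false, [::]).
pose eS := ep (fun b => eb b) (fun w : bits => w).
suff H : ptime dom inp (fun a => eS (foldl f (true, v a) (u a))).
  apply: (@ptime_ext _ _ _ (fun a => eb ((foldl f (true, v a) (u a)).1 && nilp (foldl f (true, v a) (u a)).2))).
    move=> a _; rewrite -[in RHS](andTb (u a == _)).
    elim: (u a) (v a) true => [|b w IH] [|c w'] s //=; rewrite ?andbF //.
    - by rewrite IH.
    - by rewrite IH eqseq_cons (eq_sym c b) andbA.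
  apply: ptime_andb; first exact: ptime_fst H.
  by apply: ptime_dom (ptime_nilp rawk (ptime_snd H)) => a [].
apply: (ptime_foldl rawk (eS := eS) (f := fun _ => f) (domb := fun x => dom x.1.1)) => //.
- by rewrite /eS /ep /=; apply: ptime_pair => //; apply: ptime_const.
- set D := fun x => _.
  have H2 : ptime D (ep (ep inp (fun b => eb b)) eS) (fun x => eS x.2) by exact: ptime_p2.
  have Hb : ptime D (ep (ep inp (fun b => eb b)) eS) (fun x => eb x.1.2) by ptime_var.
  apply: (@ptime_ext _ _ _ (fun x => if nilp x.2.2 then pr [:: false] [::] else
    pr [:: x.2.1 && (if x.1.2 then head false x.2.2 else ~~ head false x.2.2)] (behead x.2.2))).
    by move=> [[a b] [s [|c w]]] _ //=; case: b; case: c.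
  apply: ptime_ifs; first exact: (ptime_nilp rawk (ptime_snd H2)).
    exact: ptime_const.
  apply: ptime_pair; last exact: ptime_behead (ptime_snd H2).
  have Hh := ptime_head (ptime_snd H2).
  apply: ptime_andb; first exact: ptime_fst H2.
  apply: (@ptime_dom _ D) => [x []//|].
  apply: (@ptime_ext _ _ _ (fun x => if x.1.2 then eb (head false x.2.2) else eb (~~ head false x.2.2))).
    by move=> x _; case: ifP.
  by apply: ptime_ifs => //; apply: ptime_negb.
- have [q hq] := ptime_size Hv.
  have [r hr] : polyb (fun n => horner q n + 3) by polyb.
  exists r => a l1 l2 da _; apply: leq_trans (hr _).
  apply: (@leq_trans (size (v a) + 3)); last by rewrite leq_add2r hq.
  rewrite /eS /ep size_pr; suff -> : (foldl f (true, v a) l1).2 = drop (size l1) (v a) .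
    by rewrite size_drop /=; lia.
  elim: l1 (v a) true => [|b l IH] w s /=; first by rewrite drop0.
  by case: w => [|c w]; rewrite /f /= -/f IH.
Qed.

Lemma ptime_eq (T : eqType) (e : T -> bits) A (dom : A -> Prop) inp (x y : A -> T) :
  injective e -> ptime dom inp (fun a => e (x a)) -> ptime dom inp (fun a => e (y a)) ->
  ptime dom inp (fun a => eb (x a == y a)).
Proof.
by move=> ie Hx Hy; apply: ptime_ext (ptime_eqbits Hx Hy) => a _; rewrite (inj_eq ie).
Qed.

Lemma en_inj : injective en.
Proof. by move=> m n /(congr1 size); rewrite !size_en. Qed.

Lemma pr_inj u v u' v' : pr u v = pr u' v' -> u = u' /\ v = v'.
Proof.
rewrite /pr /code_word -!catA; elim: u u' => [|b u IH] [|c u'] //=; first by case.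
by case=> -> /IH[-> ->].
Qed.

Lemma ep_inj T U (e : T -> bits) (f : U -> bits) : injective e -> injective f ->
  injective (ep e f).
Proof. by move=> ie jf [a b] [c d] /pr_inj /= [/ie -> /jf ->]. Qed.

Lemma es_inj T (e : T -> bits) : injective e -> injective (es e).
Proof.
move=> ie; elim=> [|x l IH] [|y l'] //; try by move/(congr1 size); rewrite !es_cons !size_pr.
by rewrite !es_cons => /pr_inj [/ie -> /IH ->].
Qed.

Lemma id_inj : injective (fun w : bits => w). Proof. by []. Qed.

Lemma ptime_eqn A (dom : A -> Prop) inp (x y : A -> nat) :
  ptime dom inp (fun a => en (x a)) -> ptime dom inp (fun a => en (y a)) ->
  ptime dom inp (fun a => eb (x a == y a)).
Proof. exact/ptime_eq/en_inj. Qed.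

Lemma ptime_eqns A (dom : A -> Prop) inp (x y : A -> seq nat) :
  ptime dom inp (fun a => es en (x a)) -> ptime dom inp (fun a => es en (y a)) ->
  ptime dom inp (fun a => eb (x a == y a)).
Proof. exact/ptime_eq/es_inj/en_inj. Qed.

Lemma ptime_index (T : eqType) (e : T -> bits) (eL : seq T -> bits) (K : lkind e eL)
    A (dom : A -> Prop) inp (x : A -> T) (l : A -> seq T) :
  injective e -> ptime dom inp (fun a => e (x a)) -> ptime dom inp (fun a => eL (l a)) ->
  ptime dom inp (fun a => en (index (x a) (l a))).
Proof.
move=> ie Hx Hl; apply: (ptime_find K (p := fun a t => t == x a) (domb := fun y => dom y.1)) => //.
by apply: (ptime_eq ie); ptime_var.
Qed.

Lemma ptime_mem (T : eqType) (e : T -> bits) (eL : seq T -> bits) (K : lkind e eL)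
    A (dom : A -> Prop) inp (x : A -> T) (l : A -> seq T) :
  injective e -> ptime dom inp (fun a => e (x a)) -> ptime dom inp (fun a => eL (l a)) ->
  ptime dom inp (fun a => eb (x a \in l a)).
Proof.
move=> ie Hx Hl; apply: (@ptime_ext _ _ _ (fun a => eb (has (pred1 (x a)) (l a)))).
  by move=> a _; rewrite has_pred1.
apply: (ptime_has K (p := fun a t => t == x a) (domb := fun y => dom y.1)) => //.
by apply: (ptime_eq ie); ptime_var.
Qed.

Lemma ptime_iota0 A (dom : A -> Prop) inp (n : A -> nat) :
  ptime dom inp (fun a => en (n a)) -> ptime dom inp (fun a => es en (iota 0 (n a))).
Proof.
move=> Hn; have E i : iter i (fun s => size s :: s) [::] = rev (iota 0 i).
  by elim: i => // i IH; rewrite iterS IH size_rev size_iota -addn1 iotaD rev_cat.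
suff : ptime dom inp (fun a => es en (iter (n a) (fun s => size s :: s) [::])).
  by move=> H; have := ptime_rev (listk en) H; apply: ptime_ext => a _; rewrite E revK.
apply: (ptime_iterN_inc (f := fun _ s => size s :: s) (domb := fun x => dom x.1)) => //.
- exact: ptime_const.
- apply: (lk_cons (listk en)); last by ptime_var.
  by apply: (ptime_size_of (listk en)); ptime_var.
- have [q hq] := bnd_en Hn.
  have [r hr] : polyb (fun n => (2 * horner q n).+1) by polyb.
  exists r => a i da hi /=; rewrite es_cons size_pr size_en E size_rev size_iota.
  rewrite -addSn addnC leq_add2l; apply: leq_trans (hr _); have := hq a da; lia.
Qed.

Lemma ptime_iota A (dom : A -> Prop) inp (m n : A -> nat) :
  ptime dom inp (fun a => en (m a)) -> ptime dom inp (fun a => en (n a)) ->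
  ptime dom inp (fun a => es en (iota (m a) (n a))).
Proof.
move=> Hm Hn; apply: (@ptime_ext _ _ _ (fun a => es en (map (addn (m a)) (iota 0 (n a))))).
  by move=> a _; rewrite -iotaDl addn0.
apply: (ptime_map (listk en) (listk en) (f := fun a i => m a + i) (domb := fun x => dom x.1)) => //.
  exact: ptime_iota0.
by apply: ptime_addn; ptime_var.
Qed.

Lemma ptime_nseq T (eT : T -> bits) (eL : seq T -> bits) (K : lkind eT eL)
    A (dom : A -> Prop) inp (n : A -> nat) (x : A -> T) :
  ptime dom inp (fun a => en (n a)) -> ptime dom inp (fun a => eT (x a)) ->
  ptime dom inp (fun a => eL (nseq (n a) (x a))).
Proof.
move=> Hn Hx; apply: (@ptime_ext _ _ _ (fun a => eL (iter (n a) (cons (x a)) [::]))).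
  by move=> a _; congr eL; elim: (n a) => //= i ->.
apply: (ptime_iterN_inc (f := fun a => cons (x a)) (domb := fun x => dom x.1)) => //.
- by rewrite (lk_nil K); apply: ptime_const.
- by apply: (lk_cons K); ptime_var.
- have [q hq] := ptime_size Hx.
  have [r hr] : polyb (fun n => (2 * horner q n).+1) by polyb.
  exists r => a i da hi /=; apply: leq_trans (lk_inc K _ _) _; rewrite leq_add2l.
  by apply: leq_trans (hr _); have := hq a da; lia.
Qed.

Lemma ptime_flatten T (eT : T -> bits) (eL : seq T -> bits) (K : lkind eT eL)
    (len : forall l1 l2, size (eL (l1 ++ l2)) = size (eL l1) + size (eL l2))
    A (dom : A -> Prop) inp (l : A -> seq (seq T)) :
  ptime dom inp (fun a => es eL (l a)) -> ptime dom inp (fun a => eL (flatten (l a))).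
Proof.
move=> Hl; apply: (@ptime_ext _ _ _ (fun a => eL (foldl cat [::] (l a)))).
  move=> a _; congr eL; rewrite -[RHS]cat0s; elim: (l a) [::] => [|x s IH] u /=.
    by rewrite cats0.
  by rewrite IH catA.
apply: (ptime_foldl_inc (listk eL) (f := fun _ => cat) (domb := fun x => dom x.1.1)) => //.
- by rewrite (lk_nil K); apply: ptime_const.
- by apply: (ptime_cat K); ptime_var.
- have [q hq] := ptime_size Hl; exists q => a l1 t l2 da e /=; rewrite len leq_add2l.
  by apply: leq_trans (hq a da); rewrite e; apply: lk_sizeE (listk eL) _ _ _.
Qed.

Lemma size_es_cat T (e : T -> bits) l1 l2 :
  size (es e (l1 ++ l2)) = size (es e l1) + size (es e l2).
Proof. by rewrite /es map_cat /code map_cat flatten_cat size_cat. Qed.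

Lemma ptime_flattenl T (e : T -> bits) A (dom : A -> Prop) inp (l : A -> seq (seq T)) :
  ptime dom inp (fun a => es (es e) (l a)) -> ptime dom inp (fun a => es e (flatten (l a))).
Proof. exact/(ptime_flatten (listk e))/size_es_cat. Qed.

Lemma ptime_flattenb A (dom : A -> Prop) inp (l : A -> seq bits) :
  ptime dom inp (fun a => es (fun w => w) (l a)) -> ptime dom inp (fun a => flatten (l a)).
Proof. exact/(ptime_flatten rawk)/size_cat. Qed.

(** * Membership in permutation groups *)

(** The identity moves no point; its key is [size h] together with the default 0. *)
Definition key (h : seq nat) : nat * nat :=
  let i := find (fun i => nth 0 h i != i) (iota 0 (size h)) in (i, nth 0 h i).

Definition lmul (a b : seq nat) : seq nat := [seq nth 0 b i | i <- a].
Definition ldiv (h g : seq nat) : seq nat := [seq index x g | x <- h].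

Definition sift1 (L : seq (seq nat)) (h : seq nat) : seq nat :=
  let c := [seq g <- L | key g == key h] in
  if nilp c then h else ldiv h (head [::] c).

Definition sift (n : nat) (L : seq (seq nat)) (h : seq nat) : seq nat :=
  iter n (sift1 L) h.

Definition cands (n : nat) (gs L : seq (seq nat)) : seq (seq nat) :=
  let E := iota 0 n :: gs ++ L in
  flatten [seq [seq sift n L (lmul a b) | b <- E] | a <- E].

(** Only one residue is added per round, since two residues of the same round may have the same key,
    and keys in the table are to stay distinct. *)
Definition extend (n : nat) (gs L : seq (seq nat)) : seq (seq nat) :=
  let c := [seq r <- cands n gs L | r != iota 0 n] in
  if nilp c then L else head [::] c :: L.

(** There are at most n * n keys of nontrivial permutations, so one more round than that reaches a
    fixed point. *)
Definition table (n : nat) (gs : seq (seq nat)) : seq (seq nat) :=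
  iter (n * n).+1 (extend n gs) [::].

Definition member (n : nat) (gs : seq (seq nat)) (s : seq nat) : bool :=
  sift n (table n gs) s == iota 0 n.

Section Perms.

Variable n : nat.
Implicit Types s t g h x y u : 'S_n.
Local Open Scope group_scope.

Definition perm_seq s : seq nat := [seq val (s i) | i <- enum 'I_n].

Lemma size_perm_seq s : size (perm_seq s) = n.
Proof. by rewrite size_map size_enum_ord. Qed.

Lemma nth_perm_seq s (i : 'I_n) : nth 0 (perm_seq s) i = s i.
Proof. by rewrite (nth_map i) ?size_enum_ord // nth_ord_enum. Qed.

Lemma perm_seq_inj : injective perm_seq.
Proof. by move=> s t e; apply/permP=> i; apply: val_inj; rewrite /= -!nth_perm_seq e. Qed.

Lemma perm_seq1 : perm_seq 1 = iota 0 n.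
Proof. by rewrite -val_enum_ord; apply: eq_map => i; rewrite perm1. Qed.

Lemma lmulE s t : lmul (perm_seq s) (perm_seq t) = perm_seq (s * t).
Proof.
by rewrite /lmul -map_comp; apply: eq_map => i; rewrite /= nth_perm_seq permM.
Qed.

Lemma ldivE s t : ldiv (perm_seq s) (perm_seq t) = perm_seq (s * t^-1).
Proof.
rewrite /ldiv -map_comp; apply: eq_map => i; rewrite /= permM /perm_seq.
have -> : val (s i) = (val \o t) (t^-1 (s i)) by rewrite /= permKV.
by rewrite index_map ?index_enum_ord //; apply: inj_comp perm_inj; apply: val_inj.
Qed.

Definition depth s : nat := (key (perm_seq s)).1.

Lemma keyE s : key (perm_seq s) = (depth s, nth 0 (perm_seq s) (depth s)).
Proof. by rewrite /depth /key. Qed.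

Lemma depth_fix s (i : 'I_n) : i < depth s -> s i = i.
Proof.
rewrite /depth /key /= size_perm_seq => h; have := before_find 0 h.
by rewrite nth_iota // nth_perm_seq => /negbFE/eqP; apply: val_inj.
Qed.

Lemma depth_le s : depth s <= n.
Proof. by rewrite /depth /key /= size_perm_seq -[X in _ <= X](size_iota 0) find_size. Qed.

Lemma depth_moved s (i : 'I_n) : depth s = i :> nat -> s i != i.
Proof.
rewrite /depth /key /= size_perm_seq => h.
have hf : has (fun i => nth 0 (perm_seq s) i != i) (iota 0 n) by rewrite has_find h size_iota.
by have := nth_find 0 hf; rewrite h nth_iota // nth_perm_seq.
Qed.

Lemma depth_geP s d : d <= n -> reflect (forall i : 'I_n, i < d -> s i = i) (d <= depth s).
Proof.
move=> dn; apply: (iffP idP) => [h i id|h]; first by apply: depth_fix; apply: leq_trans h.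
rewrite leqNgt; apply/negP => hd; have hn := leq_trans hd dn.
by have := @depth_moved s (Ordinal hn) erefl; rewrite h ?eqxx.
Qed.

Lemma depth_n s : depth s = n -> s = 1.
Proof. by move=> e; apply/permP=> i; rewrite perm1 depth_fix // e. Qed.

Lemma depth1 : depth 1 = n.
Proof. by apply/eqP; rewrite eqn_leq depth_le; apply/depth_geP => // i _; rewrite perm1. Qed.

Lemma depth_mul s t d : d <= depth s -> d <= depth t -> d <= depth (s * t).
Proof.
move=> hs ht; have dn := leq_trans hs (depth_le s).
by apply/depth_geP => // i id; rewrite permM (depth_fix (leq_trans id hs)) (depth_fix (leq_trans id ht)).
Qed.

(** With equal keys, [h] and [g] agree on all points up to and including the first moved one, so the
    quotient fixes all of these. *)
Lemma depth_div h g : depth h < n -> key (perm_seq g) = key (perm_seq h) -> depth h < depth (h * g^-1).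
Proof.
move=> hn e; have [e1 e2] : depth g = depth h /\ nth 0 (perm_seq g) (depth g) = nth 0 (perm_seq h) (depth h).
  by move: e; rewrite !keyE => -[-> ->].
apply/depth_geP => // i; rewrite ltnS permM leq_eqVlt => /orP[/eqP ei|hi].
  have -> : h i = g i.
    by apply: val_inj; rewrite /= -!nth_perm_seq ei -e2 e1.
  by rewrite permK.
by rewrite (depth_fix hi) -{1}[i](@depth_fix g) ?e1 // permK.
Qed.

Definition psift1 (L : seq 'S_n) h : 'S_n :=
  let c := [seq g <- L | key (perm_seq g) == key (perm_seq h)] in
  if nilp c then h else h * (head 1 c)^-1.

Lemma sift1E (L : seq 'S_n) h : sift1 (map perm_seq L) (perm_seq h) = perm_seq (psift1 L h).
Proof.
rewrite /sift1 /psift1 filter_map /nilp size_map.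
case: (filter _ L) => //= g c; exact: ldivE.
Qed.

Lemma siftE k (L : seq 'S_n) h : iter k (sift1 (map perm_seq L)) (perm_seq h) = perm_seq (iter k (psift1 L) h).
Proof. by elim: k => //= k ->; rewrite sift1E. Qed.

Lemma psift1P L h : (psift1 L h = h /\ key (perm_seq h) \notin map (key \o perm_seq) L) \/
  (exists2 g, g \in L & psift1 L h = h * g^-1 /\ key (perm_seq g) = key (perm_seq h)).
Proof.
rewrite /psift1; case E: (filter _ L) => [|g c] /=.
  left; split=> //; apply/negP => /mapP[g gL e].
  have : g \in [seq g <- L | key (perm_seq g) == key (perm_seq h)] by rewrite mem_filter gL andbT e /=.
  by rewrite E.
have : g \in [seq g <- L | key (perm_seq g) == key (perm_seq h)] by rewrite E mem_head.
by rewrite mem_filter => /andP[/eqP e gL]; right; exists g.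
Qed.

Definition psift L h := iter n (psift1 L) h.

Section Table.

Variable L : seq 'S_n.
Hypothesis Ld : {in L, forall g, depth g < n}.

Lemma psift1_1 : psift1 L 1 = 1.
Proof.
case: (psift1P L 1) => [[]//|[g gL [_]]]; rewrite !keyE => -[e _].
by have := Ld gL; rewrite e depth1 ltnn.
Qed.

Lemma iter_psift1_1 k : iter k (psift1 L) 1 = 1.
Proof. by elim: k => //= k ->; apply: psift1_1. Qed.

(** Every effective step raises the depth. As depth [n] means the identity, [n] steps suffice for
    sifting to become stable. *)
Lemma psift1_depth k h : psift1 L (iter k (psift1 L) h) = iter k (psift1 L) h \/
  k <= depth (iter k (psift1 L) h).
Proof.
elim: k => [|k IH]; first by right.
rewrite iterS; set r := iter k _ h in IH *.
case: (psift1P L r) => [[e _]|[g gL [e ek]]]; first by left; rewrite e.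
case: IH => IH; first by left; rewrite IH.
right; rewrite e; apply: leq_trans (depth_div _ ek) => //.
by have := Ld gL; move: ek; rewrite !keyE => -[-> _].
Qed.

Lemma psift_stable h : psift1 L (psift L h) = psift L h.
Proof.
case: (psift1_depth n h) => // hd; suff -> : psift L h = 1 by exact: psift1_1.
by apply: depth_n; apply/eqP; rewrite eqn_leq depth_le.
Qed.

(** If the key occurred in the table, one more step would divide by an entry; stability makes this
    entry the identity, which the table excludes. New residues thus keep the keys distinct. *)
Lemma psift_residue h : psift L h = 1 \/
  (key (perm_seq (psift L h)) \notin map (key \o perm_seq) L).
Proof.
case: (psift1P L (psift L h)) => [[_]|[g gL [e ek]]]; first by right.
have {}e : psift L h = psift L h * g^-1 by rewrite -e psift_stable.
have : g = 1 by apply: invg_inj; apply: (mulgI (psift L h)); rewrite invg1 mulg1 -e.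
by move=> g1; have := Ld gL; rewrite g1 depth1 ltnn.
Qed.

Lemma psift1E k h : iter k (psift1 L) h = 1 -> psift L h = 1.
Proof.
move=> e; have E m : iter m (psift1 L) (psift L h) = psift L h.
  by elim: m => //= m ->; apply: psift_stable.
by rewrite -(E k) /psift -iterD addnC iterD e iter_psift1_1.
Qed.

Lemma mem_psift (G : {group 'S_n}) h : {subset L <= G} -> (psift L h \in G) = (h \in G).
Proof.
move=> sL; rewrite /psift; elim: (n in iter n) => //= k <-.
by case: (psift1P L (iter k (psift1 L) h)) => [[-> _]//|[g gL [-> _]]]; rewrite groupMr // groupV sL.
Qed.

Hypothesis Lu : uniq (map (key \o perm_seq) L).
Hypothesis Lc : forall a b, a \in 1 :: L -> b \in 1 :: L -> psift L (a * b) = 1.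

(** One level of the stabilizer chain is split off: [u] is the entry by which the first sifting step
    divides, and [y] is what that step leaves. *)
Lemma sift_decomp x d : d < n -> psift L x = 1 -> d <= depth x ->
  exists y u, [/\ x = y * u, psift L y = 1, d < depth y,
    u \in 1 :: L & u = 1 \/ depth u = d].
Proof.
move=> dn hx; rewrite leq_eqVlt => /orP[/eqP e|h]; last first.
  by exists x, 1; split; rewrite ?mulg1 ?mem_head //; left.
case: (psift1P L x) => [[ex _]|[g gL [ex ek]]].
  have : psift L x = x by rewrite /psift; elim: (n in iter n) => //= k ->.
  by rewrite hx => x1; move: e; rewrite -x1 depth1 => e; rewrite e ltnn in dn.
exists (x * g^-1), g; split; rewrite ?mulgKV ?inE ?gL ?orbT //.
- apply: (@psift1E n); rewrite -ex -iterSr iterS -/(psift L x) hx; exact: psift1_1.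
- by rewrite {1}e; apply: depth_div ek; rewrite -e.
- by right; move: ek; rewrite !keyE e => -[-> _].
Qed.

(** Since [s] fixes all points up to [d], the product has the key of [w]. Keys being distinct, its
    first sifting step divides by [w] and gives back [s]. *)
Lemma sift_compose s w d : psift L s = 1 -> d < depth s -> w \in L -> depth w = d ->
  psift L (s * w) = 1.
Proof.
move=> hs hd wL hw; have dn : d < n := leq_trans hd (depth_le s).
pose i := Ordinal dn.
have sw : (s * w) i = w i by rewrite permM (@depth_fix s i hd).
have dsw : depth (s * w) = d.
  apply/eqP; rewrite eqn_leq depth_mul ?hw // ?(ltnW hd) // andbT leqNgt.
  apply/negP => h; have := @depth_fix _ i h; rewrite sw.
  by apply/eqP; apply: depth_moved.
have ksw : key (perm_seq (s * w)) = key (perm_seq w).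
  by rewrite !keyE dsw hw -[d]/(val i) !nth_perm_seq sw.
case: (psift1P L (s * w)) => [[_ /negP[]]|[g gL [e ek]]].
  by rewrite ksw; apply: (map_f (key \o perm_seq)).
have gw : g = w.
  have inj := uniqP (0, 0) Lu.
  suff ei : index g L = index w L by rewrite -(nth_index 1 gL) ei nth_index.
  have hm z : z \in L -> nth (0, 0) (map (key \o perm_seq) L) (index z L) = key (perm_seq z).
    by move=> zL; rewrite (nth_map 1) ?index_mem // nth_index.
  by apply: inj; rewrite ?inE ?size_map ?index_mem // !hm // ek ksw.
apply: (@psift1E n.+1); rewrite iterSr e gw mulgK; exact: hs.
Qed.

(** Induction along the stabilizer chain from its deep end. Products of two table entries are known
    to sift to 1; the claim spreads this to arbitrary products of elements that sift to 1. *)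
Lemma sift_closed d : d <= n -> forall x y, psift L x = 1 -> psift L y = 1 ->
  n - d <= depth x -> n - d <= depth y -> psift L (x * y) = 1.
Proof.
elim: d => [|d IH] dn x y hx hy dx dy.
  have x1 : x = 1 by apply: depth_n; apply/eqP; rewrite eqn_leq depth_le; move: dx; rewrite subn0.
  by rewrite x1 mul1g.
set D := n - d.+1 in dx dy; have Dn : D < n by rewrite /D; lia.
have DS : n - d = D.+1 by rewrite /D; lia.
(* Multiplication by a single entry: with x' = s v and v u = z w, the product is (s z) w, where s z
   lies one level deeper and w is an entry of this level or 1. *)
have R x' u : psift L x' = 1 -> D <= depth x' -> u \in L -> D <= depth u -> psift L (x' * u) = 1.
  move=> hx' dx' uL du.
  have [s [v [-> hs ds vL vd]]] := sift_decomp Dn hx' dx'.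
  have hvu : psift L (v * u) = 1 by apply: Lc => //; rewrite inE uL orbT.
  have dvu : D <= depth (v * u).
    by apply: depth_mul => //; case: vd => ->; rewrite ?depth1 // ltnW.
  have [z [w [e hz dz wL wd]]] := sift_decomp Dn hvu dvu.
  rewrite -mulgA e mulgA.
  have hsz : psift L (s * z) = 1 by apply: IH; rewrite ?DS // ltnW.
  move: wL; rewrite inE => /orP[/eqP ->|wL]; first by rewrite mulg1.
  case: wd => wd; first by rewrite wd mulg1.
  by apply: sift_compose wL wd => //; apply: depth_mul.
(* The sifting of [y'] writes it as a product of entries, which are peeled off one at a time. *)
have Q k : forall y', D <= depth y' -> iter k (psift1 L) y' = 1 -> psift L (x * y') = 1.
  elim: k => [|k IHk] y' dy'; first by move=> /= ->; rewrite mulg1.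
  rewrite iterSr; case: (psift1P L y') => [[e _]|[g gL [e ek]]]; first by rewrite e; apply: IHk.
  have dg : depth g = depth y' by move: ek; rewrite !keyE => -[].
  have dg' : D <= depth (y' * g^-1).
    by apply: ltnW; apply: leq_ltn_trans dy' (depth_div _ ek); rewrite -dg; apply: Ld.
  rewrite e => hk; rewrite -[y'](mulgKV g) mulgA; apply: R => //; last by rewrite dg.
    exact: IHk hk.
  exact: depth_mul.
exact: Q hy.
Qed.

Lemma sift_group : group_set [set x | psift L x == 1].
Proof.
apply/group_setP; split=> [|x y]; first by rewrite inE /psift iter_psift1_1.
rewrite !inE => /eqP hx /eqP hy; apply/eqP; apply: (@sift_closed n) => //; by rewrite subnn.
Qed.

End Table.

Variable gs : seq 'S_n.

Definition pcands (L : seq 'S_n) : seq 'S_n :=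
  let E := 1 :: gs ++ L in
  flatten [seq [seq psift L (a * b) | b <- E] | a <- E].

Definition pextend (L : seq 'S_n) : seq 'S_n :=
  let c := [seq r <- pcands L | r != 1] in
  if nilp c then L else head 1 c :: L.

Lemma candsE L : cands n (map perm_seq gs) (map perm_seq L) = map perm_seq (pcands L).
Proof.
rewrite /cands /pcands map_flatten -perm_seq1 -map_cat -(map_cons perm_seq) -!map_comp.
congr flatten; apply: eq_map => a /=; congr cons.
  by rewrite lmulE /sift siftE.
by rewrite -!map_comp; apply: eq_map => b /=; rewrite lmulE /sift siftE.
Qed.

Lemma extendE L : extend n (map perm_seq gs) (map perm_seq L) = map perm_seq (pextend L).
Proof.
rewrite /extend /pextend candsE -perm_seq1 filter_map /nilp size_map.
have -> : filter (preim perm_seq (fun r => r != perm_seq 1)) (pcands L) = [seq r <- pcands L | r != 1].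
  by apply: eq_filter => r /=; rewrite (inj_eq perm_seq_inj).
by case: (filter _ _).
Qed.

Lemma tableE k : iter k (extend n (map perm_seq gs)) [::] = map perm_seq (iter k pextend [::]).
Proof. by elim: k => //= k ->; rewrite extendE. Qed.

Let G := <<[set g in gs]>>%G.

Definition good (L : seq 'S_n) := [/\ {in L, forall g, depth g < n},
  uniq (map (key \o perm_seq) L) & {subset L <= G}].

Lemma pcandsP L r : reflect (exists a b, [/\ a \in 1 :: gs ++ L, b \in 1 :: gs ++ L
  & r = psift L (a * b)]) (r \in pcands L).
Proof.
apply: (iffP flatten_mapP) => [[a aE /mapP[b bE ->]]|[a [b [aE bE ->]]]]; first by exists a, b.
by exists a => //; exact: (map_f (fun b => psift L (a * b)) bE).
Qed.

Lemma pextend_good L : good L -> good (pextend L).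
Proof.
move=> [Ld Lu LG]; rewrite /pextend; case E: (filter _ _) => [|r c] //=.
have : r \in [seq r <- pcands L | r != 1] by rewrite E mem_head.
rewrite mem_filter => /andP[r1 /pcandsP[a [b [aE bE er]]]].
have EG z : z \in 1 :: gs ++ L -> z \in G.
  rewrite inE mem_cat => /or3P[/eqP ->|zg|/LG //]; first exact: group1.
  by apply: mem_gen; rewrite inE.
split.
- move=> g; rewrite inE => /orP[/eqP ->|/Ld //].
  rewrite ltn_neqAle depth_le andbT; apply: contra r1 => /eqP /depth_n ->; exact: eqxx.
- rewrite /= Lu andbT er; case: (psift_residue Ld (a * b)) => // e.
  by rewrite er e eqxx in r1.
- move=> g; rewrite inE => /orP[/eqP ->|/LG //].
  by rewrite er mem_psift // groupM // EG.
Qed.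

Lemma table_good k : good (iter k pextend [::]).
Proof. by elim: k => [|k IH]; [split | apply: pextend_good]. Qed.

Lemma good_size L : good L -> size L <= (n * n)%N.
Proof.
move=> [Ld Lu _]; rewrite -(size_map (key \o perm_seq)).
have -> : (n * n)%N = size [seq (i, j) | i <- iota 0 n, j <- iota 0 n].
  by rewrite size_allpairs size_iota.
apply: uniq_leq_size => // _ /mapP[g gL ->] /=.
have hd := Ld g gL; rewrite keyE; apply/allpairsP.
exists (depth g, nth 0 (perm_seq g) (depth g)); rewrite !mem_iota !add0n /=; split=> //.
by rewrite -[depth g]/(val (Ordinal hd)) nth_perm_seq.
Qed.

(** A round that changes the table adds an entry, so the table either has as many entries as rounds
    or is already fixed; the number of keys excludes the former in the end. *)
Lemma table_fixed : let L := iter (n * n)%N.+1 pextend [::] in pextend L = L.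
Proof.
have H k : size (iter k pextend [::]) = k \/ pextend (iter k pextend [::]) = iter k pextend [::].
  elim: k => [|k [IH|IH]]; [by left | | by right; rewrite iterS !IH].
  rewrite iterS; set L := iter k _ _ in IH *.
  case E: [seq r <- pcands L | r != 1] => [|r c]; last by left; rewrite /pextend E /= IH.
  by right; have eL : pextend L = L; [rewrite /pextend E | rewrite !eL].
case: (H (n * n)%N.+1) => // e.
by have := good_size (table_good (n * n)%N.+1); rewrite e ltnn.
Qed.

(** At the fixed point all candidates sift to 1, among them [1 * g] for every generator [g]. The
    elements that sift to 1 form a group, which therefore contains [G]. Conversely, sifting only
    multiplies by elements of [G]. *)
Lemma memberP s : member n (map perm_seq gs) (perm_seq s) = (s \in G).
Proof.
rewrite /member /table tableE /sift siftE -perm_seq1 (inj_eq perm_seq_inj) -/(psift _ s).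
have := table_fixed; have := table_good (n * n)%N.+1.
move: (iter _ _ _) => L [Ld Lu LG] /= fixL.
have Lc a b : a \in 1 :: gs ++ L -> b \in 1 :: gs ++ L -> psift L (a * b) = 1.
  move=> aE bE; apply/eqP; apply: contraT => h.
  have hin : psift L (a * b) \in [seq r <- pcands L | r != 1].
    by rewrite mem_filter h; apply/pcandsP; exists a, b.
  have := congr1 size fixL; rewrite /pextend; case: (filter _ _) hin => //= r c _; lia.
have sub a : a \in 1 :: L -> a \in 1 :: gs ++ L.
  by rewrite !inE mem_cat => /orP[->//|->]; rewrite !orbT.
have gset := sift_group Ld Lu (fun a b ha hb => Lc a b (sub a ha) (sub b hb)).
apply/idP/idP => [/eqP e|]; first by rewrite -(mem_psift _ LG) // e group1.
move=> sG; have : G \subset Group gset.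
  rewrite gen_subG; apply/subsetP => g; rewrite !inE => gg; apply/eqP.
  rewrite -[g]mul1g; apply: Lc; rewrite ?mem_head // inE mem_cat gg orbT //.
by move=> /subsetP /(_ s sG); rewrite inE.
Qed.

End Perms.

(** * Running time of the membership test *)

Notation idb := (fun w : bits => w).

Lemma ptime_key A (dom : A -> Prop) inp (h : A -> seq nat) :
  ptime dom inp (fun a => es en (h a)) -> ptime dom inp (fun a => ep en en (key (h a))).
Proof.
move=> H.
have Hi : ptime dom inp (fun a => en (find (fun i => nth 0 (h a) i != i) (iota 0 (size (h a))))).
  apply: (ptime_find (listk en) (p := fun a i => nth 0 (h a) i != i) (domb := fun x => dom x.1)) => //.
    exact/ptime_iota0/(ptime_size_of (listk en)).
  apply/ptime_negb/ptime_eqn; last by ptime_var.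
  by apply: (ptime_nth (listk en) (t0 := fun=> 0)); [ptime_var | apply: ptime_const | ptime_var].
apply: ptime_pair => //.
by apply: (ptime_nth (listk en) (t0 := fun=> 0)) => //; apply: ptime_const.
Qed.

Lemma ptime_lmul A (dom : A -> Prop) inp (g h : A -> seq nat) :
  ptime dom inp (fun a => es en (g a)) -> ptime dom inp (fun a => es en (h a)) ->
  ptime dom inp (fun a => es en (lmul (g a) (h a))).
Proof.
move=> Hg Hh.
apply: (ptime_map (listk en) (listk en) (f := fun a i => nth 0 (h a) i) (domb := fun x => dom x.1)) => //.
by apply: (ptime_nth (listk en) (t0 := fun=> 0)); [ptime_var | apply: ptime_const | ptime_var].
Qed.

Lemma ptime_ldiv A (dom : A -> Prop) inp (h g : A -> seq nat) :
  ptime dom inp (fun a => es en (h a)) -> ptime dom inp (fun a => es en (g a)) ->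
  ptime dom inp (fun a => es en (ldiv (h a) (g a))).
Proof.
move=> Hh Hg.
apply: (ptime_map (listk en) (listk en) (f := fun a x => index x (g a)) (domb := fun x => dom x.1)) => //.
by apply: (ptime_index (listk en) en_inj); ptime_var.
Qed.

Lemma ptime_sift1 A (dom : A -> Prop) inp (L : A -> seq (seq nat)) (h : A -> seq nat) :
  ptime dom inp (fun a => es (es en) (L a)) -> ptime dom inp (fun a => es en (h a)) ->
  ptime dom inp (fun a => es en (sift1 (L a) (h a))).
Proof.
move=> HL Hh.
have Hc : ptime dom inp (fun a => es (es en) [seq g <- L a | key g == key (h a)]).
  apply: (ptime_filter (listk (es en)) (p := fun a g => key g == key (h a)) (domb := fun x => dom x.1)) => //.
  by apply: (ptime_eq (ep_inj en_inj en_inj)); apply: ptime_key; ptime_var.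
apply: (@ptime_ext _ _ _ (fun a => if nilp [seq g <- L a | key g == key (h a)] then es en (h a)
  else es en (ldiv (h a) (head [::] [seq g <- L a | key g == key (h a)])))).
  by move=> a _; rewrite /sift1; case: ifP.
apply: ptime_ifs => //; first exact: (ptime_nilp (listk (es en))).
apply: ptime_ldiv => //; apply: (ptime_headl (listk (es en)) (t0 := fun=> [::])) => //.
exact: ptime_const.
Qed.

Lemma size_es_en (l : seq nat) B : all (fun i => i <= B) l ->
  size (es en l) <= size l * (2 * B).+1.
Proof.
elim: l => //= x l IH /andP[hx /IH h]; rewrite es_cons size_pr size_en mulSn; lia.
Qed.

(** Entries of a quotient are positions in an entry of the table, hence bounded independently of
    [h]. A bound that grew with each step would not survive the iteration. *)
Lemma sift1_bound L h B : (forall g, g \in L -> size g <= B) ->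
  size (sift1 L h) = size h /\
  (sift1 L h = h \/ all (fun i => i <= B) (sift1 L h)).
Proof.
move=> hB; rewrite /sift1; case E: (filter _ L) => [|g c] /=; first by split => //; left.
split; first by rewrite size_map.
right; have gL : g \in L by have : g \in g :: c by [rewrite mem_head]; rewrite -E mem_filter => /andP[].
apply/allP => _ /mapP[x _ ->]; apply: leq_trans (hB _ gL); exact: index_size.
Qed.

Lemma ptime_sift A (dom : A -> Prop) inp n (L : A -> seq (seq nat)) (h : A -> seq nat) :
  ptime dom inp (fun a => en (n a)) ->
  ptime dom inp (fun a => es (es en) (L a)) -> ptime dom inp (fun a => es en (h a)) ->
  ptime dom inp (fun a => es en (sift (n a) (L a) (h a))).
Proof.
move=> Hn HL Hh.
apply: (ptime_iterN (f := fun a => sift1 (L a)) (domb := fun x => dom x.1)) => //.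
  by apply: ptime_sift1; ptime_var.
have [q hq] := ptime_size Hh; have [r hr] := ptime_size HL.
have [s hs] : polyb (fun n => horner q n + horner q n * (2 * horner r n).+1) by polyb.
exists s => a i da _; apply: leq_trans (hs _).
pose B := size (es (es en) (L a)).
have hB g : g \in L a -> size g <= B.
  rewrite /B => /splitPr[l1 l2]; apply: leq_trans (lk_sizeE (listk (es en)) _ _ _).
  exact: lk_len (listk en) _.
set it := iter i _ _.
have [e1 e2] : size it = size (h a) /\ (it = h a \/ all (fun i => i <= B) it).
  rewrite /it; elim: i {it} => [|i [IH1 IH2]] /=; first by split => //; left.
  have [-> [->|]] := sift1_bound (iter i (sift1 (L a)) (h a)) hB; first by split.
  by move=> h2; split=> //; right.
case: e2 => [->|e2]; first exact: leq_trans (hq a da) (leq_addr _ _).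
apply: leq_trans (size_es_en e2) _; apply: leq_trans (leq_addl _ _).
have h1 := hq a da; have h2 := hr a da; have h3 := lk_len (listk en) (h a).
rewrite e1; apply: leq_mul; first exact: leq_trans h3 h1.
by rewrite ltnS leq_mul2l.
Qed.

Lemma ptime_cands A (dom : A -> Prop) inp n (gs L : A -> seq (seq nat)) :
  ptime dom inp (fun a => en (n a)) -> ptime dom inp (fun a => es (es en) (gs a)) ->
  ptime dom inp (fun a => es (es en) (L a)) ->
  ptime dom inp (fun a => es (es en) (cands (n a) (gs a) (L a))).
Proof.
move=> Hn Hg HL; pose E a := iota 0 (n a) :: gs a ++ L a.
have HE : ptime dom inp (fun a => es (es en) (E a)).
  by apply: (lk_cons (listk (es en))); [exact: ptime_iota0 | exact: (ptime_cat (listk (es en)))].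
apply: ptime_flattenl.
apply: (ptime_map (listk (es en)) (listk (es (es en)))
  (f := fun a x => [seq sift (n a) (L a) (lmul x b) | b <- E a]) (domb := fun x => dom x.1)) => //.
apply: (ptime_map (listk (es en)) (listk (es en))
  (f := fun (x : A * seq nat) b => sift (n x.1) (L x.1) (lmul x.2 b)) (domb := fun x => dom x.1.1)) => //.
  by ptime_var.
by apply: ptime_sift; [ptime_var | ptime_var | apply: ptime_lmul; ptime_var].
Qed.

Lemma ptime_extend A (dom : A -> Prop) inp n (gs L : A -> seq (seq nat)) :
  ptime dom inp (fun a => en (n a)) -> ptime dom inp (fun a => es (es en) (gs a)) ->
  ptime dom inp (fun a => es (es en) (L a)) ->
  ptime dom inp (fun a => es (es en) (extend (n a) (gs a) (L a))).
Proof.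
move=> Hn Hg HL.
pose c a := [seq r <- cands (n a) (gs a) (L a) | r != iota 0 (n a)].
have Hc : ptime dom inp (fun a => es (es en) (c a)).
  apply: (ptime_filter (listk (es en)) (p := fun a r => r != iota 0 (n a)) (domb := fun x => dom x.1)) => //.
    exact: ptime_cands.
  by apply: ptime_negb; apply: ptime_eqns; [ptime_var | apply: ptime_iota0; ptime_var].
apply: (@ptime_ext _ _ _ (fun a => if nilp (c a) then es (es en) (L a)
  else es (es en) (head [::] (c a) :: L a))).
  by move=> a _; rewrite /extend -/(c a); case: ifP.
apply: ptime_ifs => //; first exact: (ptime_nilp (listk (es en))).
apply: (lk_cons (listk (es en))) => //.
by apply: (ptime_headl (listk (es en)) (t0 := fun=> [::])) => //; apply: ptime_const.
Qed.

Lemma size_es_perm_seq n (s : 'S_n) : size (es en (perm_seq s)) <= n * (2 * n).+1.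
Proof.
rewrite -{2}(size_perm_seq s); apply: size_es_en; apply/allP => _ /mapP[i _ ->].
by rewrite /= ltnW.
Qed.

Lemma size_es_all T (e : T -> bits) (l : seq T) B : all (fun t => size (e t) <= B) l ->
  size (es e l) <= size l * (2 * B).+1.
Proof.
elim: l => //= x l IH /andP[hx /IH h]; rewrite es_cons size_pr mulSn; lia.
Qed.

(** That the generators are permutations enters the size estimate: only then does the table have at
    most n * n entries, each a permutation, at all stages. *)
Lemma ptime_member A (dom : A -> Prop) inp n (gs : A -> seq (seq nat)) s :
  (forall a, dom a -> exists gs' : seq 'S_(n a), gs a = map (@perm_seq (n a)) gs') ->
  ptime dom inp (fun a => en (n a)) -> ptime dom inp (fun a => es (es en) (gs a)) ->
  ptime dom inp (fun a => es en (s a)) ->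
  ptime dom inp (fun a => eb (member (n a) (gs a) (s a))).
Proof.
move=> Hd Hn Hg Hs; apply: ptime_eqns; last exact: ptime_iota0.
apply: ptime_sift => //.
apply: (ptime_iterN (n := fun a => (n a * n a).+1) (s0 := fun=> [::])
   (f := fun a => extend (n a) (gs a)) (domb := fun x => dom x.1)) => //.
- exact/ptime_succ/ptime_muln.
- exact: ptime_const.
- by apply: ptime_extend; ptime_var.
have Hb : bnd dom inp (fun a => n a * n a * (2 * (n a * (2 * n a).+1)).+1) by bnd.
have [q hq] := Hb; exists q => a i da _; apply: leq_trans (hq a da).
have [gs' ->] := Hd a da; rewrite tableE.
have hg := table_good gs' i; apply: (@leq_trans (size (iter i (pextend gs') [::]) * (2 * (n a * (2 * n a).+1)).+1)).
  rewrite -(size_map (@perm_seq _)); apply: size_es_all; apply/allP => _ /mapP[t _ ->].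
  exact: size_es_perm_seq.
by rewrite leq_mul2r (good_size hg) orbT.
Qed.

(** * Decoding of numbers and words *)

Definition enc_nats (l : seq nat) : bits :=
  flatten [seq nseq i true ++ [:: false] | i <- l].

Definition dec_nats (w : bits) : seq nat :=
  rev (foldl (fun (s : nat * seq nat) (b : bool) =>
    if b then (s.1.+1, s.2) else (0, s.1 :: s.2)) (0, [::]) w).2.

Lemma enc_natsK : cancel enc_nats dec_nats.
Proof.
move=> l; rewrite /dec_nats -[RHS]/(catrev [::] l); move: [::] => s.
elim: l s => [|x l IH] s; first by rewrite /= catrevE cats0.
rewrite /enc_nats /= -/(enc_nats l) -catA foldl_cat.
have -> m : foldl (fun (s : nat * seq nat) (b : bool) =>
    if b then (s.1.+1, s.2) else (0, s.1 :: s.2)) (m, s) (nseq x true) = (x + m, s).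
  by elim: x m => //= x IHx m; rewrite IHx addnS.
by rewrite /= addn0 IH.
Qed.

Lemma enc_permE n (s : 'S_n) : enc_perm s = enc_nats (perm_seq s).
Proof. by rewrite /enc_nats -map_comp. Qed.

(** The state records whether a marker 1 has just been read, then the current word and the finished
    words, both in reverse. *)
Definition dec_words (x : bits) : seq bits :=
  rev (foldl (fun (s : bool * (bits * seq bits)) (b : bool) =>
    if s.1 then (false, (b :: s.2.1, s.2.2))
    else if b then (true, s.2) else (false, ([::], rev s.2.1 :: s.2.2)))
    (false, ([::], [::])) x).2.2.

Lemma codeK : cancel code dec_words.
Proof.
move=> ws; rewrite /dec_words; set f := fun (s : bool * _) => _.
suff H s : rev (foldl f (false, ([::], s)) (code ws)).2.2 = catrev s ws by apply: H.
elim: ws s => [|w ws IH] s; first by rewrite /= catrevE cats0.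
rewrite /code /= -/(code ws) foldl_cat /code_word foldl_cat.
have -> u : foldl f (false, (u, s)) (flatten [seq [:: true; b] | b <- w]) = (false, (catrev w u, s)).
  by elim: w u => //= b w IHw u; rewrite IHw.
by rewrite /= /f /= -/f -/(rev (rev w)) revK IH.
Qed.

Lemma ptime_enc_nats A (dom : A -> Prop) inp (l : A -> seq nat) :
  ptime dom inp (fun a => es en (l a)) -> ptime dom inp (fun a => enc_nats (l a)).
Proof.
move=> H; apply: ptime_flattenb.
apply: (ptime_map (listk en) (listk idb) (f := fun _ i => nseq i true ++ [:: false]) (domb := fun x => dom x.1)) => //.
by apply: (ptime_cat rawk); [ptime_var | apply: ptime_const].
Qed.

Lemma ptime_dec_nats A (dom : A -> Prop) inp (w : A -> bits) :
  ptime dom inp w -> ptime dom inp (fun a => es en (dec_nats (w a))).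
Proof.
move=> H; apply: (ptime_rev (listk en)).
set f := fun (s : nat * seq nat) => _.
apply: (@ptime_snd _ _ _ (fun a => en (foldl f (0, [::]) (w a)).1)).
apply: (ptime_foldl_inc rawk (eS := ep en (es en)) (f := fun _ => f) (s0 := fun=> (0, [::])) (domb := fun x => dom x.1.1)) => //.
- exact: ptime_const.
- set D := fun x => _.
  have H2 : ptime D (ep (ep inp (fun b => eb b)) (ep en (es en))) (fun x => ep en (es en) x.2) by exact: ptime_p2.
  apply: (@ptime_ext _ _ _ (fun x => if x.1.2 then pr (en x.2.1.+1) (es en x.2.2)
     else pr (en 0) (es en (x.2.1 :: x.2.2)))).
    by move=> x _; rewrite /f; case: ifP.
  apply: ptime_ifs; first by ptime_var.
    by apply: ptime_pair; [exact: ptime_succ (ptime_fst H2) | exact: ptime_snd H2].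
  apply: ptime_pair; first exact: ptime_const.
  by apply: (lk_cons (listk en)); [exact: ptime_fst H2 | exact: ptime_snd H2].
- have [q hq] := polyb_const 2; exists q => a l1 b l2 da _ /=.
  set s := foldl _ _ _; apply: leq_trans (_ : _ <= size (ep en (es en) s) + 2) _; last by rewrite leq_add2l.
  by rewrite /f /ep; case: b; rewrite /= ?es_cons !size_pr !size_nseq; lia.
Qed.

Lemma ptime_dec_words A (dom : A -> Prop) inp (w : A -> bits) :
  ptime dom inp w -> ptime dom inp (fun a => es idb (dec_words (w a))).
Proof.
move=> H; apply: (ptime_rev (listk idb)).
set f := fun (s : bool * (bits * seq bits)) => _.
pose eS := ep (fun b => eb b) (ep idb (es idb)).
suff HH : ptime dom inp (fun a => eS (foldl f (false, ([::], [::])) (w a))) by exact: ptime_snd (ptime_snd HH).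
apply: (ptime_foldl_inc rawk (eS := eS) (f := fun _ => f) (s0 := fun=> (false, ([::], [::]))) (domb := fun x => dom x.1.1)) => //.
- exact: ptime_const.
- set D := fun x => _.
  have H2 : ptime D (ep (ep inp (fun b => eb b)) eS) (fun x => eS x.2) by exact: ptime_p2.
  have Hm := ptime_fst H2; have Hc := ptime_fst (ptime_snd H2); have Ha := ptime_snd (ptime_snd H2).
  apply: (@ptime_ext _ _ _ (fun x => if x.2.1 then pr [:: false] (pr (x.1.2 :: x.2.2.1) (es idb x.2.2.2)) else
     if x.1.2 then pr [:: true] (pr x.2.2.1 (es idb x.2.2.2))
     else pr [:: false] (pr [::] (es idb (rev x.2.2.1 :: x.2.2.2))))).
    by move=> x _; rewrite /f; case: ifP => //; case: ifP.
  have Hb : ptime D (ep (ep inp (fun b => eb b)) eS) (fun x => eb x.1.2) by ptime_var.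
  apply: ptime_ifs => //.
    by apply: ptime_pair; [exact: ptime_const | apply: ptime_pair => //; apply: (lk_cons rawk)].
  apply: ptime_ifs => //; (apply: ptime_pair; first exact: ptime_const); apply: ptime_pair => //; first exact: ptime_const.
  by apply: (lk_cons (listk idb)) => //; apply: (ptime_rev rawk).
- have [q hq] := polyb_const 2; exists q => a l1 b l2 da _ /=.
  set s := foldl _ _ _; apply: leq_trans (_ : _ <= size (eS s) + 2) _; last by rewrite leq_add2l.
  by rewrite /f /eS /ep; case: ifP => _; [|case: b]; rewrite /= ?es_cons !size_pr /= ?size_rev; lia.
Qed.

(** * PLOM is in PLS *)

Lemma bits_val_cons b w : bits_val (b :: w) = b * 2 ^ size w + bits_val w.
Proof.
have H a : foldl (fun a (b : bool) => a.*2 + b) a w = a * 2 ^ size w + bits_val w.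
  elim: w a => [|c w IH] a /=; first by rewrite muln1 addn0.
  rewrite /bits_val /= !IH expnS; lia.
by rewrite /bits_val /= H /bits_val.
Qed.

Lemma bits_val_lt w : bits_val w < 2 ^ size w.
Proof.
elim: w => // b w IH; rewrite bits_val_cons /= expnS.
by case: b; rewrite ?mul1n ?mul0n; lia.
Qed.

(** Consequently the string of a solution, read as a binary number, serves as its cost. *)
Lemma lexi_bits_val (u v : bits) : size u = size v ->
  ((u : seqlexi bool) <= v)%O = (bits_val u <= bits_val v).
Proof.
elim: u v => [|b u IH] [|c v] //= [e]; rewrite Order.SeqLexiOrder.Exports.lexi_cons IH // !bits_val_cons e.
have := bits_val_lt u; have := bits_val_lt v; rewrite e.
by case: b; case: c; rewrite /= ?mul1n ?mul0n => h1 h2 //; lia.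
Qed.

(** Surjectivity onto the n positions; by counting this makes the list a permutation. *)
Definition isperm (n : nat) (l : seq nat) : bool :=
  (size l == n) && all (fun i => i \in l) (iota 0 n).

Lemma ispermP n l : reflect (exists s : 'S_n, l = perm_seq s) (isperm n l).
Proof.
apply: (iffP andP) => [[/eqP sl /allP al]|[s ->]]; last first.
  rewrite size_perm_seq; split=> //; apply/allP => i; rewrite mem_iota => /andP[_ hi].
  have -> : i = (s (s^-1%g (Ordinal hi)) : 'I_n) by rewrite permKV.
  by apply/mapP; exists (s^-1%g (Ordinal hi)); rewrite ?mem_enum.
have sz : size l <= size (iota 0 n) by rewrite size_iota sl.
have [_ ei] := uniq_min_size (iota_uniq 0 n) al sz.
have ul : uniq l by apply: leq_size_uniq (iota_uniq 0 n) al sz.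
have hl (i : 'I_n) : nth 0 l i < n.
  by have := mem_nth 0 (_ : i < size l); rewrite sl -ei mem_iota => /(_ (ltn_ord i)).
pose f (i : 'I_n) := Ordinal (hl i).
have fi : injective f.
  move=> i j [/eqP]; rewrite nth_uniq ?sl // => /eqP; exact: val_inj.
exists (perm fi); apply: (@eq_from_nth _ 0); rewrite ?size_perm_seq // => i.
by rewrite sl => hi; rewrite -[i]/(val (Ordinal hi)) nth_perm_seq permE.
Qed.

(** Decoders accept every word, so well-formed words are recognized by decoding and encoding
    again. *)
Definition perm_word (n : nat) (w : bits) : bool :=
  (enc_nats (dec_nats w) == w) && isperm n (dec_nats w).

Lemma perm_wordP n w : reflect (exists s : 'S_n, w = enc_perm s) (perm_word n w).
Proof.
apply: (iffP andP) => [[/eqP e /ispermP[s es]]|[s ->]].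
  by exists s; rewrite enc_permE -es.
by rewrite enc_permE enc_natsK; split=> //; apply/ispermP; exists s.
Qed.

Definition inst_str (x : bits) : bits := head [::] (dec_words x).
Definition inst_n (x : bits) : nat := size (inst_str x).
Definition inst_gens (x : bits) : seq (seq nat) :=
  [seq dec_nats w | w <- behead (dec_words x)].

Definition inst_ok (x : bits) : bool :=
  [&& code (dec_words x) == x, ~~ nilp (dec_words x)
    & all (perm_word (inst_n x)) (behead (dec_words x))].

Lemma size_word_of n (v : 'I_n -> bool) : size (word_of v) = n.
Proof. by rewrite size_map size_enum_ord. Qed.

Lemma dec_instance I : dec_words (enc_instance I) =
  word_of (str I) :: [seq enc_perm pi | pi <- gens I].
Proof. exact: codeK. Qed.

Lemma inst_strE I : inst_str (enc_instance I) = word_of (str I).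
Proof. by rewrite /inst_str dec_instance. Qed.

Lemma inst_nE I : inst_n (enc_instance I) = npos I.
Proof. by rewrite /inst_n inst_strE size_word_of. Qed.

Lemma inst_gensE I : inst_gens (enc_instance I) = map (@perm_seq _) (gens I).
Proof.
rewrite /inst_gens dec_instance /= -map_comp; apply: eq_map => s /=.
by rewrite enc_permE enc_natsK.
Qed.

Lemma inst_okP x : is_instance PLOM x <-> inst_ok x.
Proof.
split=> [[I ->]|/and3P[/eqP e nn /allP al]].
  rewrite /inst_ok inst_nE dec_instance eqxx /=; apply/allP => _ /mapP[s _ ->].
  by apply/perm_wordP; exists s.
move: e nn al; rewrite /inst_n /inst_str; case: (dec_words x) => //= w ws e _ al.
have [gs egs] : exists gs : seq 'S_(size w), ws = [seq enc_perm g | g <- gs].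
  elim: ws al {e} => [|u ws IH] al; first by exists [::].
  have [s es] := perm_wordP _ _ (al u (mem_head _ _)).
  have [|gs egs] := IH; first by move=> v hv; apply: al; rewrite inE hv orbT.
  by exists (s :: gs); rewrite /= -es -egs.
exists (@PlomInstance (size w) gs (fun i => nth false w i)); rewrite /enc_instance /= -egs -e.
congr (code (_ :: _)); apply: (@eq_from_nth _ false); rewrite ?size_word_of // => i hi.
by rewrite (nth_map (Ordinal hi)) ?size_enum_ord // nth_enum_ord.
Qed.

Definition plom_feas (x y : bits) : bool :=
  perm_word (inst_n x) y && member (inst_n x) (inst_gens x) (dec_nats y).

Lemma plom_feasP x y : is_instance PLOM x -> (feasible PLOM x y <-> plom_feas x y).
Proof.
move=> [I0 e0]; split=> [[I [s [ex ey hs]]]|].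
  rewrite /plom_feas ex inst_nE inst_gensE ey enc_permE enc_natsK memberP -enc_permE.
  by apply/andP; split=> //; apply/perm_wordP; exists s.
rewrite /plom_feas e0 inst_nE inst_gensE => /andP[/perm_wordP[s ->]].
rewrite enc_permE enc_natsK memberP => hs; exists I0, s; split=> //.
by rewrite enc_permE.
Qed.

Definition plom_init (x : bits) : bits := enc_nats (iota 0 (inst_n x)).
Definition plom_cost (x y : bits) : bits :=
  [seq nth false (inst_str x) i | i <- dec_nats y].
Definition plom_nbrs (x y : bits) : seq bits :=
  [seq enc_nats (lmul g (dec_nats y)) | g <- inst_gens x].

Lemma plom_costE I (s : 'S_(npos I)) :
  plom_cost (enc_instance I) (enc_perm s) = word_of (str I \o s).
Proof.
rewrite /plom_cost enc_permE enc_natsK inst_strE /perm_seq -map_comp; apply: eq_map => i /=.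
by rewrite (nth_map (s i)) ?size_enum_ord // nth_ord_enum.
Qed.

Lemma plom_nbrsE I (s : 'S_(npos I)) :
  plom_nbrs (enc_instance I) (enc_perm s) = [seq enc_perm (pi * s)%g | pi <- gens I].
Proof.
rewrite /plom_nbrs inst_gensE -map_comp; apply: eq_map => pi /=.
by rewrite !enc_permE enc_natsK lmulE.
Qed.

(** The product [pi * s] applies [pi] first, so multiplying a solution by a generator on the left
    composes its string with the generator on the right. *)
Lemma plom_betterE I (s pi : 'S_(npos I)) :
  ~~ better false (plom_cost (enc_instance I) (enc_perm (pi * s)%g))
       (plom_cost (enc_instance I) (enc_perm s)) = lex_le (str I \o s) (str I \o s \o pi).
Proof.
rewrite /better !plom_costE /lex_le lexi_bits_val ?size_word_of // -leqNgt.
congr (_ <= bits_val _); apply: eq_map => i; by rewrite /= permM.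
Qed.

Lemma plom_local_optP x y : is_instance PLOM x ->
  (local_opt PLOM x y <-> feasible PLOM x y /\ forall y', y' \in plom_nbrs x y ->
     ~~ better false (plom_cost x y') (plom_cost x y)).
Proof.
move=> _; split=> [[I [s [-> -> hs hm]]]|[[I [s [-> -> hs]]] hm]].
  split; first by exists I, s.
  by move=> y'; rewrite plom_nbrsE => /mapP[pi hpi ->]; rewrite plom_betterE; apply: hm.
exists I, s; split=> // v pi hpi; rewrite -plom_betterE; apply: hm.
by rewrite plom_nbrsE; apply: map_f.
Qed.

(* Distinct instances may share their encoding (through the functional str), so
   the witness is transported to the given one. *)
Lemma plom_local_opt_enc I y : local_opt PLOM (enc_instance I) y ->
  exists s : 'S_(npos I), [/\ y = enc_perm s, plom_solution s & plom_local_min s].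
Proof.
have iI : is_instance PLOM (enc_instance I) by exists I.
move=> /(plom_local_optP _ iI)[/(plom_feasP _ iI)]; rewrite /plom_feas inst_nE inst_gensE.
move=> /andP[/perm_wordP[s ->]]; rewrite enc_permE enc_natsK memberP -enc_permE => hs hm.
exists s; split=> // v pi hpi; rewrite -plom_betterE; apply: hm.
by rewrite plom_nbrsE; apply: map_f.
Qed.

(** * Running time of the local search on PLOM *)

Section Poly.

Variables (A : Type) (dom : A -> Prop) (inp x y : A -> bits).
Hypothesis Hx : ptime dom inp x.
Hypothesis Hy : ptime dom inp y.

Lemma ptime_inst_str : ptime dom inp (fun a => inst_str (x a)).
Proof.
apply: (ptime_headl (listk idb) (t0 := fun=> [::])); last exact: ptime_const.
exact: ptime_dec_words.
Qed.

Lemma ptime_inst_n : ptime dom inp (fun a => en (inst_n (x a))).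
Proof. exact: (ptime_size_of rawk ptime_inst_str). Qed.

Lemma ptime_inst_gens : ptime dom inp (fun a => es (es en) (inst_gens (x a))).
Proof.
apply: (ptime_map (listk idb) (listk (es en)) (f := fun=> dec_nats) (domb := fun x => dom x.1)) => //.
  by apply: (lk_behead (listk idb)); apply: ptime_dec_words.
by apply: ptime_dec_nats; ptime_var.
Qed.

End Poly.

Lemma ptime_isperm A (dom : A -> Prop) inp n (l : A -> seq nat) :
  ptime dom inp (fun a => en (n a)) -> ptime dom inp (fun a => es en (l a)) ->
  ptime dom inp (fun a => eb (isperm (n a) (l a))).
Proof.
move=> Hn Hl; apply: ptime_andb.
  by apply: ptime_eqn => //; apply: (ptime_size_of (listk en)).
apply: (@ptime_dom _ dom) => [a []//|].
apply: (ptime_all (listk en) (p := fun a i => i \in l a) (domb := fun x => dom x.1)) => //.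
  exact: ptime_iota0.
by apply: (ptime_mem (listk en) en_inj); ptime_var.
Qed.

Lemma ptime_perm_word A (dom : A -> Prop) inp n w :
  ptime dom inp (fun a => en (n a)) -> ptime dom inp w ->
  ptime dom inp (fun a => eb (perm_word (n a) (w a))).
Proof.
move=> Hn Hw; have Hd := ptime_dec_nats Hw; apply: ptime_andb.
  by apply: ptime_eqbits => //; apply: ptime_enc_nats.
apply: (@ptime_dom _ dom) => [a []//|]; exact: ptime_isperm.
Qed.

Lemma ptime_inst_ok A (dom : A -> Prop) inp x : ptime dom inp x ->
  ptime dom inp (fun a => eb (inst_ok (x a))).
Proof.
move=> Hx; have Hw := ptime_dec_words Hx; have Hn := ptime_inst_n Hx.
apply: ptime_andb.
  apply: ptime_eqbits => //; apply: ptime_ext Hw => a _; by rewrite /es map_id.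
apply: (@ptime_dom _ dom) => [a []//|]; apply: ptime_andb.
  exact/ptime_negb/(ptime_nilp (listk idb)).
apply: (@ptime_dom _ dom) => [a []//|].
apply: (ptime_all (listk idb) (p := fun a w => perm_word (inst_n (x a)) w) (domb := fun x => dom x.1)) => //.
  exact: (lk_behead (listk idb)).
by apply: ptime_perm_word; ptime_var.
Qed.

Notation pair_inp := (fun xs : bits * bits => code [:: xs.1; xs.2]).

Lemma ptime_arg1 (dom : bits * bits -> Prop) : ptime dom pair_inp (fun xs => xs.1).
Proof. exact: (@ptime_fst _ _ _ _ (fun xs => pr xs.2 [::]) (ptime_id _ _)). Qed.

Lemma ptime_arg2 (dom : bits * bits -> Prop) : ptime dom pair_inp (fun xs => xs.2).
Proof.
exact: (@ptime_fst _ _ _ _ (fun=> [::]) (@ptime_snd _ _ _ (fun xs => xs.1) _ (ptime_id _ _))).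
Qed.

Lemma inst_gens_perm_seq x : is_instance PLOM x ->
  exists gs : seq 'S_(inst_n x), inst_gens x = map (@perm_seq _) gs.
Proof.
move=> [I ->]; rewrite inst_gensE inst_nE; by exists (gens I).
Qed.

Lemma ptime_plom_feas (dom : bits * bits -> Prop) : (forall xs, dom xs -> is_instance PLOM xs.1) ->
  ptime dom pair_inp (fun xs => eb (plom_feas xs.1 xs.2)).
Proof.
move=> hd; have H1 := @ptime_arg1 dom; have H2 := @ptime_arg2 dom.
apply: ptime_andb; first exact: ptime_perm_word (ptime_inst_n H1) H2.
apply: (@ptime_dom _ dom) => [a []//|]; apply: ptime_member.
- by move=> xs /hd /inst_gens_perm_seq.
- exact: ptime_inst_n.
- exact: ptime_inst_gens.
- exact: ptime_dec_nats.
Qed.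

Lemma ptime_plom_cost (dom : bits * bits -> Prop) :
  ptime dom pair_inp (fun xs => plom_cost xs.1 xs.2).
Proof.
have H1 := @ptime_arg1 dom; have H2 := @ptime_arg2 dom.
have Hs := ptime_inst_str H1.
apply: (ptime_map (listk en) rawk (f := fun xs i => nth false (inst_str xs.1) i) (domb := fun x => dom x.1)) => //.
  exact: ptime_dec_nats.
by apply: (ptime_nth rawk (t0 := fun=> false)); [ptime_var | apply: ptime_const | ptime_var].
Qed.

Lemma ptime_plom_nbrs (dom : bits * bits -> Prop) :
  ptime dom pair_inp (fun xs => code (plom_nbrs xs.1 xs.2)).
Proof.
have H1 := @ptime_arg1 dom; have H2 := ptime_dec_nats (@ptime_arg2 dom).
apply: (@ptime_ext _ _ _ (fun xs => es idb (plom_nbrs xs.1 xs.2))).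
  by move=> xs _; rewrite /es map_id.
apply: (ptime_map (listk (es en)) (listk idb) (f := fun xs g => enc_nats (lmul g (dec_nats xs.2))) (domb := fun x => dom x.1)) => //.
  exact: ptime_inst_gens.
by apply: ptime_enc_nats; apply: ptime_lmul; ptime_var.
Qed.

Lemma size_enc_nats l B : all (fun i => i <= B) l -> size (enc_nats l) <= size l * B.+1.
Proof.
elim: l => //= i l IH /andP[hi /IH h].
by rewrite /enc_nats /= -/(enc_nats l) !size_cat size_nseq /=; lia.
Qed.

Lemma size_enc_perm n (s : 'S_n) : size (enc_perm s) <= n * n.+1.
Proof.
rewrite enc_permE -{2}(size_perm_seq s); apply: size_enc_nats; apply/allP => _ /mapP[i _ ->].
by rewrite /= ltnW.
Qed.

Lemma npos_le I : npos I <= size (enc_instance I).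
Proof. by rewrite /enc_instance /code /= size_cat size_code_word size_word_of; lia. Qed.

Lemma PLOM_in_PLS : PLS_structure PLOM.
Proof.
apply: (@Build_PLS_structure PLOM false plom_init plom_cost plom_nbrs).
- have [q hq] : polyb (fun n => n * n.+1) by polyb.
  exists q => _ _ _ [I [s [-> -> _]]]; apply: leq_trans (hq _).
  by apply: leq_trans (size_enc_perm s) _; have := npos_le I; nia.
- exists inst_ok; first by move=> x _; apply: inst_okP.
  by apply/polytimeP; apply: ptime_inst_ok; apply: ptime_id.
- exists (fun xs => plom_feas xs.1 xs.2); first by move=> xs; apply: plom_feasP.
  by apply/polytimeP; apply: ptime_plom_feas.
- move=> _ [I ->]; exists I, 1%g; split=> //; last exact: group1.
  by rewrite /plom_init inst_nE enc_permE perm_seq1.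
- apply/polytimeP; apply: ptime_enc_nats; apply: ptime_iota0; apply: ptime_inst_n; exact: ptime_id.
- by apply/polytimeP; apply: ptime_plom_cost.
- move=> _ y y' _ [I [s [-> -> hs]]]; rewrite plom_nbrsE => /mapP[pi hpi ->].
  exists I, (pi * s)%g; split=> //; apply: groupM => //; apply: mem_gen; by rewrite inE.
- by apply/polytimeP; apply: ptime_plom_nbrs.
- exact: plom_local_optP.
Qed.

(** * Restriction to commuting generators *)

Lemma polytime_dom A (dom dom' : A -> Prop) inp out : (forall a, dom' a -> dom a) ->
  polytime_on dom inp out -> polytime_on dom' inp out.
Proof. by move=> h [M [q H]]; exists M, q => a /h; apply: H. Qed.

(** Initial solutions, costs and neighborhoods are kept; only the recognition of instances gains a
    test. *)
Lemma PLS_restrict P (D : bits -> Prop) (d : bits -> bool) :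
  PLS_structure P -> (forall x, is_instance P x -> (D x <-> d x)) ->
  ptime (is_instance P) id (fun x => eb (d x)) -> PLS_structure (restrict D P).
Proof.
move=> [mx ini cost nbrs h1 h2 h3 h4 h5 h6 h7 h8 h9] dP Hd.
apply: (@Build_PLS_structure (restrict D P) mx ini cost nbrs) => /=.
- by have [q hq] := h1; exists q => x s [ix _]; apply: hq.
- case: h2 => b hb /polytimeP Hb; exists (fun x => b x && d x).
    move=> x _; have hbx := hb x I; split=> [[ix Dx]|/andP[bx dx]].
      by rewrite (proj1 hbx ix) (proj1 (dP x ix) Dx).
    have ix := proj2 hbx bx; split=> //; exact/(dP x ix).
  apply/polytimeP; apply: ptime_andb => //; apply: ptime_dom Hd => x [_ bx].
  exact/(hb x I).
- case: h3 => b hb Hb; exists b; first by move=> xs [ix _]; apply: hb.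
  by apply: polytime_dom Hb => xs [].
- by move=> x [ix _]; apply: h4.
- by apply: polytime_dom h5 => x [].
- by apply: polytime_dom h6 => xs [[ix _] fx].
- by move=> x s s' [ix _]; apply: h7.
- by apply: polytime_dom h8 => xs [[ix _] fx].
- by move=> x s [ix _]; apply: h9.
Qed.

Definition gens_commute (x : bits) : bool :=
  all (fun g => all (fun h => lmul g h == lmul h g) (inst_gens x)) (inst_gens x).

Lemma gens_commuteP x : is_instance PLOM x ->
  ((exists2 I, commuting I & x = enc_instance I) <-> gens_commute x).
Proof.
have key I : commuting I <-> gens_commute (enc_instance I).
  rewrite /gens_commute inst_gensE; split=> [c|/allP al g h hg hh].
    apply/allP => _ /mapP[g hg ->]; apply/allP => _ /mapP[h hh ->].
    by rewrite !lmulE (inj_eq (@perm_seq_inj _)); apply/eqP; apply: c.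
  have /allP := al _ (map_f (@perm_seq _) hg); move=> /(_ _ (map_f (@perm_seq _) hh)).
  by rewrite !lmulE (inj_eq (@perm_seq_inj _)) => /eqP.
move=> [I0 e0]; split=> [[I c ->]|h]; first exact/key.
by exists I0 => //; apply/key; rewrite -e0.
Qed.

Lemma PLOM_commuting_in_PLS : PLS_structure PLOM_commuting.
Proof.
apply: (PLS_restrict PLOM_in_PLS gens_commuteP).
have Hg := ptime_inst_gens (ptime_id (is_instance PLOM) id).
apply: (ptime_all (listk (es en)) (p := fun x g => all (fun h => lmul g h == lmul h g) (inst_gens x))
  (domb := fun x => is_instance PLOM x.1)) => //.
apply: (ptime_all (listk (es en)) (p := fun x h => lmul x.2 h == lmul h x.2)
  (domb := fun x => is_instance PLOM x.1.1)) => //; first by ptime_var.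
by apply: ptime_eqns; apply: ptime_lmul; ptime_var.
Qed.

(** * Local search as the iteration of one map *)

(** Costs are exponentially large numbers and are compared by digits: at the first difference the
    larger one has the 1. *)
Definition blt (u v : bits) : bool :=
  let i := find (fun i => nth false u i != nth false v i) (iota 0 (size u)) in
  (i < size u) && nth false v i.

Lemma blt_cons b u c v : blt (b :: u) (c :: v) = if b == c then blt u v else c.
Proof.
rewrite /blt /= (iotaDl 1 0) find_map; case: eqP => [->|_] //=.
Qed.

Lemma bltE u v : size u = size v -> blt u v = (bits_val u < bits_val v).
Proof.
elim: u v => [|b u IH] [|c v] //= [e]; rewrite blt_cons IH // !bits_val_cons e.
have := bits_val_lt u; have := bits_val_lt v; rewrite e.
by case: b; case: c; rewrite /= ?mul1n ?mul0n => h1 h2 //; lia.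
Qed.

Lemma ptime_blt A (dom : A -> Prop) inp (u v : A -> bits) : ptime dom inp u -> ptime dom inp v ->
  ptime dom inp (fun a => eb (blt (u a) (v a))).
Proof.
move=> Hu Hv.
have Hs : ptime dom inp (fun a => en (size (u a))) by apply: (ptime_size_of rawk).
have Hi : ptime dom inp (fun a => en (find (fun i => nth false (u a) i != nth false (v a) i) (iota 0 (size (u a))))).
  apply: (ptime_find (listk en) (p := fun a i => nth false (u a) i != nth false (v a) i) (domb := fun x => dom x.1)) => //.
    exact: ptime_iota0.
  apply: ptime_negb; apply: (@ptime_eq _ (fun b => eb b)); first by move=> b c [].
    by apply: (ptime_nth rawk (t0 := fun=> false)); [ptime_var | apply: ptime_const | ptime_var].
  by apply: (ptime_nth rawk (t0 := fun=> false)); [ptime_var | apply: ptime_const | ptime_var].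
apply: ptime_andb; first by apply: ptime_leq => //; apply: ptime_succ.
apply: (@ptime_dom _ dom) => [a []//|].
by apply: (ptime_nth rawk (t0 := fun=> false)) => //; apply: ptime_const.
Qed.

Lemma bits_val_pad k w : bits_val (nseq k false ++ w) = bits_val w.
Proof. by elim: k => //= k IH; rewrite bits_val_cons mul0n IH. Qed.

(** On words of a fixed length, complementation reverses the order and so turns maximization into
    minimization. *)
Lemma bits_val_negb w : bits_val (map negb w) + bits_val w = 2 ^ size w - 1.
Proof.
elim: w => // b w IH; rewrite /= !bits_val_cons size_map expnS.
have := expn_gt0 2 (size w); case: b => /=; lia.
Qed.

Lemma bits_val_ones n : bits_val (nseq n true) = 2 ^ n - 1.
Proof.
elim: n => // n IH; rewrite /= bits_val_cons size_nseq IH expnS.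
have := expn_gt0 2 n; lia.
Qed.

(** The last 1 marks the end of [s], so [unpad] recovers it without knowing [L]. *)
Definition pad (L : nat) (s : bits) : bits := s ++ true :: nseq (L - (size s).+1) false.
Definition unpad (w : bits) : bits := rev (drop (find id (rev w)).+1 (rev w)).

Lemma size_pad L s : size s < L -> size (pad L s) = L.
Proof. by rewrite size_cat /= size_nseq; lia. Qed.

Lemma padK L : cancel (pad L) unpad.
Proof.
move=> s; rewrite /unpad /pad rev_cat rev_cons rev_nseq -cats1 -catA /=; set k := L - _.
have -> : find id (nseq k false ++ true :: rev s) = k.
  rewrite find_cat has_nseq andbF /= size_nseq addn0 //.
by rewrite -cat_rcons drop_size_cat ?revK // size_rcons size_nseq.
Qed.

Lemma ptime_pad A (dom : A -> Prop) inp L s : ptime dom inp (fun a => en (L a)) -> ptime dom inp s ->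
  ptime dom inp (fun a => pad (L a) (s a)).
Proof.
move=> HL Hs; apply: (ptime_cat rawk) => //; apply: ptime_cons.
apply: (ptime_nseq rawk); last exact: ptime_const.
by apply: ptime_subn => //; apply: ptime_succ; apply: (ptime_size_of rawk).
Qed.

Lemma ptime_unpad A (dom : A -> Prop) inp w : ptime dom inp w ->
  ptime dom inp (fun a => unpad (w a)).
Proof.
move=> Hw; have Hr := ptime_rev rawk Hw; apply: (ptime_rev rawk).
apply: (ptime_drop rawk) => //; apply: ptime_succ.
apply: (ptime_find rawk (p := fun _ => id) (domb := fun x => dom x.1)) => //.
by ptime_var.
Qed.

Lemma ptime_call2 (dom' : bits * bits -> Prop) (out' : bits * bits -> bits)
    A (dom : A -> Prop) inp (u v : A -> bits) :
  ptime dom' (fun xs => code [:: xs.1; xs.2]) out' ->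
  (forall a, dom a -> dom' (u a, v a)) -> ptime dom inp u -> ptime dom inp v ->
  ptime dom inp (fun a => out' (u a, v a)).
Proof.
move=> Ho hd Hu Hv; apply: (ptime_sub (m := fun a => (u a, v a)) Ho) => //.
by apply: ptime_pair => //; apply: ptime_pair => //; apply: ptime_const.
Qed.

(* The local search of P as iteration of one polynomial-time map on
   fixed-length registers: infeasible registers get the largest cost and move
   to the initial solution. *)
Lemma PLS_successor P : in_PLS P ->
  exists (L C : {poly nat}) (H : bits -> bits -> bits),
  [/\ forall n, 0 < horner L n,
      ptime (fun xa => is_instance P xa.1 /\ size xa.2 = horner L (size xa.1))
         (ep idb idb) (fun xa => H xa.1 xa.2),
      forall x a, is_instance P x -> size a = horner L (size x) ->
        size (H x a) = horner L (size x) + horner C (size x)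
    & forall x a, is_instance P x -> size a = horner L (size x) ->
        let l := horner L (size x) in
        let b := take l (H x a) in
        bits_val (drop l (H x a)) <= bits_val (drop l (H x b)) ->
        local_opt P x (unpad a)].
Proof.
move=> [[mx ini cost nbrs [qs hqs] _ [fb fbP /polytimeP Hfb] iniP /polytimeP Hini
  /polytimeP Hcost nbrsP /polytimeP Hnbrs loP]].
have [r hr] := ptime_size Hcost.
(* The argument of [r] is the length of the code of an instance and a solution of the largest
   size. *)
have [q2 hq2] : polyb (fun n => horner r (2 * n + 2 * horner qs n + 2)) by polyb.
(* One bit more than solutions take, for the end mark of [pad]. *)
pose L : {poly nat} := (qs + polyC 1)%R.
have LE n : horner L n = (horner qs n).+1.
  by rewrite /L hornerD hornerC; exact: addn1.
(* One bit more than costs take: it is 0 on feasible registers, whereas infeasible ones get all ones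
   and are strictly worse. *)
pose C : {poly nat} := (q2 + polyC 1)%R.
have CE n : horner C n = (horner q2 n).+1.
  by rewrite /C hornerD hornerC; exact: addn1.
pose l (x : bits) := horner L (size x).
pose nc x s := let c := cost x s in let c1 := nseq (horner q2 (size x) - size c) false ++ c in
  if mx then map negb c1 else c1.
have nc_size x s : is_instance P x -> feasible P x s -> size (nc x s) = horner q2 (size x).
  move=> ix fx; have : size (cost x s) <= horner q2 (size x).
    apply: leq_trans (hr (x, s) (conj ix fx)) _; apply: leq_trans (hq2 _).
    apply: horner_mono; rewrite -[code _]/(pr x (pr s [::])) !size_pr [size [::]]/=.
    by have := hqs x s ix fx; lia.
  by rewrite /nc; case: (mx); rewrite ?size_map size_cat size_nseq; lia.
have nc_better x s s' : is_instance P x -> feasible P x s -> feasible P x s' ->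
    better mx (cost x s') (cost x s) = blt (nc x s') (nc x s).
  move=> ix fs fs'; have e := nc_size x s ix fs; have e' := nc_size x s' ix fs'.
  rewrite bltE ?e ?e' // /better; move: e e'; rewrite /nc; case: (mx) => e e'; last by rewrite !bits_val_pad.
  set u := nseq _ _ ++ cost x s in e *; set v := nseq _ _ ++ cost x s' in e' *.
  have := bits_val_negb u; have := bits_val_negb v.
  rewrite !size_map in e e'; rewrite e e' /u /v !bits_val_pad -/u -/v.
  have := bits_val_lt (map negb u); have := bits_val_lt (map negb v); rewrite !size_map e e'.
  have h1 := bits_val_lt u; have h2 := bits_val_lt v.
  rewrite e /u bits_val_pad -/u in h1; rewrite e' /v bits_val_pad -/v in h2.
  move=> *; apply/idP/idP; lia.
pose nb x s := [seq s' <- nbrs x s | blt (nc x s') (nc x s)].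
(* A feasible register without a better neighbor moves to the padded form of its own solution. *)
pose H x a := if fb (x, unpad a) then
    pad (l x) (head (unpad a) (nb x (unpad a))) ++ false :: nc x (unpad a)
  else pad (l x) (ini x) ++ nseq (horner C (size x)) true.
have fbE x s : is_instance P x -> feasible P x s <-> fb (x, s) by move=> ix; apply: (fbP (x, s)).
have head_feas x s : is_instance P x -> feasible P x s -> feasible P x (head s (nb x s)).
  move=> ix fs; case E: (nb x s) => [//|s' t] /=.
  have : s' \in nb x s by rewrite E mem_head.
  by rewrite mem_filter => /andP[_]; apply: nbrsP.
have szp x s : is_instance P x -> feasible P x s -> size (pad (l x) s) = l x.
  by move=> ix fs; rewrite size_pad // /l LE ltnS; apply: hqs.
exists L, C, H; split.
- by move=> n; rewrite LE.
- set D := fun xa : bits * bits => _.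
  have H1 : ptime D (ep idb idb) (fun xa => xa.1) by exact: ptime_fst (ptime_id _ _).
  have Hs : ptime D (ep idb idb) (fun xa => unpad xa.2) by apply: ptime_unpad; exact: ptime_snd (ptime_id _ _).
  have Hl : ptime D (ep idb idb) (fun xa => en (l xa.1)).
    by apply: ptime_horner; apply: (ptime_size_of rawk).
  apply: ptime_if.
  + by apply: (ptime_call2 Hfb) => // xa [].
  + set D' := fun xa : bits * bits => D xa /\ _.
    have DD xa : D' xa -> D xa by case.
    have Df xa : D' xa -> feasible_pair P (xa.1, unpad xa.2).
      by move=> [[ix _] h]; split=> //; apply/fbE.
    have Hnc A (dom : A -> Prop) inp (u v : A -> bits) : (forall a, dom a -> feasible_pair P (u a, v a)) ->
       ptime dom inp u -> ptime dom inp v -> ptime dom inp (fun a => nc (u a) (v a)).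
      move=> hd Hu Hv; have Hc : ptime dom inp (fun a => cost (u a) (v a)) by apply: (ptime_call2 Hcost).
      have Hp : ptime dom inp (fun a => nseq (horner q2 (size (u a)) - size (cost (u a) (v a))) false ++ cost (u a) (v a)).
        apply: (ptime_cat rawk) => //; apply: (ptime_nseq rawk); last exact: ptime_const.
        by apply: ptime_subn; [apply: ptime_horner|]; apply: (ptime_size_of rawk).
      rewrite /nc; case: (mx) => //.
      apply: (ptime_map rawk rawk (f := fun _ => negb) (domb := fun x => dom x.1)) => //.
      by apply: ptime_negb; ptime_var.
    have H1' := ptime_dom DD H1; have Hs' := ptime_dom DD Hs.
    have Hn := Hnc _ D' (ep idb idb) _ _ Df H1' Hs'.
    apply: (ptime_cat rawk); last exact: ptime_cons Hn.
    apply: ptime_pad; first exact: ptime_dom DD Hl.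
    apply: (ptime_headl (listk idb) (t0 := fun xa => unpad xa.2)) => //.
    apply: (ptime_filter (listk idb) (p := fun xa s' => blt (nc xa.1 s') (nc xa.1 (unpad xa.2)))
       (domb := fun y => D' y.1 /\ feasible P y.1.1 y.2)).
    * have := ptime_call2 Hnbrs Df H1' Hs'; apply: ptime_ext => xa _; by rewrite /es map_id.
    * apply: ptime_blt; last by ptime_var.
      apply: Hnc; [|ptime_var|ptime_var].
      by move=> [[x a] s'] [[[ix _] _] fs'].
    * move=> xa l1 t l2 Dx e; split=> //.
      have [ix fx] := Df xa Dx; apply: (nbrsP _ _ _ ix fx).
      by rewrite /= e mem_cat mem_head orbT.
  + apply: (@ptime_dom _ D) => [xa []//|]; apply: (ptime_cat rawk).
      apply: ptime_pad => //; apply: (ptime_sub (m := fun xa => xa.1) Hini) => //.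
      by move=> xa [].
    apply: (ptime_nseq rawk); last exact: ptime_const.
    by apply: ptime_horner; apply: (ptime_size_of rawk).
- move=> x a ix sa; rewrite /H; case: ifP => hf.
    have fx : feasible P x (unpad a) by apply/fbE.
    by rewrite size_cat szp //= ?nc_size // ?CE //; apply: head_feas.
  by rewrite size_cat szp ?size_nseq //; apply: iniP.
move=> x a ix sa ll b; have take_pad s (w : bits) : feasible P x s -> take ll (pad (l x) s ++ w) = pad (l x) s.
  by move=> fs; rewrite take_size_cat // szp.
have drop_pad s (w : bits) : feasible P x s -> drop ll (pad (l x) s ++ w) = w.
  by move=> fs; rewrite drop_size_cat // szp.
have dropH s : feasible P x s -> drop ll (H x (pad (l x) s)) = false :: nc x s.
  move=> fs; rewrite /H padK ifT; last exact/fbE.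
  by rewrite drop_pad //; apply: head_feas.
have bf s : bits_val (false :: nc x s) = bits_val (nc x s) by rewrite bits_val_cons.
(* An infeasible register contradicts the assumption: its cost is all ones, and that of the initial
   solution starts with 0. *)
have [hf|hf] := boolP (fb (x, unpad a)); last first.
  have ib : b = pad (l x) (ini x) by rewrite /b /H (negPf hf) take_pad //; apply: iniP.
  rewrite ib dropH; last exact: iniP.
  rewrite /H (negPf hf) drop_pad; last exact: iniP.
  rewrite bf bits_val_ones CE => h.
  have := bits_val_lt (nc x (ini x)); rewrite nc_size //; last exact: iniP.
  have := expn_gt0 2 (horner q2 (size x)); rewrite expnS in h; lia.
have fx : feasible P x (unpad a) by apply/fbE.
set s := unpad a in hf fx *.
have ib : b = pad (l x) (head s (nb x s)) by rewrite /b /H hf take_pad //; apply: head_feas.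
rewrite ib dropH; last exact: head_feas.
rewrite /H -/s hf drop_pad; last exact: head_feas.
rewrite !bf => h; apply/loP => //; split=> // s' hs'.
have fs' := nbrsP _ _ _ ix fx hs'.
(* A better neighbor would make the list [nb x s] nonempty, and its head, to which [H] moves, would
   be strictly cheaper. *)
rewrite nc_better //; apply/negP => hb.
have : s' \in nb x s by rewrite mem_filter hb.
case E: (nb x s) h => [//|s1 t] /= h _.
have : s1 \in nb x s by rewrite E mem_head.
rewrite mem_filter => /andP[hb1 hs1]; have fs1 := nbrsP _ _ _ ix fx hs1.
by move: hb1; rewrite bltE ?nc_size // ltnNge h.
Qed.

(** * From prioritized constraints to commuting permutations *)

Fixpoint allbits (r : nat) : seq bits :=
  if r is r'.+1 then map (cons false) (allbits r') ++ map (cons true) (allbits r')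
  else [:: [::]].

Lemma mem_allbits r (w : bits) : (w \in allbits r) = (size w == r).
Proof.
elim: r w => [|r IH] [|b w] //=; rewrite mem_cat.
  by apply/negP => /orP[] /mapP[].
rewrite eqSS -IH; case: b.
  have -> : (true :: w \in map (cons false) (allbits r)) = false by apply/negP => /mapP[].
  by rewrite mem_map //; move=> u v [].
have -> : (false :: w \in map (cons true) (allbits r)) = false by apply/negP => /mapP[].
by rewrite orbF mem_map //; move=> u v [].
Qed.

Lemma uniq_allbits r : uniq (allbits r).
Proof.
elim: r => //= r IH; rewrite cat_uniq !map_inj_uniq ?IH /= ?andbT; try by move=> u v [].
by apply/hasPn => _ /mapP[w _ ->]; apply/negP => /mapP[].
Qed.

Lemma head_allbits r : nth [::] (allbits r) 0 = nseq r false.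
Proof.
elim: r => //= r <-; case: (allbits r) (mem_allbits r (nseq r false)) => //=.
by rewrite size_nseq eqxx.
Qed.

Lemma index_allbits0 r : index (nseq r false) (allbits r) = 0.
Proof.
rewrite -head_allbits index_uniq ?uniq_allbits //.
have : nseq r false \in allbits r by rewrite mem_allbits size_nseq.
by case: (allbits r).
Qed.

Lemma size_allbits_gt0 r : 0 < size (allbits r).
Proof.
have : nseq r false \in allbits r by rewrite mem_allbits size_nseq.
by case: (allbits r).
Qed.

Definition tb (r : nat) (F : bits -> bool) : bits := [seq F w | w <- allbits r].

Lemma nth_tb r F w : size w = r -> nth false (tb r F) (index w (allbits r)) = F w.
Proof.
move=> sw; have hw : w \in allbits r by rewrite mem_allbits sw.
by rewrite (nth_map [::]) ?index_mem // nth_index.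
Qed.

Definition bxor (u v : bits) : bits := [seq (nth false u i) (+) (nth false v i) | i <- iota 0 (size u)].

Lemma size_bxor u v : size (bxor u v) = size u.
Proof. by rewrite size_map size_iota. Qed.

Lemma nth_bxor u v i : i < size u -> nth false (bxor u v) i = nth false u i (+) nth false v i.
Proof. by move=> h; rewrite (nth_map 0) ?size_iota // nth_iota. Qed.

Lemma bxorA u v w : size v = size u -> bxor (bxor u v) w = bxor u (bxor v w).
Proof.
move=> e; apply: (@eq_from_nth _ false) => [|i]; rewrite !size_bxor // => hi.
by rewrite !nth_bxor ?size_bxor ?e // addbA.
Qed.

Lemma bxor0 u r : bxor u (nseq r false) = u.
Proof.
apply: (@eq_from_nth _ false); rewrite size_bxor // => i hi.
by rewrite nth_bxor // nth_nseq if_same addbF.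
Qed.

Lemma bxor0s v : bxor (nseq (size v) false) v = v.
Proof.
apply: (@eq_from_nth _ false); rewrite size_bxor size_nseq // => i hi.
by rewrite nth_bxor ?size_nseq // nth_nseq if_same.
Qed.

Lemma flatten_iota T (F : nat -> nat -> T) m k :
  flatten [seq [seq F p c | c <- iota 0 m] | p <- iota 0 k] =
  [seq F (i %/ m) (i %% m) | i <- iota 0 (k * m)].
Proof.
elim: k => // k IH; rewrite -addn1 iotaD map_cat flatten_cat IH mulnDl mul1n iotaD map_cat.
congr cat; rewrite /= cats0 add0n -[k * m in RHS]addn0 (iotaDl (k * m) 0 m) -map_comp.
apply/eq_in_map => c; rewrite mem_iota add0n => /andP[_ hc] /=.
have m0 : 0 < m by lia.
by rewrite divnMDl // modnMDl divn_small // modn_small // addn0.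
Qed.

Definition cstr := (seq nat * bits)%type.
Definition cstr0 : cstr := ([::], [::]).

Definition ceval (r : nat) (c : cstr) (y : nat -> bool) : bool :=
  nth false c.2 (index (map y c.1) (allbits r)).

Definition flip (u : nat) (y : nat -> bool) : nat -> bool := fun v => (v == u) (+) y v.

(** Entry [p] of the i-th table is placed at [p * size cs + i]. The entries for the all-zero
    argument, one from each constraint in order of priority, thus form the beginning of the string.
    This layout rests on all tables having the same size. *)
Definition strl (r : nat) (cs : seq cstr) : bits :=
  flatten [seq [seq nth false (nth cstr0 cs i).2 p | i <- iota 0 (size cs)]
          | p <- iota 0 (size (allbits r))].

(** A variable may fill several slots of a constraint; flipping it toggles all of them. *)
Definition genl (r : nat) (cs : seq cstr) (u : nat) : seq nat :=
  flatten [seq [seq index (bxor (nth [::] (allbits r) p)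
                         [seq v == u | v <- (nth cstr0 cs i).1]) (allbits r)
                    * size cs + i
               | i <- iota 0 (size cs)]
          | p <- iota 0 (size (allbits r))].

Definition plom_of (r K : nat) (cs : seq cstr) : bits :=
  code (strl r cs :: [seq enc_nats (genl r cs u) | u <- iota 0 K]).

Section Instance.

Variables (r K : nat) (cs : seq cstr).
Hypothesis r0 : 0 < r.
Hypothesis csr : all (fun c => size c.1 == r) cs.

Local Notation m := (size cs).
Local Notation AB := (allbits r).
Local Notation N := (size AB * m).
Local Notation con i := (nth cstr0 cs i).

Lemma size_slots i : i < m -> size (con i).1 = r.
Proof. by move=> hi; apply/eqP; apply: (allP csr); apply: mem_nth. Qed.

(** Products of generators are described by the sum of their variables modulo 2, so the action is
    set up for whole assignments; [genl] is the case of a single variable. *)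
Definition pos_act (y : nat -> bool) (i : nat) : nat :=
  index (bxor (nth [::] AB (i %/ m)) (map y (con (i %% m)).1)) AB * m + i %% m.

Lemma pos_split i : i < N -> [/\ 0 < m, i %/ m < size AB, i %% m < m & size (nth [::] AB (i %/ m)) = r].
Proof.
move=> hi; have m0 : 0 < m by case: (m) hi => //; rewrite muln0.
have h : i %/ m < size AB by rewrite ltn_divLR.
split=> //; first exact: ltn_pmod.
by apply/eqP; rewrite -mem_allbits mem_nth.
Qed.

Lemma idx_lt y i : i < N -> index (bxor (nth [::] AB (i %/ m)) (map y (con (i %% m)).1)) AB < size AB.
Proof.
by move=> /pos_split[_ _ _ e]; rewrite index_mem mem_allbits size_bxor e.
Qed.

Lemma pos_act_lt y i : i < N -> pos_act y i < N.
Proof.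
move=> hi; have [m0 _ h2 _] := pos_split hi; have h := idx_lt y hi.
rewrite /pos_act; move: (index _ _) h => k hk.
apply: (@leq_trans (k.+1 * m)); last by rewrite leq_mul2r hk orbT.
by rewrite mulSn addnC ltn_add2r.
Qed.

Lemma pos_act_mod y i : i < N -> pos_act y i %% m = i %% m.
Proof. by move=> /pos_split[m0 _ h _]; rewrite /pos_act modnMDl modn_mod. Qed.

Lemma pos_act_div y i : i < N ->
  nth [::] AB (pos_act y i %/ m) = bxor (nth [::] AB (i %/ m)) (map y (con (i %% m)).1).
Proof.
move=> hi; have [m0 _ h _] := pos_split hi; have := idx_lt y hi.
rewrite /pos_act divnMDl // (divn_small (ltn_pmod _ m0)) addn0 index_mem => hm.
by rewrite nth_index.
Qed.

Lemma pos_actD y y' i : i < N -> pos_act y' (pos_act y i) = pos_act (fun v => y v (+) y' v) i.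
Proof.
move=> hi; have [m0 _ h e] := pos_split hi.
rewrite /pos_act -/(pos_act y i) pos_act_mod // pos_act_div // bxorA; last by rewrite size_map e size_slots.
congr (index (bxor _ _) _ * _ + _); apply: (@eq_from_nth _ false) => [|j].
  by rewrite size_bxor !size_map.
rewrite size_bxor size_map => hj.
by rewrite nth_bxor ?size_map // !(nth_map 0).
Qed.

Lemma pos_act0 i : i < N -> pos_act (fun=> false) i = i.
Proof.
move=> hi; have [m0 h1 h e] := pos_split hi; rewrite /pos_act.
have -> : [seq false | _ <- (con (i %% m)).1] = nseq r false.
  by rewrite -(size_slots h); elim: (con _).1 => //= a l ->.
by rewrite bxor0 index_uniq ?uniq_allbits // -divn_eq.
Qed.

Definition pact_fun (y : nat -> bool) (i : 'I_N) : 'I_N := Ordinal (pos_act_lt y (ltn_ord i)).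

(** The action of an assignment is its own inverse. *)
Lemma pact_inj y : injective (pact_fun y).
Proof.
apply: (can_inj (g := pact_fun y)) => i; apply: val_inj; rewrite /= pos_actD //.
rewrite -[RHS](pos_act0 (ltn_ord i)); congr pos_act.
by apply: functional_extensionality => v; rewrite addbb.
Qed.

Definition pact y : 'S_N := perm (@pact_inj y).

Lemma pactE y (i : 'I_N) : pact y i = pos_act y i :> nat.
Proof. by rewrite permE. Qed.

Lemma pactM y y' : (pact y * pact y')%g = pact (fun v => y v (+) y' v).
Proof. by apply/permP=> i; apply: val_inj; rewrite permM /= !pactE pos_actD. Qed.

Definition plom_inst : plom_instance :=
  @PlomInstance N [seq pact (pred1 u) | u <- iota 0 K]
    (fun i => nth false (con (i %% m)).2 (i %/ m)).

Lemma plom_instE : enc_instance plom_inst = plom_of r K cs.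
Proof.
rewrite /enc_instance /plom_of; congr (code (_ :: _)).
  rewrite /strl (flatten_iota (fun p i => nth false (con i).2 p)) /word_of.
  by rewrite -[iota 0 _]val_enum_ord -map_comp.
rewrite /= -map_comp; apply: eq_map => u /=; rewrite enc_permE; congr enc_nats.
rewrite /genl (flatten_iota (fun p i => index (bxor (nth [::] AB p) [seq v == u | v <- (con i).1]) AB * m + i)).
rewrite -[iota 0 _]val_enum_ord -map_comp; apply: eq_map => i /=; by rewrite pactE.
Qed.

Lemma plom_commuting : commuting plom_inst.
Proof.
move=> _ _ /mapP[u _ ->] /mapP[v _ ->]; rewrite /commute !pactM; congr pact.
by apply: functional_extensionality => w; rewrite addbC.
Qed.

Lemma plom_group (s : 'S_N) : s \in <<[set g in gens plom_inst]>>%g -> exists y, s = pact y.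
Proof.
move=> /gen_prodgP[n [c hc ->]]; apply: (big_ind (fun s => exists y, s = pact y)).
- exists (fun=> false); apply/permP=> i; apply: val_inj; rewrite perm1 /= pactE pos_act0 //.
- by move=> _ _ [y ->] [y' ->]; rewrite pactM; exists (fun v => y v (+) y' v).
- by move=> i _; have := hc i; rewrite inE => /mapP[u _ ->]; exists (pred1 u).
Qed.

Lemma m_le_N : m <= N.
Proof. by apply: leq_pmull; apply: size_allbits_gt0. Qed.

(** The leading positions belong to the all-zero argument, which exclusive or turns into the values
    of the slots themselves. *)
Lemma pos_act_primary y i : i < m ->
  pos_act y i = index (map y (con i).1) AB * m + i.
Proof.
move=> hi; rewrite /pos_act modn_small // divn_small // head_allbits.
by rewrite -{1}(size_slots hi) -(size_map y) bxor0s.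
Qed.

Lemma plom_value y i : i < m ->
  nth false (word_of (str plom_inst \o pact y)) i = ceval r (con i) y.
Proof.
move=> hi; have hN := leq_trans hi m_le_N.
rewrite /word_of (nth_map (Ordinal hN)) ?size_enum_ord //.
have -> : nth (Ordinal hN) (enum 'I_N) i = Ordinal hN.
  by apply: val_inj; rewrite /= nth_enum_ord.
rewrite /= pactE /= pos_act_primary //.
have m0 : 0 < m by lia.
by rewrite modnMDl modn_small // divnMDl // divn_small // addn0.
Qed.

Lemma lexi_first (u v : bits) c : ((u : seqlexi bool) <= v)%O -> size u = size v ->
  (forall i, i < c -> nth false u i = nth false v i) -> nth false u c -> nth false v c.
Proof.
elim: u v c => [|a u IH] [|b v] c //= + [e].
rewrite Order.SeqLexiOrder.Exports.lexi_cons => /andP[h1 h2]; case: c => [|c] h /=.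
  by move: h1; case: a {h h2} => //; case: b.
have ab := h 0 isT; rewrite /= in ab; subst b; rewrite Order.POrderTheory.lexx /= in h2.
by apply: IH => // i hi; apply: (h i.+1).
Qed.

(** On the leading positions the lexicographic order is the order of priority: a flip that repaired
    constraint [c] without changing those before it would make the string smaller. *)
Lemma plom_local y u c : plom_local_min (I := plom_inst) (pact y) -> u < K -> c < m ->
  (forall i, i < c -> ceval r (con i) (flip u y) = ceval r (con i) y) ->
  ceval r (con c) y -> ceval r (con c) (flip u y).
Proof.
move=> lm uK cm h; have hg : pact (pred1 u) \in gens plom_inst.
  by apply/mapP; exists u; rewrite ?mem_iota.
have := lm _ hg; rewrite /lex_le.
have -> : word_of ((str plom_inst \o pact y) \o pact (pred1 u)) =
   word_of (str plom_inst \o pact (flip u y)).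
  have -> : pact (flip u y) = (pact (pred1 u) * pact y)%g by rewrite pactM.
  by apply: eq_map => i /=; rewrite permM.
move=> hl; rewrite -!plom_value //; apply: (lexi_first hl); rewrite ?size_word_of //.
by move=> i hi; rewrite !plom_value ?h //; apply: ltn_trans cm.
Qed.

(** All slots of the block hold [u], so its leading position goes to the entry of the constant word
    [y u]. With at least one slot the two constant words differ, and the permutation reveals the
    variable. *)
Lemma pact_dummy y (u : nat) t : u < m -> con u = (nseq r u, t) ->
  (nth 0 (perm_seq (pact y)) u != u) = y u.
Proof.
move=> um eu; have hN := leq_trans um m_le_N.
rewrite -[u in nth _ _ u]/(val (Ordinal hN)) nth_perm_seq pactE /= pos_act_primary // eu /=.
have -> : map y (nseq r u) = nseq r (y u) by rewrite map_nseq.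
case: (y u); last by rewrite index_allbits0 eqxx.
have m0 : 0 < m by lia.
suff : 0 < index (nseq r true) AB by move=> h; apply/eqP; nia.
rewrite lt0n; apply/eqP => h.
have : nth [::] AB (index (nseq r true) AB) = nseq r true.
  by rewrite nth_index // mem_allbits size_nseq.
by rewrite h head_allbits; case: (r) r0.
Qed.

End Instance.

(** * Polynomial-time construction of the instance *)

Definition eC : cstr -> bits := ep (es en) idb.

Section Poly.

Variables (A : Type) (dom : A -> Prop) (inp : A -> bits).
Variables (r : nat) (K : A -> nat) (cs : A -> seq cstr).
Hypothesis HK : ptime dom inp (fun a => en (K a)).
Hypothesis Hcs : ptime dom inp (fun a => es eC (cs a)).

Let HAB B (d : B -> Prop) i : ptime d i (fun=> es idb (allbits r)).
Proof. exact: ptime_const. Qed.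

Lemma ptime_bxor B (d : B -> Prop) i u v : ptime d i u -> ptime d i v -> ptime d i (fun a => bxor (u a) (v a)).
Proof.
move=> Hu Hv.
apply: (ptime_map (listk en) rawk (f := fun a j => nth false (u a) j (+) nth false (v a) j) (domb := fun x => d x.1)) => //.
  by apply: ptime_iota0; apply: (ptime_size_of rawk).
set D := fun x => _.
have H1 : ptime D (ep i en) (fun x => eb (nth false (u x.1) x.2)).
  by apply: (ptime_nth rawk (t0 := fun=> false)); [ptime_var | apply: ptime_const | ptime_var].
have H2 : ptime D (ep i en) (fun x => eb (nth false (v x.1) x.2)).
  by apply: (ptime_nth rawk (t0 := fun=> false)); [ptime_var | apply: ptime_const | ptime_var].
apply: (@ptime_ext _ _ _ (fun x => if nth false (u x.1) x.2 then eb (~~ nth false (v x.1) x.2) else eb (nth false (v x.1) x.2))).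
  by move=> x _; case: (nth false (u x.1) x.2).
by apply: ptime_ifs => //; apply: ptime_negb.
Qed.

Let Hm : ptime dom inp (fun a => en (size (cs a))).
Proof. exact: (ptime_size_of (listk eC)). Qed.

Lemma ptime_plom_of : ptime dom inp (fun a => plom_of r (K a) (cs a)).
Proof.
have HN B (d : B -> Prop) i : ptime d i (fun=> es en (iota 0 (size (allbits r)))) by exact: ptime_const.
have Hi : ptime dom inp (fun a => es en (iota 0 (size (cs a)))) by exact: ptime_iota0.
have Hcon B (d : B -> Prop) i (l : B -> seq cstr) j : ptime d i (fun b => es eC (l b)) ->
    ptime d i (fun b => en (j b)) -> ptime d i (fun b => eC (nth cstr0 (l b) (j b))).
  by move=> Hl Hj; apply: (ptime_nth (listk eC) (t0 := fun=> cstr0)) => //; apply: ptime_const.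
apply: (@ptime_ext _ _ _ (fun a => es idb (strl r (cs a) :: [seq enc_nats (genl r (cs a) u) | u <- iota 0 (K a)]))).
  by move=> a _; rewrite /es map_id.
apply: (lk_cons (listk idb)).
  apply: ptime_flattenb.
  apply: (ptime_map (listk en) (listk idb) (f := fun a p =>
    [seq nth false (nth cstr0 (cs a) i).2 p | i <- iota 0 (size (cs a))]) (domb := fun x => dom x.1)) => //.
  apply: (ptime_map (listk en) rawk (f := fun (x : A * nat) i => nth false (nth cstr0 (cs x.1) i).2 x.2)
    (domb := fun x => dom x.1.1)) => //; first by ptime_var.
  apply: (ptime_nth rawk (t0 := fun=> false)); [|exact: ptime_const|ptime_var].
  apply: (@ptime_snd _ _ _ (fun x => es en (nth cstr0 (cs x.1.1) x.2).1)).
  by apply: Hcon; ptime_var.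
apply: (ptime_map (listk en) (listk idb) (f := fun a u => enc_nats (genl r (cs a) u)) (domb := fun x => dom x.1)) => //.
  exact: ptime_iota0.
apply: ptime_enc_nats; apply: ptime_flattenl.
apply: (ptime_map (listk en) (listk (es en)) (f := fun (x : A * nat) p =>
    [seq index (bxor (nth [::] (allbits r) p)
                         [seq v == x.2 | v <- (nth cstr0 (cs x.1) i).1]) (allbits r)
                    * size (cs x.1) + i | i <- iota 0 (size (cs x.1))]) (domb := fun x => dom x.1.1)) => //.
apply: (ptime_map (listk en) (listk en) (f := fun (x : A * nat * nat) i =>
    index (bxor (nth [::] (allbits r) x.2)
                         [seq v == x.1.2 | v <- (nth cstr0 (cs x.1.1) i).1]) (allbits r)
                    * size (cs x.1.1) + i) (domb := fun x => dom x.1.1.1)) => //; first by ptime_var.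
apply: ptime_addn; last by ptime_var.
apply: ptime_muln; last by ptime_var.
apply: (ptime_index (listk idb) id_inj) => //.
apply: ptime_bxor.
  by apply: (ptime_nth (listk idb) (t0 := fun=> [::])); [exact: HAB | exact: ptime_const | ptime_var].
apply: (ptime_map (listk en) rawk (f := fun (x : A * nat * nat * nat) v => v == x.1.1.2) (domb := fun x => dom x.1.1.1.1)) => //.
  apply: (@ptime_fst _ _ _ _ (fun x => (nth cstr0 (cs x.1.1.1) x.2).2)).
  by apply: Hcon; ptime_var.
by apply: ptime_eqn; ptime_var.
Qed.

End Poly.

(** * Computation tableaux as circuits *)

(* Output variable, argument variables, truth table. *)
Definition gate := (nat * (seq nat * bits))%type.

Definition gval (r : nat) (g : gate) (val : nat -> bool) : bool :=
  nth false g.2.2 (index (map val g.2.1) (allbits r)).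

Section Tableau.

Variable M : machine.

Local Notation k := (ntapes M).+1.
Local Notation sym := (symbol (aux M)).

(* The j-th cell holds the state and, for every tape, the symbols at distance j
   to the left and to the right of the head. *)
Definition cells : finType := (state M * {ffun 'I_k -> sym * sym})%type.

Definition lcell (t : tape (aux M)) (j : nat) : sym := nth None (scanned t :: left_cells t) j.
Definition rcell (t : tape (aux M)) (j : nat) : sym := nth None (scanned t :: right_cells t) j.

Definition cell (c : config M) (j : nat) : cells :=
  (c.1, [ffun i => (lcell (c.2 i) j, rcell (c.2 i) j)]).

(** A move shifts the two halves of a tape in opposite directions. The written symbol ends up at
    distance 0 or 1, whence the distinction of the distances 0, 1 and at least 2 by [kd]. The head
    cell [c0] is an argument everywhere, since it decides the transition. *)
Definition phi (kd : nat) (c0 cm c cp : cells) : cells :=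
  if halting c0.1 then c else
  let: (q', acts) := delta c0.1 [ffun i => (c0.2 i).1] in
  (q', [ffun i => let: (a, mv) := acts i in
    match mv with
    | Stay => if kd == 0 then (a, a) else c.2 i
    | MoveRight =>
        (if kd == 0 then (cp.2 i).2 else if kd == 1 then a else (cm.2 i).1, (cp.2 i).2)
    | MoveLeft =>
        ((cp.2 i).1, if kd == 0 then (cp.2 i).1 else if kd == 1 then a else (cm.2 i).2)
    end]).

Lemma cell_step (c : config M) j :
  cell (step c) j = phi (minn j 2) (cell c 0) (cell c j.-1) (cell c j) (cell c j.+1).
Proof.
case: c => q ts; rewrite /phi /step /=; case: ifP => // hq.
have -> : [ffun i => ([ffun i0 => (lcell (ts i0) 0, rcell (ts i0) 0)] i).1] =
  [ffun i => scanned (ts i)] by apply/ffunP => i; rewrite !ffunE.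
case: (delta _ _) => q' acts; rewrite /cell /=; congr (_, _).
apply/ffunP => i; rewrite !ffunE; case: (acts i) => a mv; case: (ts i) => l s r.
by case: mv; case: j => [|[|j]] //=; rewrite /lcell /rcell /= ?nth0 ?nth_behead // -nth0 nth_behead.
Qed.

Definition cw : nat := size (enum cells).
Definition cell0 : cells := (start M, [ffun=> (None, None)]).
(** The one-hot code. *)
Definition cenc (c : cells) : bits := [seq c == g | g <- enum cells].
Definition cdec (w : bits) : cells := nth cell0 (enum cells) (index true w).

Lemma size_cenc c : size (cenc c) = cw.
Proof. by rewrite size_map. Qed.

Lemma cencK : cancel cenc cdec.
Proof.
move=> c; rewrite /cdec /cenc.
have -> : index true [seq c == g | g <- enum cells] = index c (enum cells).
  rewrite /index find_map; apply: eq_find => g /=; by rewrite eqb_id eq_sym.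
by rewrite nth_index // mem_enum.
Qed.

Lemma cw_gt0 : 0 < cw.
Proof. by rewrite /cw; have := mem_enum cells cell0; case: (enum cells). Qed.

(** [z] tells whether the cell is at the head, where both halves show the scanned symbol; elsewhere
    the input lies to the right only. *)
Definition icell (z : bool) (o : option bool) : cells :=
  (start M, [ffun i => if i == ord0 then
     let a := if o is Some b then Some (inl b) else None in
     (if z then a else None, a) else (None, None)]).

Lemma cell_init w j : cell (init_config M w) j =
  icell (j == 0) (if j < size w then Some (nth false w j) else None).
Proof.
rewrite /cell /icell; congr (_, _); apply/ffunP => i; rewrite !ffunE.
case: eqP => _; last by case: j => [|j]; rewrite /lcell /rcell //= nth_nil.
rewrite /lcell /rcell /input_tape /=; case: w => [|b w] /=; first by case: j => [|j] //=; rewrite nth_nil.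
case: j => [|j] //=; rewrite ltnS nth_nil; congr (_, _).
case: ltnP => h; first by rewrite (nth_map false).
by rewrite nth_default // size_map.
Qed.

Lemma cell_blank (c : config M) n j :
  (forall i, size (left_cells (c.2 i)) <= n /\ size (right_cells (c.2 i)) <= n) ->
  n < j -> cell c j = (c.1, [ffun=> (None, None)]).
Proof.
move=> h nj; congr (_, _); apply/ffunP => i; rewrite !ffunE /lcell /rcell.
have [h1 h2] := h i; case: j nj => // j nj /=.
by rewrite (nth_default _ (leq_trans h1 nj)) (nth_default _ (leq_trans h2 nj)).
Qed.

Lemma size_step (c : config M) n :
  (forall i, size (left_cells (c.2 i)) <= n /\ size (right_cells (c.2 i)) <= n) ->
  forall i, size (left_cells ((step c).2 i)) <= n.+1 /\ size (right_cells ((step c).2 i)) <= n.+1.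
Proof.
case: c => q ts /= h i; case: ifP => _; first by have [] := h i; rewrite /=; lia.
case: (delta _ _) => q' acts /=; rewrite ffunE; have [] := h i.
by case: (ts i) => l s r; case: (acts i).2 => /=; rewrite ?size_behead; lia.
Qed.

Lemma size_iter w t i :
  let c := iter t (@step M) (init_config M w) in
  size (left_cells (c.2 i)) <= size w + t /\ size (right_cells (c.2 i)) <= size w + t.
Proof.
elim: t i => [|t IH] i; last by rewrite iterS addnS; apply: size_step.
by rewrite /= ffunE /= size_behead size_map; case: eqP => _ /=; lia.
Qed.

Lemma leading_bitsP (l : seq sym) o : o < size (leading_bits l) ->
  nth None l o = Some (inl (nth false (leading_bits l) o)).
Proof. by elim: l o => // -[[b|?]|] l IH [|o] //=; rewrite ltnS; apply: IH. Qed.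

Local Notation r := (4 * cw).

(** Since [cw] is a constant of the machine, a lookup in this finite list is computable from [b] in
    polynomial time, whatever [F] is. *)
Definition tabulate (F : nat -> bits) (b : nat) : bits := nth [::] [seq F b | b <- iota 0 cw] b.

Lemma tabulateE F b : b < cw -> tabulate F b = F b.
Proof. by move=> h; rewrite /tabulate (nth_map 0) ?size_iota // nth_iota. Qed.

Definition part (i : nat) (w : bits) : cells := cdec (take cw (drop (i * cw) w)).

Definition const_tab (z : bool) (o : option bool) (b : nat) : bits :=
  tb r (fun=> nth false (cenc (icell z o)) b).
Definition input_tab (z : bool) (b : nat) : bits :=
  tb r (fun w => nth false (cenc (icell z (Some (head false w)))) b).
Definition step_tab (kd b : nat) : bits :=
  tb r (fun w => nth false (cenc (phi kd (part 0 w) (part 1 w) (part 2 w) (part 3 w))) b).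
Definition out_tab : bits :=
  tb r (fun w => ((part 0 w).2 ord_max).2 == Some (inl true)).

Section Circuit.

Variables (L T W O : nat) (xw : bits).

Definition base (t j : nat) : nat := L + (t * W + j) * cw.

(** The cells of the first row are fixed by [xw], then read from the [L] free inputs, then blank.
    All gates have exactly [r] arguments; constants repeat variable 0. Only finitely many tables
    occur, selected by tests, so that all of them are constants. *)
Definition gate0 (j b : nat) : gate :=
  (base 0 j + b,
   if j < size xw then
     (nseq r 0, if nth false xw j then
        if j == 0 then tabulate (const_tab true (Some true)) b
        else tabulate (const_tab false (Some true)) b
      else if j == 0 then tabulate (const_tab true (Some false)) b
        else tabulate (const_tab false (Some false)) b)
   else if j < size xw + L then
     (nseq r (j - size xw), if j == 0 then tabulate (input_tab true) b
        else tabulate (input_tab false) b)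
   else (nseq r 0, if j == 0 then tabulate (const_tab true None) b
        else tabulate (const_tab false None) b)).

(** The last column has no right neighbor and takes itself instead; the tableau is wide enough for
    both to be blank there. *)
Definition gateS (t j b : nat) : gate :=
  (base t.+1 j + b,
   (iota (base t 0) cw ++ iota (base t j.-1) cw ++ iota (base t j) cw
      ++ iota (base t (if j.+1 < W then j.+1 else j)) cw,
    if j == 0 then tabulate (step_tab 0) b
    else if j == 1 then tabulate (step_tab 1) b else tabulate (step_tab 2) b)).

(** The output lies to the right of the head of the last tape, so its bit [o] is the right half of
    the cell at distance [o]. The other three cells of the argument are padding. *)
Definition gateO (o : nat) : gate :=
  (base T.+1 0 + o, (iota (base T o) cw ++ nseq (3 * cw) 0, out_tab)).

Definition circ : seq gate :=
  flatten [seq [seq gate0 j b | b <- iota 0 cw] | j <- iota 0 W] ++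
  flatten [seq flatten [seq [seq gateS t j b | b <- iota 0 cw] | j <- iota 0 W]
          | t <- iota 0 T] ++
  [seq gateO o | o <- iota 0 O].

Variant circ_spec (g : gate) : Prop :=
| Circ0 j b of j < W & b < cw & g = gate0 j b
| CircS t j b of t < T & j < W & b < cw & g = gateS t j b
| CircO o of o < O & g = gateO o.

Lemma circP g : g \in circ -> circ_spec g.
Proof.
rewrite !mem_cat => /or3P[/flatten_mapP[j]|/flatten_mapP[t]|/mapP[o]]; rewrite mem_iota /=.
- by move=> hj /mapP[b]; rewrite mem_iota => /= hb ->; apply: Circ0 hj hb _.
- move=> ht /flatten_mapP[j]; rewrite mem_iota /= => hj /mapP[b]; rewrite mem_iota /= => hb ->.
  exact: CircS ht hj hb _.
- by move=> ho ->; apply: CircO ho _.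
Qed.

Lemma mem_circ0 j b : j < W -> b < cw -> gate0 j b \in circ.
Proof.
move=> hj hb; rewrite mem_cat; apply/orP; left; apply/flatten_mapP; exists j; rewrite ?mem_iota //.
by apply: (map_f (gate0 j)); rewrite mem_iota.
Qed.

Lemma mem_circS t j b : t < T -> j < W -> b < cw -> gateS t j b \in circ.
Proof.
move=> ht hj hb; rewrite !mem_cat; apply/or3P; apply: Or32.
apply/flatten_mapP; exists t; rewrite ?mem_iota //.
apply/flatten_mapP; exists j; rewrite ?mem_iota //.
by apply: (map_f (gateS t j)); rewrite mem_iota.
Qed.

Lemma mem_circO o : o < O -> gateO o \in circ.
Proof.
move=> ho; rewrite !mem_cat; apply/or3P; apply: Or33.
by apply: (map_f gateO); rewrite mem_iota.
Qed.

Lemma flatten_iota_base a m n :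
  flatten [seq [seq a + j * m + b | b <- iota 0 m] | j <- iota 0 n] = iota a (n * m).
Proof.
elim: n => // n IH; rewrite -addn1 iotaD map_cat flatten_cat IH mulnDl mul1n iotaD.
by congr cat; rewrite /= cats0 add0n -[in RHS](addn0 (a + _)) (iotaDl (a + n * m) 0 m).
Qed.

(** Consecutive numbering yields both the range of the variables and the order in which gates depend
    on each other. *)
Lemma circ_outs : map fst circ = iota L ((T.+1 * W) * cw + O).
Proof.
rewrite !map_cat iotaD mulSn mulnDl iotaD -catA; congr (_ ++ (_ ++ _)).
- rewrite map_flatten -(flatten_iota_base L cw W) -map_comp; congr flatten.
  by apply: eq_map => j; rewrite /= -map_comp.
- rewrite map_flatten -mulnA -flatten_iota_base -map_comp; congr flatten.
  apply: eq_map => t /=; rewrite map_flatten -map_comp.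
  have -> : [seq L + W * cw + t * (W * cw) + b | b <- iota 0 (W * cw)] =
     iota (L + W * cw + t * (W * cw)) (W * cw).
    by rewrite -[in RHS](addn0 (L + _ + _)) iotaDl.
  rewrite -flatten_iota_base; congr flatten; apply: eq_map => j /=.
  rewrite -map_comp; apply: eq_map => b /=; rewrite /base; congr (_ + b).
  by rewrite mulSn !mulnDl mulnA; lia.
- have -> : L + (W * cw + T * W * cw) = base T.+1 0 + 0.
    by rewrite /base mulSn addn0 !mulnDl; lia.
  by rewrite iotaDl -map_comp.
Qed.

Lemma base_mono t j t' : t < t' -> j < W -> base t j + cw <= base t' 0.
Proof.
move=> ht hj; rewrite /base addn0 -addnA leq_add2l.
apply: (@leq_trans (t.+1 * W * cw)); last by rewrite leq_mul2r leq_mul2r ht !orbT.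
apply: (@leq_trans ((t * W + j).+1 * cw)); first by rewrite mulSn addnC.
by rewrite leq_mul2r; apply/orP; right; rewrite mulSn; lia.
Qed.

Hypothesis L0 : 0 < L.
Hypothesis OW : O <= W.

Lemma circ_args g : g \in circ -> size g.2.1 = r /\ all (fun v => v < g.1) g.2.1.
Proof.
have an n v m : v < m -> all (fun v => v < m) (nseq n v) by move=> h; apply/allP => u /nseqP[->].
have ai a n m : a + n <= m -> all (fun v => v < m) (iota a n).
  by move=> h; apply/allP => u; rewrite mem_iota; lia.
case/circP => [j b hj hb ->|t j b ht hj hb ->|o ho ->].
(* Constant gates refer to variable 0, which precedes every gate because [L] is positive. *)
- have bL : L <= base 0 j + b by rewrite /base; lia.
  rewrite /gate0; case: ifP => h1 /=; [|case: ifP => h2 /=]; rewrite size_nseq; split=> //;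
    apply: an; lia.
- have bb j' : j' < W -> base t j' + cw <= base t.+1 j + b.
    move=> hj'; apply: leq_trans (base_mono (ltnSn t) hj') _.
    by rewrite /base addn0 mulnDl; lia.
  rewrite /= !all_cat !ai ?andbT; first by rewrite !size_cat !size_iota; split => //; lia.
  + by apply: bb; case: ifP.
  + exact: bb.
  + by apply: bb; lia.
  + by apply: bb; lia.
- rewrite /= size_cat size_iota size_nseq all_cat an ?andbT; last by rewrite /base; lia.
  split; first by lia.
  apply: ai; apply: leq_trans (base_mono (ltnSn T) _) (leq_addr _ _); exact: leq_trans ho OW.
Qed.

Lemma circ_out_ge g : g \in circ -> L <= g.1.
Proof.
move=> hg; have : g.1 \in map fst circ by apply: map_f.
by rewrite circ_outs mem_iota => /andP[].
Qed.

Variable val : nat -> bool.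
Hypothesis ok : forall g, g \in circ -> val g.1 = gval r g val.

Let A := map val (iota 0 L).
Let inw := xw ++ A.
Let conf t := iter t (@step M) (init_config M inw).

Hypothesis WE : size inw + T + 2 <= W.

Lemma tableau_bits t j F : (forall b, b < cw -> val (base t j + b) = nth false F b) ->
  size F = cw -> map val (iota (base t j) cw) = F.
Proof.
move=> h sF; apply: (@eq_from_nth _ false); rewrite size_map size_iota ?sF // => b hb.
by rewrite (nth_map 0) ?size_iota // nth_iota // h.
Qed.

Lemma gval_tb o args F : size args = r -> gval r (o, (args, tb r F)) val = F (map val args).
Proof. by move=> h; rewrite /gval /= nth_tb // size_map. Qed.

Lemma tableau0 j : j < W -> map val (iota (base 0 j) cw) = cenc (cell (conf 0) j).
Proof.
move=> hj; apply: tableau_bits; last exact: size_cenc.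
move=> b hb; rewrite (ok (mem_circ0 hj hb)) /conf /= cell_init /inw size_cat {2}/A size_map size_iota.
rewrite /gate0; case: ltnP => h1.
  rewrite ltn_addr // nth_cat h1.
  by case: (nth false xw j); case: eqP => _; rewrite tabulateE // gval_tb ?size_nseq.
case: ltnP => h2.
  have e : nth false (xw ++ A) j = val (j - size xw).
    rewrite nth_cat ltnNge h1 /= (nth_map 0) ?size_iota ?nth_iota ?add0n //; lia.
  have hd (v : nat) : head false [seq val i | i <- nseq r v] = val v.
    by rewrite map_nseq; have := cw_gt0; case: (cw) => // n _; rewrite mulnS.
  by case: eqP => _; rewrite tabulateE // gval_tb ?size_nseq // hd e.
by case: eqP => _; rewrite tabulateE // gval_tb ?size_nseq.
Qed.

Lemma part_cat (a b c d : bits) : size a = cw -> size b = cw -> size c = cw -> size d = cw ->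
  [/\ part 0 (a ++ b ++ c ++ d) = cdec a, part 1 (a ++ b ++ c ++ d) = cdec b,
      part 2 (a ++ b ++ c ++ d) = cdec c & part 3 (a ++ b ++ c ++ d) = cdec d].
Proof.
move=> sa sb sc sd; rewrite /part; split; congr cdec.
- by rewrite mul0n drop0 take_size_cat.
- by rewrite mul1n drop_size_cat // take_size_cat.
- by rewrite catA drop_size_cat ?take_size_cat // size_cat sa sb; lia.
- by rewrite !catA drop_size_cat ?take_oversize ?sd // !size_cat sa sb sc; lia.
Qed.

(** An assignment that satisfies all gates is determined by its inputs: row by row it is the run of
    [M] on [inw]. *)
Lemma tableau t j : t <= T -> j < W -> map val (iota (base t j) cw) = cenc (cell (conf t) j).
Proof.
elim: t j => [|t IH] j ht hj; first exact: tableau0.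
apply: tableau_bits; last exact: size_cenc.
move=> b hb; rewrite (ok (mem_circS ht hj hb)) /conf iterS -/(conf t) cell_step.
have sa : size (iota (base t 0) cw ++ iota (base t j.-1) cw ++ iota (base t j) cw
      ++ iota (base t (if j.+1 < W then j.+1 else j)) cw) = r.
  by rewrite !size_cat !size_iota; lia.
have hn : (if j.+1 < W then j.+1 else j) < W by case: ifP.
(* They differ only at the right edge, which no tape has reached by time [t]: by [WE] both cells are
   blank with the same state. *)
have ec : cell (conf t) (if j.+1 < W then j.+1 else j) = cell (conf t) j.+1.
  case: ltnP => // hW; have h := @size_iter inw t.
  by rewrite !(cell_blank h) //; lia.
have F kd : gval r (base t.+1 j + b, (iota (base t 0) cw ++ iota (base t j.-1) cw ++ iota (base t j) cw
      ++ iota (base t (if j.+1 < W then j.+1 else j)) cw, tabulate (step_tab kd) b)) val =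
   nth false (cenc (phi kd (cell (conf t) 0) (cell (conf t) j.-1) (cell (conf t) j) (cell (conf t) j.+1))) b.
  rewrite tabulateE // gval_tb // !map_cat !IH ?(ltnW ht) //; try lia.
  have [-> -> -> ->] := part_cat (size_cenc (cell (conf t) 0)) (size_cenc (cell (conf t) j.-1))
    (size_cenc (cell (conf t) j)) (size_cenc (cell (conf t) (if j.+1 < W then j.+1 else j))).
  by rewrite !cencK ec.
by rewrite /gateS; case: j {hj sa hn ec} F => [|[|j]] F /=; rewrite F.
Qed.

Lemma circ_output y : output (conf T) = y -> size y = O ->
  map val (iota (base T.+1 0) O) = y.
Proof.
move=> e sy; apply: (@eq_from_nth _ false); rewrite size_map size_iota ?sy // => o ho.
rewrite (nth_map 0) ?size_iota // nth_iota // (ok (mem_circO ho)).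
have hW : o < W := leq_trans ho OW.
rewrite /gateO gval_tb; last by rewrite size_cat size_iota size_nseq; lia.
rewrite map_cat tableau // /part mul0n drop0 take_size_cat ?size_cenc // cencK /= ffunE /=.
rewrite -e in ho sy *; rewrite -sy in ho; rewrite /rcell (leading_bitsP ho).
by rewrite -/(output (conf T)); case: (nth false _ _).
Qed.

End Circuit.

End Tableau.

(** * The constraints of the reduction *)

(** Variable 0 is the control bit; the variables of the copies [false] and [true] follow in this
    order. *)
Definition cv (V : nat) (z : bool) (j : nat) : nat := if z then (V + j).+1 else j.+1.

Lemma cv_inj V z z' j j' : j < V -> j' < V -> cv V z j = cv V z' j' -> z = z' /\ j = j'.
Proof. by rewrite /cv; case: z; case: z' => h1 h2 e; split=> //; lia. Qed.

Lemma cv_lt V z j : j < V -> cv V z j < (V + V).+1.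
Proof. by rewrite /cv; case: z; lia. Qed.

Lemma cv0 V z j : cv V z j != 0.
Proof. by rewrite /cv; case: z. Qed.

Section Constraints.

Variables (r V L C ob : nat) (gs : seq gate).
Local Notation R := (r + 2).
Local Notation K := (V + V).+1.

(** Constantly 0, hence neutral in every comparison; its purpose is to make variable [u] legible in
    the permutation. *)
Definition c_dummy (u : nat) : cstr := (nseq R u, tb R (fun=> false)).
(** The two slots beyond the arguments of the gate hold the control bit and the output. The
    constraint is switched off unless the copy [z] is the master. *)
Definition c_guard (z : bool) (g : gate) : cstr :=
  (0 :: cv V z g.1 :: map (cv V z) g.2.1,
   tb R (fun w => (nth false w 0 == z) &&
     (nth false w 1 != nth false g.2.2 (index (drop 2 w) (allbits r))))).
(** Three slots matter; [r.-1] more copies of variable 0 make up the common number [r + 2]. *)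
Definition c_cost (o : nat) : cstr :=
  ([:: 0, cv V false (ob + L + o), cv V true (ob + L + o) & nseq r.-1 0],
   tb R (fun w => if nth false w 0 then nth false w 2 else nth false w 1)).
Definition c_copy (z : bool) (j : nat) : cstr :=
  ([:: 0, cv V (~~ z) j, cv V z (ob + j) & nseq r.-1 0],
   tb R (fun w => (nth false w 0 == z) && (nth false w 1 != nth false w 2))).
(** It does not look at the control bit: gates have to be correct in both copies, so that all guards
    remain satisfied when the control bit is flipped. *)
Definition c_all (z : bool) (g : gate) : cstr :=
  (0 :: cv V z g.1 :: map (cv V z) g.2.1,
   tb R (fun w => nth false w 1 != nth false g.2.2 (index (drop 2 w) (allbits r)))).

Definition cstrs : seq cstr :=
  [seq c_dummy u | u <- iota 0 K] ++
  ([seq c_guard false g | g <- gs] ++ [seq c_guard true g | g <- gs]) ++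
  [seq c_cost o | o <- iota 0 C] ++
  ([seq c_copy false j | j <- iota 0 L] ++ [seq c_copy true j | j <- iota 0 L]) ++
  ([seq c_all false g | g <- gs] ++ [seq c_all true g | g <- gs]).

Hypothesis r0 : 0 < r.
Hypothesis gs_args : forall g, g \in gs ->
  [/\ size g.2.1 = r, all (fun v => v < g.1) g.2.1, L <= g.1 & g.1 < V].
Hypothesis gs_sorted : forall g1 g g2 g', gs = g1 ++ g :: g2 -> g' \in g1 -> g'.1 < g.1.
Hypothesis obL : L <= ob.
Hypothesis obV : ob + L + C <= V.

Lemma size_cstrs : all (fun c => size c.1 == R) cstrs.
Proof.
have rr : r.-1.+3 = R by lia.
have G (z : bool) (f : bool -> gate -> cstr) :
    (forall g, size (f z g).1 = (size g.2.1).+2) ->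
    all (fun c : cstr => size c.1 == R) [seq f z g | g <- gs].
  move=> hf; apply/allP => _ /mapP[g hg ->]; rewrite hf //.
  by have [-> _ _ _] := gs_args hg; rewrite addn2.
have S (f : nat -> cstr) l : (forall u, size (f u).1 = R) ->
    all (fun c : cstr => size c.1 == R) [seq f u | u <- l].
  by move=> hf; apply/allP => _ /mapP[u _ ->]; rewrite hf.
rewrite !all_cat !(G _ c_guard) ?(G _ c_all) ?(S c_dummy) ?(S c_cost) ?(S (c_copy _)) // => *;
  by rewrite /= ?size_map // size_nseq.
Qed.

Lemma ceval_tb sl F y : size sl = R -> ceval R (sl, tb R F) y = F (map y sl).
Proof. by move=> h; rewrite /ceval nth_tb // size_map. Qed.

Lemma ceval_dummy u y : ceval R (c_dummy u) y = false.
Proof. by rewrite ceval_tb // size_nseq. Qed.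

Lemma ceval_guard z g y : g \in gs -> ceval R (c_guard z g) y =
  (y 0 == z) && (y (cv V z g.1) != gval r g (y \o cv V z)).
Proof.
move=> /gs_args[sg _ _ _]; rewrite ceval_tb /= ?size_map ?sg ?addn2 //.
by rewrite drop0 -map_comp.
Qed.

Lemma ceval_all z g y : g \in gs -> ceval R (c_all z g) y =
  (y (cv V z g.1) != gval r g (y \o cv V z)).
Proof.
move=> /gs_args[sg _ _ _]; rewrite ceval_tb /= ?size_map ?sg ?addn2 //.
by rewrite drop0 -map_comp.
Qed.

Lemma ceval_cost o y : ceval R (c_cost o) y = y (cv V (y 0) (ob + L + o)).
Proof. by rewrite ceval_tb /=; [case: (y 0) | rewrite size_nseq; lia]. Qed.

Lemma ceval_copy z j y : ceval R (c_copy z j) y =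
  (y 0 == z) && (y (cv V (~~ z) j) != y (cv V z (ob + j))).
Proof. by rewrite ceval_tb //= size_nseq; lia. Qed.

Variable y : nat -> bool.
Hypothesis LM : forall u c, u < K -> c < size cstrs ->
  (forall i, i < c -> ceval R (nth cstr0 cstrs i) (flip u y) = ceval R (nth cstr0 cstrs i) y) ->
  ceval R (nth cstr0 cstrs c) y -> ceval R (nth cstr0 cstrs c) (flip u y).

Lemma LM_split u c1 c c2 : u < K -> cstrs = c1 ++ c :: c2 ->
  (forall d, d \in c1 -> ceval R d (flip u y) = ceval R d y) ->
  ceval R c y -> ceval R c (flip u y).
Proof.
move=> hu e h; have := @LM u (size c1) hu; rewrite e nth_cat ltnn subnn /= => H.
apply: H; first by rewrite size_cat /=; lia.
by move=> i hi; rewrite nth_cat hi; apply: h; apply: mem_nth.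
Qed.

(** Treats both values of the control bit at once. Whichever copy is listed first, only earlier
    constraints of the same copy and constraints of the other copy stand before. *)
Lemma block_split T (f : bool -> T -> cstr) (l : seq T) z l1 t l2 : l = l1 ++ t :: l2 ->
  exists p s, map (f false) l ++ map (f true) l = p ++ f z t :: s /\
    forall d, d \in p -> d \in map (f z) l1 \/ d \in map (f (~~ z)) l.
Proof.
move=> e; case: z.
  exists (map (f false) l ++ map (f true) l1), (map (f true) l2); split.
    by rewrite {2}e map_cat /= catA.
  by move=> d; rewrite mem_cat => /orP[]; [right | left].
exists (map (f false) l1), (map (f false) l2 ++ map (f true) l); split; last by move=> d; left.
by rewrite {1}e map_cat /= -catA.
Qed.

Lemma flipE u : flip u y u = ~~ y u.
Proof. by rewrite /flip eqxx. Qed.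

Lemma flipN u v : v != u -> flip u y v = y v.
Proof. by rewrite /flip => /negPf ->. Qed.

Lemma flip_cv z j z' j' : j < V -> j' < V -> (z' != z) || (j' != j) ->
  flip (cv V z j) y (cv V z' j') = y (cv V z' j').
Proof.
move=> h h' n; apply: flipN; apply/eqP => /cv_inj [] // e e'.
by rewrite e e' !eqxx in n.
Qed.

Lemma flip_gval z j z' g : j < V -> g \in gs -> (z' != z) || (g.1 <= j) ->
  gval r g (flip (cv V z j) y \o cv V z') = gval r g (y \o cv V z').
Proof.
move=> hj hg h; rewrite /gval; congr (nth _ _ (index _ _)); apply/eq_in_map => v hv /=.
have [_ /allP ag _ gV] := gs_args hg; have hv' := ag v hv.
apply: flip_cv => //; first exact: ltn_trans gV.
by case/orP: h => [->//|h]; apply/orP; right; apply/eqP; lia.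
Qed.

Lemma flip_cv0 z j : flip (cv V z j) y 0 = y 0.
Proof. by rewrite flipN // eq_sym cv0. Qed.

Let z := y 0.

Lemma negbz : (z == ~~ z) = false.
Proof. by case: z. Qed.

(** Flipping the output of a violated gate repairs it. Earlier gates of the master involve smaller
    variables only, and the guards of the slave are switched off, so nothing of higher priority
    changes. *)
Lemma master_ok g : g \in gs -> y (cv V z g.1) = gval r g (y \o cv V z).
Proof.
move=> hg; have [g1 [g2 e]] : exists g1 g2, gs = g1 ++ g :: g2.
  by case/splitPr: hg => g1 g2; exists g1, g2.
have [_ _ gL gV] := gs_args hg.
have [p [s [ep hp]]] := block_split c_guard z e.
set u := cv V z g.1; apply/eqP; apply: contraT => hne.
have : ceval R (c_guard z g) (flip u y).
  apply: (@LM_split u ([seq c_dummy u | u <- iota 0 K] ++ p)) => //.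
  - exact: cv_lt.
  - by rewrite /cstrs ep -!catA.
  - move=> d; rewrite mem_cat => /orP[/mapP[v _ ->]|/hp[/mapP[g' hg' ->]|/mapP[g' hg' ->]]].
    + by rewrite !ceval_dummy.
    + have lt := gs_sorted e hg'; have hg0 : g' \in gs by rewrite e mem_cat hg'.
      have [_ _ _ gV'] := gs_args hg0.
      rewrite !ceval_guard // flip_cv0 flip_gval ?flip_cv // ?(ltnW lt) ?orbT //.
      by rewrite neq_ltn lt orbT.
    + by rewrite !ceval_guard // flip_cv0 -/z negbz.
  - by rewrite ceval_guard // eqxx.
rewrite ceval_guard // flip_cv0 flip_gval ?leqnn ?orbT // flipE => /andP[_].
by move: hne; case: (y u); case: (gval _ _ _).
Qed.

(** The active guards and the costs read the master only, and each input of the slave occurs in a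
    single active copy constraint. Flipping a wrong input would repair just that one. *)
Lemma slave_copy j : j < L -> y (cv V (~~ z) j) = y (cv V z (ob + j)).
Proof.
move=> hj; have jV : j < V by lia.
have [p [s [ep hp]]] : exists p s, [seq c_copy false j | j <- iota 0 L] ++ [seq c_copy true j | j <- iota 0 L]
   = p ++ c_copy z j :: s /\ forall d, d \in p -> d \in [seq c_copy z i | i <- iota 0 j] \/
     d \in [seq c_copy (~~ z) i | i <- iota 0 L].
  apply: (block_split c_copy z (l2 := iota j.+1 (L - j.+1))).
  have -> : L = j + (1 + (L - j.+1)) by lia.
  by rewrite !iotaD /= !add0n addn1; congr (_ ++ _ :: iota _ _); lia.
set u := cv V (~~ z) j; apply/eqP; apply: contraT => hne.
have : ceval R (c_copy z j) (flip u y).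
  apply: (@LM_split u ([seq c_dummy u | u <- iota 0 K] ++
     ([seq c_guard false g | g <- gs] ++ [seq c_guard true g | g <- gs]) ++
     [seq c_cost o | o <- iota 0 C] ++ p)) => //.
  - exact: cv_lt.
  - by rewrite /cstrs ep -!catA.
  - have G z' g : g \in gs -> ceval R (c_guard z' g) (flip u y) = ceval R (c_guard z' g) y.
      move=> hg; have [_ _ gL gV] := gs_args hg; rewrite !ceval_guard // flip_cv0 -/z.
      case: (boolP (z == z')) => // /eqP <-.
      by rewrite flip_gval ?flip_cv // ?negbK ?eqxx //; case: (z).
    move=> d; rewrite !mem_cat => /orP[/mapP[v _ ->]|/orP[/orP[/mapP[g hg ->]|/mapP[g hg ->]]|]].
    + by rewrite !ceval_dummy.
    + exact: G.
    + exact: G.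
    case/orP => [/mapP[o ho ->]|/hp[/mapP[i hi ->]|/mapP[i hi ->]]].
    + rewrite mem_iota in ho; rewrite !ceval_cost flip_cv0 flip_cv //; first by lia.
      by rewrite -/z; case: (z).
    + rewrite mem_iota in hi; rewrite !ceval_copy flip_cv0 !flip_cv //; try lia.
    + by rewrite !ceval_copy flip_cv0 -/z negbz.
  - by rewrite ceval_copy eqxx.
rewrite ceval_copy flip_cv0 flipE flip_cv //; [|by lia|by case: (z)].
by move/andP => [_]; move: hne; case: (y u); case: (y _).
Qed.

(** For the slave: its guards are switched off, costs read the master, and the active copy
    constraints read inputs of the slave, which lie below [L] and are not outputs of gates. The
    argument for the master then applies to [c_all]. *)
Lemma gates_ok z' g : g \in gs -> y (cv V z' g.1) = gval r g (y \o cv V z').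
Proof.
move=> hg; case: (boolP (z' == z)) => [/eqP ->|zz]; first exact: master_ok.
have {zz} -> : z' = ~~ z by move: zz; case: z'; case: z.
have [g1 [g2 e]] : exists g1 g2, gs = g1 ++ g :: g2.
  by case/splitPr: hg => g1 g2; exists g1, g2.
have [_ _ gL gV] := gs_args hg.
have [p [s [ep hp]]] := block_split c_all (~~ z) e.
set u := cv V (~~ z) g.1; apply/eqP; apply: contraT => hne.
have zn : z != ~~ z by case: z.
have : ceval R (c_all (~~ z) g) (flip u y).
  apply: (@LM_split u ([seq c_dummy u | u <- iota 0 K] ++
     ([seq c_guard false g | g <- gs] ++ [seq c_guard true g | g <- gs]) ++
     [seq c_cost o | o <- iota 0 C] ++
     ([seq c_copy false j | j <- iota 0 L] ++ [seq c_copy true j | j <- iota 0 L]) ++ p)) => //.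
  - exact: cv_lt.
  - by rewrite /cstrs ep -!catA.
  - have G z1 g' : g' \in gs -> ceval R (c_guard z1 g') (flip u y) = ceval R (c_guard z1 g') y.
      move=> hg'; have [_ _ gL' gV'] := gs_args hg'; rewrite !ceval_guard // flip_cv0 -/z.
      by case: (boolP (z == z1)) => // /eqP <-; rewrite flip_gval ?flip_cv // ?zn.
    have Cp z1 j : j \in iota 0 L -> ceval R (c_copy z1 j) (flip u y) = ceval R (c_copy z1 j) y.
      rewrite mem_iota => hj; rewrite !ceval_copy flip_cv0 -/z.
      case: (boolP (z == z1)) => // /eqP <-; rewrite !flip_cv ?zn //; try lia.
    move=> d; rewrite !mem_cat => /orP[/mapP[v _ ->]|/orP[/orP[/mapP[g' hg' ->]|/mapP[g' hg' ->]]|]].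
    + by rewrite !ceval_dummy.
    + exact: G.
    + exact: G.
    case/orP => [/mapP[o ho ->]|/orP[/orP[/mapP[j hj ->]|/mapP[j hj ->]]|/hp[/mapP[g' hg' ->]|/mapP[g' hg' ->]]]].
    + rewrite mem_iota in ho; rewrite !ceval_cost flip_cv0 flip_cv -/z ?zn //; lia.
    + exact: Cp.
    + exact: Cp.
    + have lt := gs_sorted e hg'; have hg0 : g' \in gs by rewrite e mem_cat hg'.
      have [_ _ _ gV'] := gs_args hg0.
      rewrite !ceval_all // flip_gval ?flip_cv // ?(ltnW lt) ?orbT //.
      by rewrite neq_ltn lt orbT.
    + have [_ _ _ gV'] := gs_args hg'.
      by rewrite negbK !ceval_all // flip_gval ?flip_cv // ?zn.
  - by rewrite ceval_all.
rewrite ceval_all // flip_gval ?leqnn ?orbT // flipE.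
by move: hne; case: (y u); case: (gval _ _ _).
Qed.

Definition costs (b : bool) : bits := [seq y (cv V b (ob + L + o)) | o <- iota 0 C].

(** Otherwise the control bit could be flipped with profit. With all gates correct in both copies,
    all guards stay at 0, so the cost bits are the first constraints that can change. *)
Lemma costs_le : bits_val (costs z) <= bits_val (costs (~~ z)).
Proof.
rewrite leqNgt -bltE ?size_map // /blt size_map size_iota; set f := fun i => _.
apply/negP => /andP[hi].
set i := find f _ in hi *.
have nc b o : o < C -> nth false (costs b) o = y (cv V b (ob + L + o)).
  by move=> ho; rewrite (nth_map 0) ?size_iota // nth_iota.
have hf : has f (iota 0 C) by rewrite has_find size_iota.
have hd : f i by have := nth_find 0 hf; rewrite -/i nth_iota.
have before o : o < i -> y (cv V (~~ z) (ob + L + o)) = y (cv V z (ob + L + o)).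
  move=> ho; have oC : o < C := ltn_trans ho hi.
  by have := before_find 0 ho; rewrite nth_iota // /f !nc // => /negbFE/eqP.
(* At the first difference [i] the master has a 1, hence the slave a 0. *)
rewrite nc // => h.
have hn : ~~ y (cv V (~~ z) (ob + L + i)).
  by move: hd; rewrite /f !nc // h; case: (y _).
have z0 b j : flip 0 y (cv V b j) = y (cv V b j) by rewrite flipN // cv0.
have gv b g : gval r g (flip 0 y \o cv V b) = gval r g (y \o cv V b).
  by rewrite /gval; congr (nth _ _ (index _ _)); apply: eq_map => v /=; rewrite z0.
have : ceval R (c_cost i) (flip 0 y).
  apply: (@LM_split 0 ([seq c_dummy u | u <- iota 0 K] ++
     ([seq c_guard false g | g <- gs] ++ [seq c_guard true g | g <- gs]) ++
     [seq c_cost o | o <- iota 0 i]) _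
     ([seq c_cost o | o <- iota i.+1 (C - i.+1)] ++
  ([seq c_copy false j | j <- iota 0 L] ++ [seq c_copy true j | j <- iota 0 L]) ++
  ([seq c_all false g | g <- gs] ++ [seq c_all true g | g <- gs]))) => //.
  - rewrite /cstrs.
    have -> : iota 0 C = iota 0 i ++ i :: iota i.+1 (C - i.+1).
      have {1}-> : C = i + (1 + (C - i.+1)) by lia.
      by rewrite !iotaD /= !add0n addn1.
    by rewrite map_cat /= -!catA.
  - move=> d; rewrite !mem_cat => /orP[/mapP[v _ ->]|/orP[/orP[/mapP[g hg ->]|/mapP[g hg ->]]|/mapP[o ho ->]]].
    + by rewrite !ceval_dummy.
    + by rewrite !ceval_guard // z0 gv gates_ok // eqxx !andbF.
    + by rewrite !ceval_guard // z0 gv gates_ok // eqxx !andbF.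
    + by rewrite mem_iota in ho; rewrite !ceval_cost z0 flipE -/z before.
  - by rewrite ceval_cost.
by rewrite ceval_cost z0 flipE -/z (negPf hn).
Qed.

End Constraints.

(** * PLS-hardness *)

Definition eG : gate -> bits := ep en (ep (es en) idb).

Lemma ptime_ifE T (e : T -> bits) A (dom : A -> Prop) inp (c : A -> bool) (u v : A -> T) :
  ptime dom inp (fun a => eb (c a)) -> ptime dom inp (fun a => e (u a)) ->
  ptime dom inp (fun a => e (v a)) -> ptime dom inp (fun a => e (if c a then u a else v a)).
Proof.
move=> Hc Hu Hv; apply: (@ptime_ext _ _ _ (fun a => if c a then e (u a) else e (v a))).
  by move=> a _; case: (c a).
exact: ptime_ifs.
Qed.

Lemma ptime_pairE T U (e : T -> bits) (f : U -> bits) A (dom : A -> Prop) inp (u : A -> T) (v : A -> U) :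
  ptime dom inp (fun a => e (u a)) -> ptime dom inp (fun a => f (v a)) ->
  ptime dom inp (fun a => ep e f (u a, v a)).
Proof. exact: ptime_pair. Qed.

(** * Polynomial-time construction of the circuit *)

Section CircuitPoly.

Variable M : machine.

Lemma ptime_tabulate A (dom : A -> Prop) inp F b : ptime dom inp (fun a => en (b a)) ->
  ptime dom inp (fun a => tabulate M F (b a)).
Proof.
move=> Hb; apply: (ptime_nth (listk idb) (t0 := fun=> [::]) (l := fun=> [seq F b | b <- iota 0 (cw M)])) => //;
exact: ptime_const.
Qed.

Lemma ptime_base A (dom : A -> Prop) inp L W t j : ptime dom inp (fun a => en (L a)) ->
  ptime dom inp (fun a => en (W a)) -> ptime dom inp (fun a => en (t a)) ->
  ptime dom inp (fun a => en (j a)) ->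
  ptime dom inp (fun a => en (base M (L a) (W a) (t a) (j a))).
Proof.
move=> HL HW Ht Hj; apply: ptime_addn => //; apply: ptime_muln; last exact: ptime_const.
by apply: ptime_addn => //; apply: ptime_muln.
Qed.

Lemma ptime_lt A (dom : A -> Prop) inp m n : ptime dom inp (fun a => en (m a)) ->
  ptime dom inp (fun a => en (n a)) -> ptime dom inp (fun a => eb (m a < n a)).
Proof. by move=> Hm Hn; apply: ptime_leq => //; apply: ptime_succ. Qed.

Lemma ptime_gate0 A (dom : A -> Prop) inp L W xw j b : ptime dom inp (fun a => en (L a)) ->
  ptime dom inp (fun a => en (W a)) -> ptime dom inp xw -> ptime dom inp (fun a => en (j a)) ->
  ptime dom inp (fun a => en (b a)) ->
  ptime dom inp (fun a => eG (gate0 M (L a) (W a) (xw a) (j a) (b a))).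
Proof.
move=> HL HW Hx Hj Hb.
have Hs : ptime dom inp (fun a => en (size (xw a))) by exact: (ptime_size_of rawk).
have H0 : ptime dom inp (fun a => en 0) by exact: ptime_const.
have Hr : ptime dom inp (fun a => en (4 * cw M)) by exact: ptime_const.
have Hz F G : ptime dom inp (fun a => if j a == 0 then tabulate M F (b a) else tabulate M G (b a)).
  by apply: ptime_ifs; [apply: ptime_eqn | apply: ptime_tabulate | apply: ptime_tabulate].
apply: ptime_pairE; first by apply: ptime_addn => //; apply: ptime_base.
apply: (ptime_ifE (e := ep (es en) idb)); first exact: ptime_lt.
  apply: ptime_pairE; first exact: (ptime_nseq (listk en)).
  apply: (ptime_ifE (e := idb)) => //.
  by apply: (ptime_nth rawk (t0 := fun=> false)) => //; apply: ptime_const.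
apply: (ptime_ifE (e := ep (es en) idb)); first by apply: ptime_lt => //; apply: ptime_addn.
  apply: ptime_pairE => //; apply: (ptime_nseq (listk en)) => //; exact: ptime_subn.
by apply: ptime_pairE => //; apply: (ptime_nseq (listk en)).
Qed.

Lemma ptime_gateS A (dom : A -> Prop) inp L W t j b : ptime dom inp (fun a => en (L a)) ->
  ptime dom inp (fun a => en (W a)) -> ptime dom inp (fun a => en (t a)) ->
  ptime dom inp (fun a => en (j a)) -> ptime dom inp (fun a => en (b a)) ->
  ptime dom inp (fun a => eG (gateS M (L a) (W a) (t a) (j a) (b a))).
Proof.
move=> HL HW Ht Hj Hb.
have H0 : ptime dom inp (fun a => en 0) by exact: ptime_const.
have H1 : ptime dom inp (fun a => en 1) by exact: ptime_const.
have Hc : ptime dom inp (fun a => en (cw M)) by exact: ptime_const.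
have Hi j' : ptime dom inp (fun a => en (j' a)) ->
    ptime dom inp (fun a => es en (iota (base M (L a) (W a) (t a) (j' a)) (cw M))).
  by move=> Hj'; apply: ptime_iota => //; apply: ptime_base.
apply: ptime_pairE; first by apply: ptime_addn => //; apply: ptime_base => //; apply: ptime_succ.
apply: ptime_pairE.
  apply: (ptime_cat (listk en)); first exact: Hi.
  apply: (ptime_cat (listk en)).
    apply: Hi; by apply: (@ptime_ext _ _ _ (fun a => en (j a - 1))) => [a _|]; [rewrite subn1 | apply: ptime_subn].
  apply: (ptime_cat (listk en)); first exact: Hi.
  apply: Hi; apply: (ptime_ifE (e := en)) => //; last exact: ptime_succ.
  by apply: ptime_lt => //; apply: ptime_succ.
apply: (ptime_ifE (e := idb)); [exact: ptime_eqn | exact: ptime_tabulate |].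
by apply: (ptime_ifE (e := idb)); [exact: ptime_eqn | exact: ptime_tabulate | exact: ptime_tabulate].
Qed.

Lemma ptime_gateO A (dom : A -> Prop) inp L T W o : ptime dom inp (fun a => en (L a)) ->
  ptime dom inp (fun a => en (T a)) -> ptime dom inp (fun a => en (W a)) ->
  ptime dom inp (fun a => en (o a)) ->
  ptime dom inp (fun a => eG (gateO M (L a) (T a) (W a) (o a))).
Proof.
move=> HL HT HW Ho.
have H0 : ptime dom inp (fun a => en 0) by exact: ptime_const.
apply: ptime_pairE; first by apply: ptime_addn => //; apply: ptime_base => //; apply: ptime_succ.
apply: ptime_pairE; last exact: ptime_const.
apply: (ptime_cat (listk en)); last exact: ptime_const.
by apply: ptime_iota; [apply: ptime_base | apply: ptime_const].
Qed.

Lemma ptime_circ A (dom : A -> Prop) inp L T W O xw : ptime dom inp (fun a => en (L a)) ->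
  ptime dom inp (fun a => en (T a)) -> ptime dom inp (fun a => en (W a)) ->
  ptime dom inp (fun a => en (O a)) -> ptime dom inp xw ->
  ptime dom inp (fun a => es eG (circ M (L a) (T a) (W a) (O a) (xw a))).
Proof.
move=> HL HT HW HO Hx.
have Hc B (d : B -> Prop) i : ptime d i (fun=> es en (iota 0 (cw M))) by exact: ptime_const.
apply: (ptime_cat (listk eG)).
  apply: ptime_flattenl; apply: (ptime_map (listk en) (listk (es eG))
    (f := fun a j => [seq gate0 M (L a) (W a) (xw a) j b | b <- iota 0 (cw M)]) (domb := fun x => dom x.1)) => //.
    exact: ptime_iota0.
  apply: (ptime_map (listk en) (listk eG) (f := fun (x : A * nat) b => gate0 M (L x.1) (W x.1) (xw x.1) x.2 b)
    (domb := fun x => dom x.1.1)) => //.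
  by apply: ptime_gate0; ptime_var.
apply: (ptime_cat (listk eG)).
  apply: ptime_flattenl; apply: (ptime_map (listk en) (listk (es eG))
    (f := fun a t => flatten [seq [seq gateS M (L a) (W a) t j b | b <- iota 0 (cw M)] | j <- iota 0 (W a)])
    (domb := fun x => dom x.1)) => //.
    exact: ptime_iota0.
  apply: ptime_flattenl; apply: (ptime_map (listk en) (listk (es eG))
    (f := fun (x : A * nat) j => [seq gateS M (L x.1) (W x.1) x.2 j b | b <- iota 0 (cw M)]) (domb := fun x => dom x.1.1)) => //.
    by apply: ptime_iota0; ptime_var.
  apply: (ptime_map (listk en) (listk eG) (f := fun (x : A * nat * nat) b => gateS M (L x.1.1) (W x.1.1) x.1.2 x.2 b)
    (domb := fun x => dom x.1.1.1)) => //.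
  by apply: ptime_gateS; ptime_var.
apply: (ptime_map (listk en) (listk eG) (f := fun a o => gateO M (L a) (T a) (W a) o) (domb := fun x => dom x.1)) => //.
  exact: ptime_iota0.
by apply: ptime_gateO; ptime_var.
Qed.

End CircuitPoly.

(** * Polynomial-time construction of the constraints *)

Section ConstraintPoly.

Variable r : nat.

Lemma ptime_cv A (dom : A -> Prop) inp V z j : ptime dom inp (fun a => en (V a)) ->
  ptime dom inp (fun a => en (j a)) -> ptime dom inp (fun a => en (cv (V a) z (j a))).
Proof. by move=> HV Hj; case: z; apply: ptime_succ => //; apply: ptime_addn. Qed.

Lemma ptime_nthb A (dom : A -> Prop) inp w i : ptime dom inp w ->
  ptime dom inp (fun a => eb (nth false (w a) i)).
Proof.
by move=> Hw; apply: (ptime_nth rawk (t0 := fun=> false) (n := fun=> i)) => //; apply: ptime_const.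
Qed.

Lemma ptime_neqb A (dom : A -> Prop) inp (b c : A -> bool) : ptime dom inp (fun a => eb (b a)) ->
  ptime dom inp (fun a => eb (c a)) -> ptime dom inp (fun a => eb (b a != c a)).
Proof. by move=> Hb Hc; apply: ptime_negb; apply: (@ptime_eq _ (fun b => eb b)) => //; move=> ? ? []. Qed.

(** As [r] is fixed, the list of arguments is a constant; only the table of the gate varies with the
    input. *)
Lemma ptime_gate_tables A (dom : A -> Prop) inp (t : A -> bits) (F : bool -> bool -> bool) :
  ptime dom inp t ->
  (forall B (d : B -> Prop) i (b c : B -> bool), ptime d i (fun x => eb (b x)) -> ptime d i (fun x => eb (c x)) ->
     ptime d i (fun x => eb (F (b x) (c x)))) ->
  ptime dom inp (fun a => tb (r + 2) (fun w => F (nth false w 0)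
    (nth false w 1 != nth false (t a) (index (drop 2 w) (allbits r))))).
Proof.
move=> Ht HF; apply: (ptime_map (listk idb) rawk (l := fun=> allbits (r + 2)) (f := fun a w => F (nth false w 0)
    (nth false w 1 != nth false (t a) (index (drop 2 w) (allbits r)))) (domb := fun x => dom x.1)) => //.
  exact: ptime_const.
apply: HF; first by apply: ptime_nthb; ptime_var.
apply: ptime_neqb; first by apply: ptime_nthb; ptime_var.
apply: (ptime_nth rawk (t0 := fun=> false)); [ptime_var | exact: ptime_const |].
apply: (ptime_index (listk idb) id_inj (l := fun=> allbits r)); last exact: ptime_const.
by apply: (ptime_drop rawk (n := fun=> 2)); [exact: ptime_const | ptime_var].
Qed.

Lemma ptime_gate_slots A (dom : A -> Prop) inp V z (g : A -> gate) :
  ptime dom inp (fun a => en (V a)) -> ptime dom inp (fun a => eG (g a)) ->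
  ptime dom inp (fun a => es en (0 :: cv (V a) z (g a).1 :: map (cv (V a) z) (g a).2.1)).
Proof.
move=> HV Hg; apply: (lk_cons (listk en) (h := fun=> 0)); first exact: ptime_const.
apply: (lk_cons (listk en)); first by apply: ptime_cv => //; exact: ptime_fst Hg.
apply: (ptime_map (listk en) (listk en) (f := fun a v => cv (V a) z v) (domb := fun x => dom x.1)) => //.
  exact: ptime_fst (ptime_snd Hg).
by apply: ptime_cv; ptime_var.
Qed.

Lemma ptime_c_guard A (dom : A -> Prop) inp V z (g : A -> gate) :
  ptime dom inp (fun a => en (V a)) -> ptime dom inp (fun a => eG (g a)) ->
  ptime dom inp (fun a => eC (c_guard r (V a) z (g a))).
Proof.
move=> HV Hg; apply: ptime_pairE; first exact: ptime_gate_slots.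
apply: (ptime_gate_tables (F := fun b c => (b == z) && c)); first exact: ptime_snd (ptime_snd Hg).
move=> B d i b c Hb Hc; apply: ptime_andb; last by apply: ptime_dom Hc => x [].
apply: (@ptime_eq _ (fun b => eb b) _ _ _ _ (fun=> z)) => //; [by move=> ? ? []|exact: ptime_const].
Qed.

Lemma ptime_c_all A (dom : A -> Prop) inp V z (g : A -> gate) :
  ptime dom inp (fun a => en (V a)) -> ptime dom inp (fun a => eG (g a)) ->
  ptime dom inp (fun a => eC (c_all r (V a) z (g a))).
Proof.
move=> HV Hg; apply: ptime_pairE; first exact: ptime_gate_slots.
by apply: (ptime_gate_tables (F := fun b c => c)) => //; exact: ptime_snd (ptime_snd Hg).
Qed.

Lemma ptime_cstrs A (dom : A -> Prop) inp V L C ob (gs : A -> seq gate) :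
  ptime dom inp (fun a => en (V a)) -> ptime dom inp (fun a => en (L a)) ->
  ptime dom inp (fun a => en (C a)) -> ptime dom inp (fun a => en (ob a)) ->
  ptime dom inp (fun a => es eG (gs a)) ->
  ptime dom inp (fun a => es eC (cstrs r (V a) (L a) (C a) (ob a) (gs a))).
Proof.
move=> HV HL HC Hob Hg.
have Hgate (f : nat -> gate -> cstr) :
   (forall B (d : B -> Prop) i V' (g : B -> gate), ptime d i (fun a => en (V' a)) -> ptime d i (fun a => eG (g a)) ->
     ptime d i (fun a => eC (f (V' a) (g a)))) ->
   ptime dom inp (fun a => es eC [seq f (V a) g | g <- gs a]).
  move=> H; apply: (ptime_map (listk eG) (listk eC) (f := fun a g => f (V a) g) (domb := fun x => dom x.1)) => //.
  by apply: H; ptime_var.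
have Hcopy z : ptime dom inp (fun a => es eC [seq c_copy r (V a) (ob a) z j | j <- iota 0 (L a)]).
  apply: (ptime_map (listk en) (listk eC) (f := fun a j => c_copy r (V a) (ob a) z j) (domb := fun x => dom x.1)) => //.
    exact: ptime_iota0.
  apply: ptime_pairE; last exact: ptime_const.
  apply: (lk_cons (listk en) (h := fun=> 0)); first exact: ptime_const.
  apply: (lk_cons (listk en)); first by apply: ptime_cv; ptime_var.
  apply: (lk_cons (listk en)); last exact: ptime_const.
  by apply: ptime_cv; [ptime_var | apply: ptime_addn; ptime_var].
apply: (ptime_cat (listk eC)).
  apply: (ptime_map (listk en) (listk eC) (f := fun _ u => c_dummy r u) (domb := fun x => dom x.1)) => //.
    by apply: ptime_iota0; apply: ptime_succ; apply: ptime_addn.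
  apply: ptime_pairE; last exact: ptime_const.
  by apply: (ptime_nseq (listk en) (n := fun=> r + 2)); [exact: ptime_const | ptime_var].
apply: (ptime_cat (listk eC)).
  by apply: (ptime_cat (listk eC)); apply: (Hgate (fun V g => c_guard r V _ g)) => *; apply: ptime_c_guard.
apply: (ptime_cat (listk eC)).
  apply: (ptime_map (listk en) (listk eC) (f := fun a o => c_cost r (V a) (L a) (ob a) o) (domb := fun x => dom x.1)) => //.
    exact: ptime_iota0.
  have Ho : ptime (fun x => dom x.1) (ep inp en) (fun x => en (ob x.1 + L x.1 + x.2)).
    by apply: ptime_addn; [apply: ptime_addn; ptime_var | ptime_var].
  apply: ptime_pairE; last exact: ptime_const.
  apply: (lk_cons (listk en) (h := fun=> 0)); first exact: ptime_const.
  apply: (lk_cons (listk en)); first by apply: ptime_cv => //; ptime_var.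
  apply: (lk_cons (listk en)); last exact: ptime_const.
  by apply: ptime_cv => //; ptime_var.
apply: (ptime_cat (listk eC)); first exact: (ptime_cat (listk eC)).
by apply: (ptime_cat (listk eC)); apply: (Hgate (fun V g => c_all r V _ g)) => *; apply: ptime_c_all.
Qed.

End ConstraintPoly.

(** Stated with instances of commuting permutations as values of [f], so that the same maps serve
    both completeness claims. *)
Lemma PLS_hardness P : in_PLS P -> exists (f : bits -> bits) (g : bits -> bits -> bits),
  [/\ ptime (is_instance P) id f,
      ptime (fun=> True) (fun xs => code [:: xs.1; xs.2]) (fun xs => g xs.1 xs.2),
      forall x, is_instance P x -> exists2 I, commuting I & f x = enc_instance I
    & forall x s, is_instance P x -> local_opt PLOM (f x) s -> local_opt P x (g x s)].
Proof.
move=> /PLS_successor [Lp [Cp [H [L0 HH sH spec]]]].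
(* A tableau requires a machine, so the program for [H] is compiled back into one. *)
have [M [p hM]] := prog_to_polytime HH.
pose l (x : bits) := horner Lp (size x); pose c (x : bits) := horner Cp (size x).
(* The length of the input of [M], the instance coded as a word followed by a register. *)
pose len (x : bits) := (2 * size x).+1 + l x.
(* A tape grows by at most one cell on either side per step; the two extra columns keep the right
   edge blank. *)
pose T x := horner p (len x); pose W x := len x + T x + 2.
pose r := 4 * cw M; pose O x := l x + c x.
pose V x := l x + (((T x).+1 * W x) * cw M + O x).
pose ob x := base M (l x) (W x) (T x).+1 0.
pose gs x := circ M (l x) (T x) (W x) (O x) (code_word x).
pose cs x := cstrs r (V x) (l x) (c x) (ob x) (gs x).
pose K x := (V x + V x).+1.
pose f x := plom_of (r + 2) (K x) (cs x).
(* A variable is set exactly when the leading position of its dummy block is moved. These blocks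
   come first, so that this is position [u]. *)
pose bit (y : bits) u := nth 0 (dec_nats y) u != u.
(* The register of the master, which is named by variable 0. *)
pose g x y := unpad [seq bit y (cv (V x) (bit y 0) j) | j <- iota 0 (l x)].
have Hpar A (dom : A -> Prop) inp x : ptime dom inp x ->
  [/\ ptime dom inp (fun a => en (l (x a))), ptime dom inp (fun a => en (c (x a))),
      ptime dom inp (fun a => en (T (x a))), ptime dom inp (fun a => en (W (x a)))
    & ptime dom inp (fun a => en (V (x a)))].
  move=> Hx; have Hs : ptime dom inp (fun a => en (size (x a))) by exact: (ptime_size_of rawk).
  have Hl : ptime dom inp (fun a => en (l (x a))) by exact: ptime_horner.
  have Hc : ptime dom inp (fun a => en (c (x a))) by exact: ptime_horner.
  have Hlen : ptime dom inp (fun a => en (len (x a))).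
    by apply: ptime_addn => //; apply: ptime_succ; apply: ptime_muln => //; apply: ptime_const.
  have HT : ptime dom inp (fun a => en (T (x a))) by exact: ptime_horner.
  have HW : ptime dom inp (fun a => en (W (x a))).
    by apply: ptime_addn; [apply: ptime_addn | apply: ptime_const].
  split=> //; apply: ptime_addn => //; apply: ptime_addn; last exact: ptime_addn.
  by apply: ptime_muln; [apply: ptime_muln => //; apply: ptime_succ | apply: ptime_const].
have r0 : 0 < r by rewrite /r muln_gt0 cw_gt0.
have lx0 x : 0 < l x by exact: L0.
have comp x a : is_instance P x -> size a = l x ->
    output (iter (T x) (@step M) (init_config M (code_word x ++ a))) = H x a.
  move=> ix sa; have [_] := hM (x, a) (conj ix sa).
  by rewrite /ep size_pr /= sa -addSn.
have OW x : is_instance P x -> O x <= W x.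
  (* That the output fits into the tableau is seen from an actual run, here on the register of
     zeros: the output of [M] is no longer than the right part of its tape. *)
  move=> ix; pose a := nseq (l x) false; have sa : size a = l x by rewrite size_nseq.
  have := comp x a ix sa => /(congr1 size); rewrite (sH x a ix sa) -/(l x) -/(c x) -/(O x) => <-.
  have hl (s : seq (symbol (aux M))) : size (leading_bits s) <= size s.
    by elim: s => // -[[b|?]|] s IH //=.
  apply: leq_trans (hl _) _.
  have [_ h] := @size_iter M (code_word x ++ a) (T x) ord_max.
  rewrite size_cat size_code_word sa -/(len x) in h.
  by apply: leq_ltn_trans h _; rewrite /W; lia.
have gs_args x : is_instance P x -> forall g, g \in gs x ->
  [/\ size g.2.1 = r, all (fun v => v < g.1) g.2.1, l x <= g.1 & g.1 < V x].
  move=> ix g0 hg; have [h1 h2] := circ_args (lx0 x) (OW x ix) hg.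
  split=> //; first exact: circ_out_ge hg.
  have : g0.1 \in map fst (gs x) by apply: map_f.
  by rewrite circ_outs mem_iota => /andP[].
have gs_sorted x g1 g0 g2 g' : gs x = g1 ++ g0 :: g2 -> g' \in g1 -> g'.1 < g0.1.
  move=> e hg; have := iota_ltn_sorted (l x) (((T x).+1 * W x) * cw M + O x).
  rewrite -(circ_outs M (l x) (T x) (W x) (O x) (code_word x)) -/(gs x) e map_cat /=.
  rewrite sorted_pairwise; last exact: ltn_trans.
  rewrite pairwise_cat => /and3P[/allrelP h _ _]; apply: h; first exact: map_f.
  exact: mem_head.
have obL x : l x <= ob x by rewrite /ob /base leq_addr.
have obV x : ob x + l x + c x <= V x.
  by rewrite /ob /base /V /O addn0 -!addnA.
have csr x : is_instance P x -> all (fun c => size c.1 == r + 2) (cs x).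
  by move=> ix; apply: size_cstrs => //; apply: gs_args.
have R0 : 0 < r + 2 by lia.
have fE x (ix : is_instance P x) : f x = enc_instance (plom_inst (K x) (csr x ix)).
  by rewrite plom_instE.
exists f, g; split.
- have [Hl Hc HT HW HV] := Hpar _ (is_instance P) id id (ptime_id _ _).
  apply: ptime_plom_of; first by apply: ptime_succ; apply: ptime_addn.
  apply: ptime_cstrs => //.
    by apply: ptime_base => //; [apply: ptime_succ | apply: ptime_const].
  apply: ptime_circ => //; first exact: ptime_addn.
  apply: (@ptime_ext _ _ _ (fun x => pr x [::])); first by move=> x _; rewrite /pr cats0.
  by apply: ptime_pair; [exact: ptime_id | exact: ptime_const].
- set D := fun=> True.
  have [Hl _ _ _ HV] := Hpar _ D (fun xs => code [:: xs.1; xs.2]) _ (@ptime_arg1 D).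
  have Hd := ptime_dec_nats (@ptime_arg2 D).
  have Hbit B (d : B -> Prop) i (y : B -> seq nat) u : ptime d i (fun b => es en (y b)) -> ptime d i (fun b => en (u b)) ->
      ptime d i (fun b => eb (nth 0 (y b) (u b) != u b)).
    move=> Hy Hu; apply: ptime_negb; apply: ptime_eqn => //.
    by apply: (ptime_nth (listk en) (t0 := fun=> 0)) => //; apply: ptime_const.
  have H0 : ptime D (fun xs => code [:: xs.1; xs.2]) (fun xs => eb (bit xs.2 0)).
    by apply: (Hbit _ _ _ (fun xs => dec_nats xs.2) (fun=> 0)) => //; apply: ptime_const.
  apply: ptime_unpad.
  apply: (ptime_map (listk en) rawk (f := fun (xs : bits * bits) j => bit xs.2 (cv (V xs.1) (bit xs.2 0) j))
    (domb := fun x => D x.1)) => //.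
    exact: ptime_iota0.
  apply: (Hbit _ _ _ (fun y => dec_nats y.1.2)); first by ptime_var.
  apply: (ptime_ifE (e := en)); first by ptime_var.
    by apply: ptime_succ; apply: ptime_addn; ptime_var.
  by apply: ptime_succ; ptime_var.
- by move=> x ix; exists (plom_inst (K x) (csr x ix)); [exact: plom_commuting | exact: fE].
move=> x s ix; rewrite (fE x ix) => /plom_local_opt_enc [sg [-> hs lm]].
have [y ey] := plom_group hs; rewrite ey in lm.
have LM u i := @plom_local _ (K x) _ R0 (csr x ix) y u i lm.
have bitE u : u < K x -> bit (enc_perm sg) u = y u.
  move=> hu; rewrite /bit enc_permE enc_natsK ey; apply: (@pact_dummy _ _ R0 _ _ _ (tb (r + 2) (fun=> false))).
    rewrite /cs /cstrs size_cat size_map size_iota; exact: leq_trans hu (leq_addr _ _).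
  by rewrite /cs /cstrs nth_cat size_map size_iota hu (nth_map 0) ?size_iota // nth_iota.
set z := y 0.
pose val b := y \o cv (V x) b.
have out b : [seq val b i | i <- iota (ob x) (O x)] = H x [seq val b j | j <- iota 0 (l x)].
  have sa : size [seq val b j | j <- iota 0 (l x)] = l x by rewrite size_map size_iota.
  apply: (circ_output (lx0 x) (OW x ix) (xw := code_word x)).
  - by move=> g0 hg; apply: (gates_ok r0 (gs_args x ix) (@gs_sorted x) (obL x) (obV x) LM).
  - by rewrite size_cat size_code_word sa -/(len x).
  - exact: comp.
  - exact: sH.
have lV : l x <= V x by rewrite /V leq_addr.
have gE : g x (enc_perm sg) = unpad [seq val z j | j <- iota 0 (l x)].
  rewrite /g bitE // -/z; congr unpad; apply/eq_in_map => j; rewrite mem_iota => hj.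
  by rewrite bitE //; apply: cv_lt; case/andP: hj => _ hj; exact: leq_trans hj lV.
rewrite gE; apply: spec => //; first by rewrite size_map size_iota.
rewrite -/(l x) /= -!out /O iotaD !map_cat.
rewrite take_size_cat ?size_map ?size_iota // drop_size_cat ?size_map ?size_iota //.
(* By the copy constraints the slave holds the successor of the register of the master, so its cost
   output is the cost of that successor. *)
have -> : [seq val z i | i <- iota (ob x) (l x)] = [seq val (~~ z) j | j <- iota 0 (l x)].
  rewrite -[ob x]addn0 iotaDl -map_comp; apply/eq_in_map => j; rewrite mem_iota => hj.
  by rewrite /= /val /= -(slave_copy r0 (gs_args x ix) (obL x) (obV x) LM hj).
rewrite -out /O iotaD map_cat drop_size_cat ?size_map ?size_iota //.
have cE b : [seq val b i | i <- iota (ob x + l x) (c x)] = costs (V x) (l x) (c x) (ob x) y b.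
  by rewrite -[ob x + l x]addn0 iotaDl -map_comp.
rewrite !cE; exact: (costs_le r0 (gs_args x ix) (@gs_sorted x) (obL x) (obV x) LM).
Qed.

(** Restriction changes neither feasibility nor local optima, so one reduction proves both problems
    hard. *)
Theorem theorem4 : PLS_complete PLOM /\ PLS_complete PLOM_commuting.
Proof.
split; split.
- exact: inhabits PLOM_in_PLS.
- move=> P /PLS_hardness [f [g [Hf Hg cI lo]]]; exists f, g; split=> //.
  + exact/polytimeP.
  + by apply/polytimeP; apply: ptime_dom Hg.
  + by move=> x /cI [I _ ->]; exists I.
- exact: inhabits PLOM_commuting_in_PLS.
- move=> P /PLS_hardness [f [g [Hf Hg cI lo]]]; exists f, g; split=> //.
  + exact/polytimeP.
  + by apply/polytimeP; apply: ptime_dom Hg.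
  + by move=> x /cI [I cm ->]; split; [exists I | exists I].
Qed.
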